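(* Consider the leaky Abelian sandpile model (LASM) on $\mathbb Z^d\times\{1,\dots,p\}$ started from $N$ grains at $(0,i_0)$, under Assumption A, and fix a color $j\in\{1,\dots,p\}$ in which the shape of the final configuration is observed. In direction $u\in\mathbb S^{d-1}$, for fixed $N$, the shape of the final configuration of the sandpile lies between the two radii $r_{N,u}$ and $R_{N,u}$ defined in the context. We have $$\lim_{N\to+\infty}\frac{r_{N,u}}{\log N}=\lim_{N\to+\infty}\frac{R_{N,u}}{\log N}=\frac{1}{\Gamma^{-1}(u)\cdot u},$$ and these limits are uniform in $u$. This means that the limit shape of the LASM, rescaled by $\log N$, is delimited by the curve $$\mathcal C=\left\{\frac{u}{\Gamma^{-1}(u)\cdot u}\ :\ u\in\mathbb S^{d-1}\right\},$$ and this limit holds for the Hausdorff distance, and in the stronger sense of uniform convergence of sets defined in the context.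
   Context: Setting. $d,p\ge1$ are integers. For $x\in\mathbb Z^d$, $i,j\in\{1,\dots,p\}$ let $c(x,i,j)\ge 0$, with $\sigma_i:=\sum_{(y,j)\in\mathbb Z^d\times\{1,\dots,p\}}c(y,i,j)<\infty$ (nonzero, so that the following quotient makes sense), and let $m_i\ge1$ be leakiness parameters. Put $\mu_{i,j}(x)=\frac{c(x,i,j)}{m_i\sigma_i}$. The killed random walk (KRW) $(X_n)$ on $(\mathbb Z^d\times\{1,\dots,p\})\sqcup\{\mathsf k\}$ jumps from $(x,i)$ to $(y,j)$ with probability $\mu_{i,j}(y-x)$ and from $(x,i)$ to the cemetery state $\mathsf k$ with probability $1-\frac1{m_i}$. Assumption A: (1) $m_i>1$ for at least one $i$; (2) the KRW is irreducible: for all $x\in\mathbb Z^d$ and all $i,j$, the site $(x,j)$ can be reached from $(0,i)$ with positive probability in some number $n\ge1$ of steps; (3) it is aperiodic: $\gcd\{n\ge1:\mathbb P_{(x,i)}(X_n=(x,i))>0\}=1$ for all $(x,i)$; (4) $\sum_{x\in\mathbb Z^d}e^{\gamma\|x\|}\mu_{i,j}(x)<\infty$ for all $i,j$ and all $\gamma>0$. Sandpile (LASM). A configuration is a function $s:\mathbb Z^d\times\{1,\dots,p\}\to\mathbb R_{\ge0}$. It is stable at $(x,i)$ if $s(x,i)\le m_i\sigma_i$. If it is unstable at $(x,i)$, the site can topple: $s(x,i)$ decreases by $m_i\sigma_i$ and then every $s(y,j)$ increases by $c(y-x,i,j)$. Starting from $N\delta_{(0,i_0)}$ ($N\in\{1,2,\dots\}$),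 sites topple until the configuration is stable; the order of topplings does not matter. A site $(x,i)$ is in the shape of the final configuration if the total mass of sand emitted from $(x,i)$ before stabilization is positive. Green function. $G((0,i),(x,j))=\sum_{n\ge0}\mathbb P_{(0,i)}(X_n=(x,j))$. For fixed $i_0,j$ it is extended continuously from $x\in\mathbb Z^d$ to $x\in\mathbb R^d$ by $G((0,i_0),(x,j))=\frac{\sum_{y\in\mathbb Z^d}\theta(\|x-y\|_\infty)G((0,i_0),(y,j))}{\sum_{y\in\mathbb Z^d}\theta(\|x-y\|_\infty)}$, where $\theta(s)=1-s$ for $s\in[0,1]$ and $\theta(s)=0$ for $s>1$. Put $g_u(r)=G((0,i_0),(ru,j))$ for $u\in\mathbb S^{d-1}$, $r\ge0$. Radii. Let $\alpha,\beta>0$ be constants not depending on $N$ such that, for all $(x,i)$, $G((0,i_0),(x,i))>\alpha/N$ implies that $(x,i)$ is in the shape of the final configuration, and $G((0,i_0),(x,i))<\beta/N$ implies that it is not (such constants exist). Define $r_{N,u}=\inf\{r>0: g_u(r)\le\alpha/N\}$ and $R_{N,u}=\sup\{r>0:g_u(r)\ge\beta/N\}$; these are well defined at least for $N$ large enough. Thus $g_u(r)>\alpha/N$ if $r<r_{N,u}$, and $g_u(r)<\beta/N$ if $r>R_{N,u}$. The map $\Gamma$. For $t\in\mathbb R^d$ let $L\mu(t)$ be the $p\times p$ matrix with entries $\sum_{x\in\mathbb Z^d}e^{t\cdot x}\mu_{i,j}(x)$ and $\rho(t)$ its spectral radius; $\partial\mathcal T=\{t\in\mathbb R^d:\rho(t)=1\}$.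 The map $\Gamma:\partial\mathcal T\to\mathbb S^{d-1}$, $\Gamma(t)=\nabla\rho(t)/\|\nabla\rho(t)\|$, is a homeomorphism, and $\Gamma^{-1}(u)\cdot u>0$ for all $u\in\mathbb S^{d-1}$. Convergence of sets. Let $(E_N)$ be a sequence of subsets of $\mathbb R^d$ and $\mathcal C=\{r_u u: u\in\mathbb S^{d-1}\}$ with $r_u\ge 0$. The limit shape of the sets $E_N$ is said to be delimited by $\mathcal C$ if, for every $u\in\mathbb S^{d-1}$, there exist sequences $(r_{u,N})_N$ and $(R_{u,N})_N$ such that for every $N$, $$\{ru: u\in\mathbb S^{d-1},\ r\le r_{u,N}\}\subset E_N\subset\{Ru: u\in\mathbb S^{d-1},\ R\le R_{u,N}\},$$ and for every $u$, $r_{u,N}\to r_u$ and $R_{u,N}\to r_u$ as $N\to\infty$. The convergence is uniform if moreover $\sup_{u}|r_{u,N}-r_u|\to0$ and $\sup_u|R_{u,N}-r_u|\to0$. Convergence for the Hausdorff distance means $d_H(E_N,E)\to0$, where $E=\{ru: u\in\mathbb S^{d-1},\ 0\le r\le r_u\}$ is the set delimited by $\mathcal C$ and $d_H(X,Y)=\max(\sup_{x\in X}d(x,Y),\sup_{y\in Y}d(y,X))$. Here these notions are applied to the shape of the final configuration rescaled by $\log N$, with $r_u=\frac{1}{\Gamma^{-1}(u)\cdot u}$. $\|\cdot\|$ is the Euclidean norm.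
   Formalization: A set of lattice sites contains no segment, so in the uniform convergence of sets each site of the shape is replaced by the closed unit cube centred at it, radii r are taken nonnegative with r_{u,N} possibly negative, and N starts at 2. *)

(* Defs.v *)
From HB Require Import structures.
From mathcomp Require Export all_boot all_order all_algebra.
From mathcomp Require Export all_classical all_reals all_analysis.
From mathcomp Require Export complex.

Set Implicit Arguments.
Unset Strict Implicit.
Unset Printing Implicit Defensive.

Export Order.TTheory GRing.Theory Num.Theory.
Export numFieldNormedType.Exports.

Local Open Scope classical_set_scope.
Local Open Scope ring_scope.

(* The library norm [`|x|] on ['rV[R]_d] is the sup norm. *)
Definition dotp (R : realType) (d : nat) (x y : 'rV[R]_d) : R :=
  \sum_(k < d) x 0 k * y 0 k.

Definition enorm (R : realType) (d : nat) (x : 'rV[R]_d) : R :=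
  Num.sqrt (dotp x x).

Definition usphere (R : realType) (d : nat) : set 'rV[R]_d :=
  [set u | enorm u = 1].
Arguments usphere {R d}.

Definition latt (R : realType) (d : nat) (x : 'rV[int]_d) : 'rV[R]_d :=
  map_mx intr x.
Arguments latt R {d} x.

Definition gradient (R : realType) (d : nat) (f : 'rV[R]_d -> R)
    (t : 'rV[R]_d) : 'rV[R]_d :=
  \row_k 'D_(delta_mx 0 k) f t.

(* The eigenvalues range over the complex numbers [R[i]]. *)
Definition spectral_radius (R : realType) (p : nat) (A : 'M[R]_p) : R :=
  sup [set ComplexField.Normc.normc z
      | z in [set z : R[i] | eigenvalue (map_mx (real_complex R) A) z]].

(* [c x i j] is the weight of a jump by [x] from colour [i] to colour [j];
   [m i] is the leakiness of colour [i]. *)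
Definition site (d p : nat) := ('rV[int]_d * 'I_p)%type.

Definition sum_rates (R : realType) (d p : nat)
    (c : 'rV[int]_d -> 'I_p -> 'I_p -> R) (i : 'I_p) : \bar R :=
  (\esum_(a in [set: site d p]) (c a.1 i a.2)%:E)%E.

Definition sigma (R : realType) (d p : nat)
    (c : 'rV[int]_d -> 'I_p -> 'I_p -> R) (i : 'I_p) : R :=
  fine (sum_rates c i).

Definition mu (R : realType) (d p : nat)
    (c : 'rV[int]_d -> 'I_p -> 'I_p -> R) (m : 'I_p -> R)
    (i j : 'I_p) (x : 'rV[int]_d) : R :=
  c x i j / (m i * sigma c i).

(* [None] is the cemetery, which is absorbing. *)
Definition krw_step (R : realType) (d p : nat)
    (c : 'rV[int]_d -> 'I_p -> 'I_p -> R) (m : 'I_p -> R)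
    (a b : option (site d p)) : R :=
  match a, b with
  | Some (x, i), Some (y, j) => mu c m i j (y - x)
  | Some (x, i), None => 1 - (m i)^-1
  | None, Some _ => 0
  | None, None => 1
  end.

(* [krw_prob c m n a b] is the probability that [X_n = b] when [X_0 = a]. *)
Fixpoint krw_prob (R : realType) (d p : nat)
    (c : 'rV[int]_d -> 'I_p -> 'I_p -> R) (m : 'I_p -> R)
    (n : nat) (a b : option (site d p)) : \bar R :=
  if n is n'.+1 then
    (\esum_(e in [set: option (site d p)])
       (krw_step c m a e)%:E * krw_prob c m n' e b)%E
  else (a == b)%:R%:E.

Definition krw_irreducible (R : realType) (d p : nat)
    (c : 'rV[int]_d -> 'I_p -> 'I_p -> R) (m : 'I_p -> R) : Prop :=
  forall (x : 'rV[int]_d) (i j : 'I_p),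
    exists n : nat, (1 <= n)%N /\
      (0 < krw_prob c m n (Some (0%R, i)) (Some (x, j)))%E.

Definition is_gcd (S : set nat) (g : nat) : Prop :=
  (forall n, S n -> (g %| n)%N) /\
  (forall k, (forall n, S n -> (k %| n)%N) -> (k %| g)%N).

Definition krw_aperiodic (R : realType) (d p : nat)
    (c : 'rV[int]_d -> 'I_p -> 'I_p -> R) (m : 'I_p -> R) : Prop :=
  forall a : site d p,
    is_gcd [set n | (1 <= n)%N /\
                    (0 < krw_prob c m n (Some a) (Some a))%E] 1.

Definition exp_moments (R : realType) (d p : nat)
    (c : 'rV[int]_d -> 'I_p -> 'I_p -> R) (m : 'I_p -> R) : Prop :=
  forall (i j : 'I_p) (gamma : R), 0 < gamma ->
    (\esum_(x in [set: 'rV[int]_d])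
       (expR (gamma * enorm (latt R x)) * mu c m i j x)%:E < +oo)%E.

Definition lasm_setting (R : realType) (d p : nat)
    (c : 'rV[int]_d -> 'I_p -> 'I_p -> R) (m : 'I_p -> R) : Prop :=
  [/\ forall x i j, 0 <= c x i j,
      forall i, (sum_rates c i < +oo)%E,
      forall i, sum_rates c i != 0%E
    & forall i, 1 <= m i].

Definition assumptionA (R : realType) (d p : nat)
    (c : 'rV[int]_d -> 'I_p -> 'I_p -> R) (m : 'I_p -> R) : Prop :=
  [/\ exists i, 1 < m i,
      krw_irreducible c m,
      krw_aperiodic c m
    & exp_moments c m].

Definition threshold (R : realType) (d p : nat)
    (c : 'rV[int]_d -> 'I_p -> 'I_p -> R) (m : 'I_p -> R) (a : site d p) : R :=
  m a.2 * sigma c a.2.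

Definition topple (R : realType) (d p : nat)
    (c : 'rV[int]_d -> 'I_p -> 'I_p -> R) (m : 'I_p -> R)
    (s : site d p -> R) (a : site d p) : site d p -> R :=
  fun b => s b - (if b == a then threshold c m a else 0)
           + c (b.1 - a.1) a.2 b.2.

Definition stable (R : realType) (d p : nat)
    (c : 'rV[int]_d -> 'I_p -> 'I_p -> R) (m : 'I_p -> R)
    (s : site d p -> R) : Prop :=
  forall a, s a <= threshold c m a.

(* [stabilizing c m s l]: toppling successively the sites of [l] from [s],
   each one being unstable when it topples, ends in a stable configuration. *)
Fixpoint stabilizing (R : realType) (d p : nat)
    (c : 'rV[int]_d -> 'I_p -> 'I_p -> R) (m : 'I_p -> R)
    (s : site d p -> R) (l : seq (site d p)) : Prop :=
  if l is a :: l' then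
    threshold c m a < s a /\ stabilizing c m (topple c m s a) l'
  else stable c m s.

Definition pile (R : realType) (d p : nat) (i0 : 'I_p) (N : nat)
    : site d p -> R :=
  fun a => if a == (0, i0) then N%:R else 0.
Arguments pile R d {p} i0 N.

Definition emitted (R : realType) (d p : nat)
    (c : 'rV[int]_d -> 'I_p -> 'I_p -> R) (m : 'I_p -> R)
    (l : seq (site d p)) (a : site d p) : R :=
  (count_mem a l)%:R * threshold c m a.

(* The order of topplings being irrelevant, any stabilizing sequence may be
   used. *)
Definition in_shape (R : realType) (d p : nat)
    (c : 'rV[int]_d -> 'I_p -> 'I_p -> R) (m : 'I_p -> R) (i0 : 'I_p)
    (N : nat) (a : site d p) : Prop :=
  exists l : seq (site d p),
    stabilizing c m (pile R d i0 N) l /\ 0 < emitted c m l a.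

(* The sites of colour [j] of the shape, seen in R^d and rescaled by log N. *)
Definition lattice_shape (R : realType) (d p : nat)
    (c : 'rV[int]_d -> 'I_p -> 'I_p -> R) (m : 'I_p -> R) (i0 j : 'I_p)
    (N : nat) : set 'rV[R]_d :=
  [set (ln N%:R)^-1 *: latt R x | x in [set x | in_shape c m i0 N (x, j)]].

(* The solid version: each site of the shape is replaced by the closed unit
   cube centred at it (in sup norm) before rescaling. A set of lattice points
   contains no segment, so only this version can contain a region of R^d. *)
Definition solid_shape (R : realType) (d p : nat)
    (c : 'rV[int]_d -> 'I_p -> 'I_p -> R) (m : 'I_p -> R) (i0 j : 'I_p)
    (N : nat) : set 'rV[R]_d :=
  [set (ln N%:R)^-1 *: y
      | y in [set y | exists x : 'rV[int]_d,
                        in_shape c m i0 N (x, j) /\ `|y - latt R x| <= 2^-1]].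

Definition green (R : realType) (d p : nat)
    (c : 'rV[int]_d -> 'I_p -> 'I_p -> R) (m : 'I_p -> R)
    (a b : site d p) : \bar R :=
  (\sum_(0 <= n <oo) krw_prob c m n (Some a) (Some b))%E.

Definition tent (R : realType) (s : R) : R := if s <= 1 then 1 - s else 0.

(* Both sums have finite support, and the norm is the sup norm. *)
Definition green_ext (R : realType) (d p : nat)
    (c : 'rV[int]_d -> 'I_p -> 'I_p -> R) (m : 'I_p -> R) (i0 j : 'I_p)
    (x : 'rV[R]_d) : R :=
  (\sum_(y \in [set: 'rV[int]_d])
     tent `|x - latt R y| * fine (green c m (0, i0) (y, j)))
  / (\sum_(y \in [set: 'rV[int]_d]) tent `|x - latt R y|).

Definition inner_set (R : realType) (d p : nat)
    (c : 'rV[int]_d -> 'I_p -> 'I_p -> R) (m : 'I_p -> R) (i0 j : 'I_p)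
    (alpha : R) (N : nat) (u : 'rV[R]_d) : set R :=
  [set r | 0 < r /\ green_ext c m i0 j (r *: u) <= alpha / N%:R].

Definition outer_set (R : realType) (d p : nat)
    (c : 'rV[int]_d -> 'I_p -> 'I_p -> R) (m : 'I_p -> R) (i0 j : 'I_p)
    (beta : R) (N : nat) (u : 'rV[R]_d) : set R :=
  [set r | 0 < r /\ beta / N%:R <= green_ext c m i0 j (r *: u)].

Definition inner_radius (R : realType) (d p : nat)
    (c : 'rV[int]_d -> 'I_p -> 'I_p -> R) (m : 'I_p -> R) (i0 j : 'I_p)
    (alpha : R) (N : nat) (u : 'rV[R]_d) : R :=
  inf (inner_set c m i0 j alpha N u).

Definition outer_radius (R : realType) (d p : nat)
    (c : 'rV[int]_d -> 'I_p -> 'I_p -> R) (m : 'I_p -> R) (i0 j : 'I_p)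
    (beta : R) (N : nat) (u : 'rV[R]_d) : R :=
  sup (outer_set c m i0 j beta N u).

Definition shape_constants (R : realType) (d p : nat)
    (c : 'rV[int]_d -> 'I_p -> 'I_p -> R) (m : 'I_p -> R) (i0 : 'I_p)
    (alpha beta : R) : Prop :=
  forall (N : nat) (a : site d p), (1 <= N)%N ->
    (((alpha / N%:R)%:E < green c m (0%R, i0) a)%E -> in_shape c m i0 N a) /\
    ((green c m (0%R, i0) a < (beta / N%:R)%:E)%E -> ~ in_shape c m i0 N a).

Definition Lmu (R : realType) (d p : nat)
    (c : 'rV[int]_d -> 'I_p -> 'I_p -> R) (m : 'I_p -> R)
    (t : 'rV[R]_d) : 'M[R]_p :=
  \matrix_(i, j) fine (\esum_(x in [set: 'rV[int]_d])
                         (expR (dotp t (latt R x)) * mu c m i j x)%:E)%E.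

Definition rho (R : realType) (d p : nat)
    (c : 'rV[int]_d -> 'I_p -> 'I_p -> R) (m : 'I_p -> R)
    (t : 'rV[R]_d) : R :=
  spectral_radius (Lmu c m t).

Definition bdT (R : realType) (d p : nat)
    (c : 'rV[int]_d -> 'I_p -> 'I_p -> R) (m : 'I_p -> R) : set 'rV[R]_d :=
  [set t | rho c m t = 1].

Definition Gamma (R : realType) (d p : nat)
    (c : 'rV[int]_d -> 'I_p -> 'I_p -> R) (m : 'I_p -> R)
    (t : 'rV[R]_d) : 'rV[R]_d :=
  (enorm (gradient (rho c m) t))^-1 *: gradient (rho c m) t.

(* Inverse of the restriction of [Gamma] to [bdT] (with a default value 0
   outside of the image, which is the whole sphere). *)
Definition Gamma_inv (R : realType) (d p : nat)
    (c : 'rV[int]_d -> 'I_p -> 'I_p -> R) (m : 'I_p -> R)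
    : 'rV[R]_d -> 'rV[R]_d :=
  'pinv_(fun=> 0) (bdT c m) (Gamma c m).

Definition limit_radius (R : realType) (d p : nat)
    (c : 'rV[int]_d -> 'I_p -> 'I_p -> R) (m : 'I_p -> R)
    (u : 'rV[R]_d) : R :=
  1 / dotp (Gamma_inv c m u) u.

Definition polar_curve (R : realType) (d : nat) (rad : 'rV[R]_d -> R)
    : set 'rV[R]_d :=
  [set rad u *: u | u in usphere].

Definition polar_region (R : realType) (d : nat) (rad : 'rV[R]_d -> R)
    : set 'rV[R]_d :=
  [set z | exists u r, [/\ usphere u, 0 <= r, r <= rad u & z = r *: u]].

(* [rin n u] may be negative, in which case direction [u] imposes nothing. *)
Definition radially_between (R : realType) (d : nat)
    (E : nat -> set 'rV[R]_d) (rin rout : nat -> 'rV[R]_d -> R) : Prop :=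
  forall n, polar_region (rin n) `<=` E n /\ E n `<=` polar_region (rout n).

Definition uniformly_delimited (R : realType) (d : nat)
    (E : nat -> set 'rV[R]_d) (C : set 'rV[R]_d) : Prop :=
  exists (rad : 'rV[R]_d -> R) (rin rout : nat -> 'rV[R]_d -> R),
    [/\ forall u, usphere u -> 0 <= rad u,
        C = polar_curve rad,
        radially_between E rin rout,
        forall u, usphere u -> (rin n u @[n --> \oo] --> rad u) /\
                               (rout n u @[n --> \oo] --> rad u)
      & {uniform usphere, rin @ \oo --> rad} /\
        {uniform usphere, rout @ \oo --> rad}].

Definition set_dist (R : realType) (d : nat) (x : 'rV[R]_d)
    (Y : set 'rV[R]_d) : \bar R :=
  ereal_inf [set (enorm (x - y))%:E | y in Y].

Definition hausdorff_dist (R : realType) (d : nat) (X Y : set 'rV[R]_d)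
    : \bar R :=
  maxe (ereal_sup [set set_dist x Y | x in X])
       (ereal_sup [set set_dist y X | y in Y]).

(* Main.v *)
(* Let T = {rho <= 1} and let h be its support function. The statement reduces to the
   estimate -log G(x) = (1 + o(1)) h(x) for the Green function, uniform in the direction,
   with h(u) = Gamma^-1(u).u.

   By Perron-Frobenius theory and a first-order perturbation of the Perron eigenvectors,
   rho is convex and differentiable. Hence the maximizer t of t.u over T satisfies
   rho(t) = 1 and has a gradient proportional to u, and conversely; moreover t maximizes
   t.v for no other direction v.

   Upper bound: the n-step laws P_n satisfy sum_x e^{t.x} P_n(x) = L(t)^n, and rho < 1 at
   (1 - e)t for t in T, so that G(x) <= C e^{-(1 - e) t.x}; choose t maximizing t.x.

   Lower bound: let t maximize t.u over T. Since rho(t) = 1, sum_x e^{t.x} G(x) diverges.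
   The upper bound makes the directions away from u contribute a finite amount, so that
   some x with a direction close to u and some n satisfy P_n(x) >= e^{-t.x - e|x|}.
   As P_{n+n'}(x + x') >= P_n(x) P_n'(x'), walking along multiples of x gives the
   lower bound in a neighbourhood of the direction u, and the sphere is compact. *)

(* Both radii are divided by log N, so only the logarithmic order of G matters: constants in front
   and factors 1 + e or 1 - e in the exponent are harmless. Convexity alone does not make [rho]
   differentiable; the missing information is an upper bound of order |w|^2 on its symmetric second
   difference, which forbids kinks. Surjectivity of [Gamma] comes from the existence of a maximizer,
   and every preimage of u maximizes t.u, so [dotp (Gamma_inv c m u) u] is the support function
   whichever preimage is chosen. In the lower bound the paths start and end in colour j, so that
   displacements and logarithmic costs add up; i0 enters through one fixed initial path. The limit
   region is the polar body {h <= 1} of T, and the statements on sets reduce to comparing the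
   rescaled shape with {h <= 1 + e} and {h <= 1 - e}. The delimiting radii have to work for every N,
   not only for large N, hence their definition by an infimum. *)
Require Import Defs.
From mathcomp Require Import ring lra zify.

Set Implicit Arguments.
Unset Strict Implicit.
Unset Printing Implicit Defensive.

Local Open Scope classical_set_scope.
Local Open Scope ring_scope.

(** * Euclidean structure and lattice points *)

Section Euclid.
Variables (R : realType) (d : nat).
Implicit Types x y z t : 'rV[R]_d.

Lemma dotpC x y : dotp x y = dotp y x.
Proof. by apply: eq_bigr => k _; rewrite mulrC. Qed.

Lemma dotpDr x y z : dotp x (y + z) = dotp x y + dotp x z.
Proof. by rewrite -big_split; apply: eq_bigr => k _; rewrite mxE mulrDr. Qed.

Lemma dotpDl x y z : dotp (y + z) x = dotp y x + dotp z x.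
Proof. by rewrite dotpC dotpDr !(dotpC x). Qed.

Lemma dotpZr a x y : dotp x (a *: y) = a * dotp x y.
Proof. by rewrite mulr_sumr; apply: eq_bigr => k _; rewrite mxE mulrCA. Qed.

Lemma dotpZl a x y : dotp (a *: x) y = a * dotp x y.
Proof. by rewrite dotpC dotpZr dotpC. Qed.

Lemma dotpNr x y : dotp x (- y) = - dotp x y.
Proof. by rewrite -scaleN1r dotpZr mulN1r. Qed.

Lemma dotpNl x y : dotp (- x) y = - dotp x y.
Proof. by rewrite dotpC dotpNr dotpC. Qed.

Lemma dotpBr x y z : dotp x (y - z) = dotp x y - dotp x z.
Proof. by rewrite dotpDr dotpNr. Qed.

Lemma dotpBl x y z : dotp (y - z) x = dotp y x - dotp z x.
Proof. by rewrite dotpDl dotpNl. Qed.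

Lemma dot0p x : dotp 0 x = 0.
Proof. by rewrite -(scale0r x) dotpZl mul0r. Qed.

Lemma dotp0 x : dotp x 0 = 0.
Proof. by rewrite dotpC dot0p. Qed.

Lemma dotp_ge0 x : 0 <= dotp x x.
Proof. by apply: sumr_ge0 => k _; rewrite -expr2 sqr_ge0. Qed.

Lemma enorm_ge0 x : 0 <= enorm x.
Proof. exact: sqrtr_ge0. Qed.

Lemma enorm_sqr x : enorm x ^+ 2 = dotp x x.
Proof. by rewrite sqr_sqrtr// dotp_ge0. Qed.

Lemma enorm0 : enorm (0 : 'rV[R]_d) = 0.
Proof. by rewrite /enorm dotp0 sqrtr0. Qed.

Lemma enorm_eq0 x : enorm x = 0 -> x = 0.
Proof.
move=> x0; have : dotp x x = 0 by rewrite -enorm_sqr x0 expr0n.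
move/eqP; rewrite psumr_eq0 => [/allP H|k _]; last by rewrite -expr2 sqr_ge0.
apply/rowP => k; rewrite mxE; have := H k (mem_index_enum _).
by rewrite mulf_eq0 orbb => /eqP.
Qed.

Lemma enorm_gt0 x : x != 0 -> 0 < enorm x.
Proof.
move=> xN0; rewrite lt_neqAle enorm_ge0 andbT eq_sym.
by apply: contra xN0 => /eqP/enorm_eq0->.
Qed.

Lemma enormZ a x : enorm (a *: x) = `|a| * enorm x.
Proof.
by rewrite /enorm dotpZl dotpZr mulrA -expr2 sqrtrM ?sqr_ge0// sqrtr_sqr.
Qed.

Lemma enormN x : enorm (- x) = enorm x.
Proof. by rewrite -scaleN1r enormZ normrN1 mul1r. Qed.

Lemma dotp_le x y : dotp x y <= enorm x * enorm y.
Proof.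
have [->|xN0] := eqVneq x 0; first by rewrite dot0p enorm0 mul0r.
have [->|yN0] := eqVneq y 0; first by rewrite dotp0 enorm0 mulr0.
have ab : 0 < enorm x * enorm y by rewrite mulr_gt0// enorm_gt0.
have := dotp_ge0 (enorm y *: x - enorm x *: y).
rewrite dotpBl !dotpBr !dotpZl !dotpZr -!enorm_sqr (dotpC y x) => H.
rewrite -(ler_pM2l ab); nra.
Qed.

Lemma normr_dotp_le x y : `|dotp x y| <= enorm x * enorm y.
Proof.
by rewrite ler_norml dotp_le andbT lerNl -dotpNl -[X in _ <= X * _]enormN dotp_le.
Qed.

Lemma enormD x y : enorm (x + y) <= enorm x + enorm y.
Proof.
rewrite -(@ler_pXn2r _ 2) ?nnegrE ?addr_ge0 ?enorm_ge0//.
rewrite enorm_sqr dotpDl !dotpDr (dotpC y x) sqrrD -!enorm_sqr.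
have := dotp_le x y; lra.
Qed.

Lemma enormB x y : enorm (x - y) <= enorm x + enorm y.
Proof. by rewrite -(enormN y) enormD. Qed.

Lemma enorm_subC x y : enorm (x - y) = enorm (y - x).
Proof. by rewrite -enormN opprB. Qed.

Lemma coord_le_enorm x k : `|x 0 k| <= enorm x.
Proof.
rewrite -sqrtr_sqr ler_wsqrtr// /dotp (bigD1 k)//= expr2 lerDl.
by apply: sumr_ge0 => i _; rewrite -expr2 sqr_ge0.
Qed.

Lemma normr_le_enorm x : `|x| <= enorm x.
Proof.
rewrite [leLHS]/Num.Def.normr/= mx_normrE; apply/bigmax_leP; split.
  exact: enorm_ge0.
by move=> [i k] _; rewrite (ord1 i) coord_le_enorm.
Qed.

Lemma coord_le_normr x k : `|x 0 k| <= `|x|.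
Proof.
rewrite [leRHS]/Num.Def.normr/= mx_normrE.
by apply/bigmax_geP; right; exists (0, k).
Qed.

Lemma enorm_le_sum x : enorm x <= \sum_k `|x 0 k|.
Proof.
rewrite -(@ler_pXn2r _ 2) ?nnegrE ?enorm_ge0 ?sumr_ge0// enorm_sqr.
rewrite expr2 mulr_suml; apply: ler_sum => k _.
apply: (@le_trans _ _ (`|x 0 k| * `|x 0 k|)); first by rewrite -normrM ler_norm.
by apply: ler_wpM2l => //; rewrite (bigD1 k)//= lerDl sumr_ge0.
Qed.

Lemma enorm_le_normr x : enorm x <= d%:R * `|x|.
Proof.
rewrite (le_trans (enorm_le_sum x))//.
rewrite (@le_trans _ _ (\sum_(k < d) `|x|))//.
  by apply: ler_sum => k _; exact: coord_le_normr.
by rewrite sumr_const card_ord mulr_natl.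
Qed.

Lemma near_dist_le x (e : R) : 0 < e -> \forall y \near x, `|x - y| <= e.
Proof. by move=> e0; have /cvgrPdist_le := @cvg_id _ (nbhs x); exact. Qed.

Lemma near_enorm_le x (e : R) : 0 < e -> \forall y \near x, enorm (x - y) <= e.
Proof.
move=> e0; have d1 : 0 < d%:R + 1 :> R by rewrite ltr_wpDl.
near=> y; rewrite (le_trans (enorm_le_normr _))//.
rewrite (@le_trans _ _ ((d%:R + 1) * `|x - y|))//; first by rewrite ler_wpM2r// lerDl.
rewrite -ler_pdivlMl//; near: y; apply: near_dist_le.
by rewrite mulr_gt0// invr_gt0.
Unshelve. all: by end_near. Qed.

Lemma enorm_lipschitz x y : enorm x <= enorm y + enorm (x - y).
Proof. by rewrite -{1}(subrK y x) addrC enormD. Qed.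

(** The constant may depend on [x], as it does in the perturbation bounds for [rho]. *)
Lemma locally_lipschitz_continuous (f : 'rV[R]_d -> R) :
  (forall x, exists2 C, 0 <= C & forall y, enorm (x - y) <= 1 ->
     `|f x - f y| <= C * enorm (x - y)) -> continuous f.
Proof.
move=> H x; have [C C0 HC] := H x.
apply/(@cvgrPdist_le _ _ _ (nbhs x)) => e e0.
have C1 : 0 < C + 1 by rewrite ltr_wpDl.
near=> y; have y1 : enorm (x - y) <= 1 by near: y; exact: near_enorm_le.
have ye : enorm (x - y) <= e / (C + 1).
  by near: y; apply: near_enorm_le; rewrite divr_gt0.
rewrite (le_trans (HC _ y1))// (@le_trans _ _ (C * (e / (C + 1))))//.
  by rewrite ler_wpM2l.
by rewrite mulrA ler_pdivrMr// mulrC ler_pM2l// lerDl.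
Unshelve. all: by end_near. Qed.

Lemma enorm_continuous : continuous (@enorm R d).
Proof.
apply: locally_lipschitz_continuous => x; exists 1 => // y _.
rewrite mul1r ler_distl lerBlDr enorm_lipschitz andbT.
by rewrite enorm_subC enorm_lipschitz.
Qed.

Lemma usphere_compact : compact (@usphere R d).
Proof.
apply: bounded_closed_compact.
  exists 1; split=> // M M1 v /= sv.
  by rewrite (le_trans (normr_le_enorm v))// sv ltW.
rewrite -[usphere]/(@enorm R d @^-1` [set 1]).
by apply: preimage_closed; [move=> x _; exact: enorm_continuous|exact: closed_eq].
Qed.

Lemma usphere_normalize x : x != 0 -> usphere ((enorm x)^-1 *: x).
Proof.
move=> xN0; rewrite /usphere/= enormZ ger0_norm ?invr_ge0 ?enorm_ge0//.
by rewrite mulVf// gt_eqF// enorm_gt0.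
Qed.

Lemma enorm_normalize x : enorm x *: ((enorm x)^-1 *: x) = x.
Proof.
have [->|xN0] := eqVneq x 0; first by rewrite !scaler0.
by rewrite scalerA mulfV ?scale1r// gt_eqF// enorm_gt0.
Qed.

Lemma dotp_delta x k : dotp x (delta_mx 0 k) = x 0 k.
Proof.
rewrite /dotp (bigD1 k)//= mxE !eqxx mulr1 big1 ?addr0// => i ik.
by rewrite mxE eqxx (negbTE ik) mulr0.
Qed.

End Euclid.

Lemma usphere_neset (R : realType) (d : nat) :
  (0 < d)%N -> exists u : 'rV[R]_d, usphere u.
Proof.
case: d => // d _; exists (delta_mx 0 0).
by rewrite /usphere/= /enorm dotp_delta mxE !eqxx sqrtr1.
Qed.

Section Lattice.
Variables (R : realType) (d : nat).

Lemma lattD (x y : 'rV[int]_d) : latt R (x + y) = latt R x + latt R y.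
Proof. by apply/rowP => k; rewrite !mxE; exact: intrD. Qed.

Lemma lattN (x : 'rV[int]_d) : latt R (- x) = - latt R x.
Proof. by apply/rowP => k; rewrite !mxE; exact: mulrNz. Qed.

Lemma lattB (x y : 'rV[int]_d) : latt R (x - y) = latt R x - latt R y.
Proof. by rewrite lattD lattN. Qed.

Lemma latt0 : latt R (0 : 'rV[int]_d) = 0.
Proof. by apply/rowP => k; rewrite !mxE. Qed.

Lemma lattMn (x : 'rV[int]_d) n : latt R (x *+ n) = n%:R *: latt R x.
Proof.
elim: n => [|n IH]; first by rewrite mulr0n latt0 scale0r.
by rewrite mulrS lattD IH -nat1r scalerDl scale1r.
Qed.

Lemma latt_eq0 (x : 'rV[int]_d) : (latt R x == 0) = (x == 0).
Proof.
apply/eqP/eqP => [|->]; last exact: latt0.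
move=> x0; apply/rowP => k; have := congr1 (fun v : 'rV[R]_d => v 0 k) x0.
by rewrite !mxE => /eqP; rewrite intr_eq0 => /eqP.
Qed.

Lemma latt_round (y : 'rV[R]_d) : exists x : 'rV[int]_d, `|y - latt R x| <= 2^-1.
Proof.
exists (\row_k Num.floor (y 0 k + 2^-1)).
rewrite [leLHS]/Num.Def.normr/= mx_normrE; apply/bigmax_leP; split=> //.
move=> [i k] _; rewrite (ord1 i) !mxE.
have := Num.Theory.floor_le (y 0 k + 2^-1); have := Num.Theory.floorD1_gt (y 0 k + 2^-1).
rewrite intrD ler_norml => *; apply/andP; split; lra.
Qed.

End Lattice.

(** * Perron-Frobenius theory *)

Lemma closed_ge0 (R : realType) (T : topologicalType) (f : T -> R) :
  continuous f -> closed [set x | 0 <= f x].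
Proof.
move=> cf; rewrite -[mkset _]/(f @^-1` [set y | 0 <= y]).
by apply: preimage_closed; [move=> x _; exact: cf|exact: closed_ge].
Qed.

Section Perron.
Variables (R : realType) (p : nat).
Implicit Types (A : 'M[R]_p) (v : 'rV[R]_p).

Definition nonneg_mx m n (A : 'M[R]_(m, n)) := forall i j, 0 <= A i j.

(** The exponent 0 is allowed, so the condition only constrains pairs of distinct indices: strong
    connectedness of the graph of A. *)
Definition irreducible_mx A := forall i j, exists n : nat, 0 < (A ^+ n) i j.

Lemma nonneg_mxM m n k (A : 'M[R]_(m, n)) (B : 'M[R]_(n, k)) :
  nonneg_mx A -> nonneg_mx B -> nonneg_mx (A *m B).
Proof. by move=> A0 B0 i j; rewrite mxE sumr_ge0// => l _; rewrite mulr_ge0. Qed.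

Lemma nonneg_mxX A n : nonneg_mx A -> nonneg_mx (A ^+ n).
Proof.
move=> A0; elim: n => [|n IH]; last by rewrite exprS; exact: nonneg_mxM.
by move=> i j; rewrite expr0 mxE ler0n.
Qed.

Lemma trmxX A n : (A ^+ n)^T = A^T ^+ n.
Proof.
elim: n => [|n IH]; first by rewrite !expr0 trmx1.
by rewrite exprS exprSr -IH; exact: trmx_mul.
Qed.

Lemma irreducible_tr A : irreducible_mx A -> irreducible_mx A^T.
Proof. by move=> irrA i j; have [n] := irrA j i; exists n; rewrite -trmxX mxE. Qed.

(** A sum of powers of A, one for each pair of indices, commutes with A and has positive entries,
    even if no single power of A is positive. *)
Lemma irreducible_positive_commuting A :
  nonneg_mx A -> irreducible_mx A ->
  exists2 B : 'M[R]_p, A *m B = B *m A & forall i j, 0 < B i j.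
Proof.
move=> A0 irrA.
have /boolp.choice[N NP] : forall ij : 'I_p * 'I_p, exists n, 0 < (A ^+ n) ij.1 ij.2.
  by case.
exists (\sum_ij A ^+ N ij).
  rewrite mulmx_sumr mulmx_suml; apply: eq_bigr => ij _.
  by rewrite -[LHS]exprS -[RHS]exprSr.
move=> i j; rewrite summxE (bigD1 (i, j))//=.
by rewrite ltr_pwDl ?NP// sumr_ge0// => ij _; exact: nonneg_mxX.
Qed.


Lemma continuous_sumr (T : topologicalType) (I : Type) (s : seq I)
    (f : I -> T -> R) :
  (forall i, continuous (f i)) -> continuous (fun x => \sum_(i <- s) f i x).
Proof.
move=> cf; elim: s => [|i s IH].
  by under eq_fun do rewrite big_nil; exact: cst_continuous.
under eq_fun do rewrite big_cons.
by move=> x; apply: cvgD; [exact: cf|exact: IH].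
Qed.

Definition simplex : set 'rV[R]_p :=
  [set v | (forall i, 0 <= v 0 i) /\ \sum_i v 0 i = 1].

Lemma simplex_le1 v i : simplex v -> v 0 i <= 1.
Proof.
by move=> [v0 <-]; rewrite (bigD1 i)//= lerDl sumr_ge0.
Qed.

Lemma simplex_compact : compact simplex.
Proof.
apply: bounded_closed_compact.
  exists 1; split=> // M M1 v sv /=; rewrite [leLHS]/Num.Def.normr/= mx_normrE.
  apply/bigmax_leP; split; first by rewrite (le_trans _ (ltW M1)).
  move=> [i j] _ /=; rewrite (ord1 i) ger0_norm; last by case: sv.
  exact/(le_trans (simplex_le1 j sv))/ltW.
have -> : simplex = (\bigcap_(i in setT) [set v : 'rV[R]_p | 0 <= v 0 i]) `&`
    [set v : 'rV[R]_p | \sum_i v 0 i = 1].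
  by apply/seteqP; split=> v [H1 H2]; split=> // i; [move=> _; exact: H1|exact: (H1 i I)].
apply: closedI.
  apply: closed_bigI => i _.
  by apply: closed_ge0; exact: coord_continuous.
rewrite -[mkset _]/((fun v : 'rV_p => \sum_i v 0 i) @^-1` [set 1]).
apply: preimage_closed.
  by move=> v _; apply: continuous_sumr => i; exact: coord_continuous.
exact: closed_eq.
Qed.

(* Maximize a over the compact set of pairs (a, v), v in the simplex, with a v <= v A.
   If v A <> a v at the maximum, applying B makes every inequality strict. *)
Lemma perron_left_exists A : (0 < p)%N -> nonneg_mx A -> irreducible_mx A ->
  exists a v, [/\ 0 <= a, forall i, 0 < v 0 i & v *m A = a *: v].
Proof.
move=> p0 A0 irrA.
(* An a priori bound on a: sum a v_j <= (v A)_j over j, where the v_i sum to 1 and are at most 1. *)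
pose M := \sum_i \sum_j A i j.
pose S : set (R * 'rV[R]_p) := (`[0, M]%classic `*` simplex) `&`
  \bigcap_(j in [set: 'I_p]) [set x | 0 <= (x.2 *m A) 0 j - x.1 * x.2 0 j].
have cS : compact S.
  apply: compact_closedI; first by apply: compact_setX; [exact: segment_compact|exact: simplex_compact].
  apply: closed_bigI => j _.
  apply: closed_ge0.
  have c2 k : continuous (fun x : R * 'rV[R]_p => x.2 0 k).
    move=> x; apply: (@continuous_comp _ _ _ snd (fun v : 'rV[R]_p => v 0 k)).
      exact: cvg_snd.
    exact: coord_continuous.
  have cA : continuous (fun x : R * 'rV[R]_p => (x.2 *m A) 0 j).
    under eq_fun do rewrite mxE.
    apply: continuous_sumr => i y.
    by apply: cvgM; [exact: c2|exact: cvg_cst].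
  move=> x; apply: cvgB; first exact: cA.
  apply: cvgM; last exact: c2.
  exact: cvg_fst.
have S0 : S !=set0.
  exists (0, const_mx p%:R^-1); split; first split => /=.
  - by rewrite in_itv/= lexx sumr_ge0// => i _; rewrite sumr_ge0.
  - split=> [i|]; first by rewrite mxE invr_ge0.
    under eq_bigr do rewrite mxE.
    by rewrite sumr_const card_ord -[_ *+ p]mulr_natl divff// pnatr_eq0 -lt0n.
  - move=> j _ /=; rewrite mul0r subr0 mxE sumr_ge0// => i _.
    by rewrite mxE mulr_ge0.
have [[a v]] := @compact_EVT_max _ _ fst S S0 cS
  (continuous_subspaceT (fun x => @cvg_fst _ _ _ _ _)).
rewrite inE => -[[/= aM sv] sup_av] amax.
have {}sup_av j : a * v 0 j <= (v *m A) 0 j by rewrite -subr_ge0; exact: sup_av.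
have a0 : 0 <= a by move: aM; rewrite in_itv/= => /andP[].
have [B AB BP] := irreducible_positive_commuting A0 irrA.
have Bpos (w : 'rV[R]_p) : (forall i, 0 <= w 0 i) -> w != 0 -> forall j, 0 < (w *m B) 0 j.
  move=> w0 wN0 j; rewrite mxE lt_neqAle sumr_ge0 ?andbT; last first.
    by move=> i _; rewrite mulr_ge0// ltW.
  apply: contra wN0; rewrite eq_sym psumr_eq0; last by move=> i _; rewrite mulr_ge0// ltW.
  move=> /allP H; apply/eqP/rowP => i; rewrite mxE.
  by have := H i (mem_index_enum _); rewrite mulf_eq0 (gt_eqF (BP _ _)) orbF => /eqP.
have vN0 : v != 0.
  apply/eqP => v0; case: sv => _; rewrite v0.
  under eq_bigr do rewrite mxE.
  by rewrite big1// => /eqP; rewrite eq_sym oner_eq0.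
have wpos := Bpos v (sv.1) vN0.
set w := v *m B in wpos.
have [vA|vA] := eqVneq (v *m A - a *: v) 0; last first.
  have upos : forall j, 0 < (w *m A) 0 j - a * w 0 j.
    move=> j.
    have -> : (w *m A) 0 j - a * w 0 j = ((v *m A - a *: v) *m B) 0 j.
      by rewrite mulmxBl -!scalemxAl /w -!mulmxA AB !mxE.
    apply: Bpos => // i; rewrite !mxE subr_ge0.
    by have := sup_av i; rewrite mxE.
  pose i0 := Ordinal p0.
  pose Q := \sum_j w 0 j.
  have Q0 : 0 < Q.
    rewrite /Q (bigD1 i0)//= ltr_pwDl// ?sumr_ge0// => i _; exact: ltW.
  (* The least ratio e is positive, so a + e is admissible for [w] rescaled into the simplex,
     against the maximality of a. *)
  have [k _ kmin] := @arg_minP _ _ _ i0 xpredT (fun j => ((w *m A) 0 j - a * w 0 j) / w 0 j) isT.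
  set e := ((w *m A) 0 k - a * w 0 k) / w 0 k in kmin.
  have e0 : 0 < e by rewrite /e divr_gt0.
  have kw j : (a + e) * w 0 j <= (w *m A) 0 j.
    have := kmin j isT; rewrite ler_pdivlMr// => H.
    by rewrite mulrDl addrC -lerBrDr.
  suff : S (a + e, Q^-1 *: w).
    by move=> /mem_set/amax /=; rewrite gerDl leNgt e0.
  have sw : simplex (Q^-1 *: w).
    split=> [i|]; first by rewrite mxE mulr_ge0// ?invr_ge0 ltW.
    under eq_bigr do rewrite mxE.
    by rewrite -mulr_sumr mulVf// gt_eqF.
  have kw' j : (a + e) * (Q^-1 *: w) 0 j <= (Q^-1 *: w *m A) 0 j.
    by rewrite -scalemxAl mxE [X in _ <= X]mxE mulrCA ler_pM2l ?invr_gt0.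
  split; last by move=> j _ /=; rewrite subr_ge0.
  split=> //=; rewrite in_itv/= addr_ge0//=; last exact: ltW.
  have -> : a + e = \sum_j (a + e) * (Q^-1 *: w) 0 j.
    by rewrite -mulr_sumr sw.2 mulr1.
  rewrite /M exchange_big/=; apply: ler_sum => j _.
  apply: (le_trans (kw' j)); rewrite mxE; apply: ler_sum => i _.
  by rewrite ler_piMl//; exact: simplex_le1.
exists a, w; split=> //.
by move/eqP: vA; rewrite subr_eq0 => /eqP vA; rewrite /w -mulmxA -AB mulmxA vA scalemxAl.
Qed.

Lemma normc_sum (I : Type) (s : seq I) (f : I -> R[i]) :
  ComplexField.Normc.normc (\sum_(i <- s) f i) <=
  \sum_(i <- s) ComplexField.Normc.normc (f i).
Proof.
elim: s => [|i s IH]; first by rewrite !big_nil ComplexField.Normc.normc0.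
by rewrite !big_cons (le_trans (le_normcD _ _))// lerD2l.
Qed.

Lemma normc_real (x : R) : ComplexField.Normc.normc (real_complex R x) = `|x|.
Proof. by rewrite /ComplexField.Normc.normc /= expr0n addr0 sqrtr_sqr. Qed.

(** For a complex eigenvector v of eigenvalue z, the moduli satisfy |z| |v| <= |v| A entrywise;
    pairing with the positive vector [r] gives |z| <= a. The value a is attained by [l]. *)
Lemma spectral_radius_perron A (a : R) (l : 'rV[R]_p) (r : 'cV[R]_p) :
  (0 < p)%N -> nonneg_mx A -> 0 <= a ->
  (forall i, 0 < l 0 i) -> (forall i, 0 < r i 0) ->
  l *m A = a *: l -> A *m r = a *: r -> spectral_radius A = a.
Proof.
move=> p0 A0 a0 lP rP lA Ar.
pose i0 := Ordinal p0.
have lN0 : l != 0 by apply: contraTneq (lP i0) => ->; rewrite mxE ltxx.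
have ub z : eigenvalue (map_mx (real_complex R) A) z -> ComplexField.Normc.normc z <= a.
  move=> /eigenvalueP[v vA vN0].
  pose n i := ComplexField.Normc.normc (v 0 i).
  have n0 i : 0 <= n i by rewrite /n; case: (v 0 i) => x y /=; exact: sqrtr_ge0.
  have le_n j : ComplexField.Normc.normc z * n j <= \sum_i n i * A i j.
    rewrite /n -ComplexField.Normc.normcM.
    have -> : z * v 0 j = \sum_i v 0 i * real_complex R (A i j).
      have := congr1 (fun w : 'rV_p => w 0 j) vA; rewrite [X in _ = X]mxE => <-.
      by rewrite mxE; apply: eq_bigr => i _; rewrite !mxE.
    rewrite (le_trans (normc_sum _ _))// ler_sum// => i _.
    by rewrite ComplexField.Normc.normcM normc_real ger0_norm//.
  have [i iN0] : exists i, n i != 0.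
    apply/existsP; rewrite -negb_forall; apply: contra vN0 => /forallP H.
    apply/eqP/rowP => i; rewrite mxE; apply: ComplexField.Normc.eq0_normc.
    exact/eqP/H.
  have sP : 0 < \sum_j n j * r j 0.
    rewrite (bigD1 i)//= ltr_pwDl//.
      by rewrite mulr_gt0// lt_neqAle eq_sym iN0 n0.
    by rewrite sumr_ge0// => j _; rewrite mulr_ge0// ltW.
  rewrite -(ler_pM2r sP) !mulr_sumr.
  apply: (@le_trans _ _ (\sum_j (\sum_i n i * A i j) * r j 0)).
    by apply: ler_sum => j _; rewrite mulrA ler_wpM2r// ltW.
  under eq_bigr do rewrite mulr_suml.
  rewrite exchange_big/=; apply: ler_sum => k _.
  under eq_bigr do rewrite -mulrA.
  rewrite -mulr_sumr mulrCA.
  by have := congr1 (fun w : 'cV_p => w k 0) Ar; rewrite !mxE => ->.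
rewrite /spectral_radius.
set E := mkset _.
have aE : [set ComplexField.Normc.normc z | z in E] a.
  exists (real_complex R a); last by rewrite normc_real ger0_norm.
  rewrite /E/= eigenvalue_map; apply/eigenvalueP; exists l => //.
apply/eqP; rewrite eq_le; apply/andP; split.
  by apply: ge_sup; [exists a|move=> _ [z Ez <-]; exact: ub].
by apply: ub_le_sup => //; exists a => _ [z Ez <-]; exact: ub.
Qed.

End Perron.

Lemma perron (R : realType) (p : nat) (A : 'M[R]_p) :
  (0 < p)%N -> nonneg_mx A -> irreducible_mx A ->
  exists (l : 'rV[R]_p) (r : 'cV[R]_p),
    [/\ forall i, 0 < l 0 i, forall i, 0 < r i 0,
        l *m A = spectral_radius A *: l & A *m r = spectral_radius A *: r].
Proof.
move=> p0 A0 irrA.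
have [a [l [a0 lP lA]]] := perron_left_exists p0 A0 irrA.
have A0' : nonneg_mx A^T by move=> i j; rewrite mxE.
have [b [r [_ rP rA]]] := perron_left_exists p0 A0' (irreducible_tr irrA).
have Ar : A *m r^T = b *: r^T.
  by rewrite -[A]trmxK -trmx_mul rA linearZ.
(* Evaluate l A r on both sides; l r is positive. *)
have ab : a = b.
  have : a *: (l *m r^T) = b *: (l *m r^T).
    by rewrite scalemxAl -lA -mulmxA Ar scalemxAr.
  move=> /(congr1 (fun M : 'M[R]_1 => M 0 0)); rewrite !mxE; apply: mulIf.
  pose i0 := Ordinal p0.
  rewrite gt_eqF// (bigD1 i0)//= ltr_pwDl//; first by rewrite mxE mulr_gt0.
  by rewrite sumr_ge0// => i _; rewrite mxE ltW// mulr_gt0.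
have rP' i : 0 < r^T i 0 by rewrite mxE.
have -> : spectral_radius A = a.
  by apply: (@spectral_radius_perron _ _ _ _ l r^T) => //; rewrite ab.
by exists l, r^T; split=> //; rewrite ab.
Qed.

(** * The killed random walk and its exponential transform *)

Section Esum.
Variable R : realType.
Local Open Scope ereal_scope.

Lemma ge0_esumZl (T : choiceType) (a : R) (f : T -> \bar R) : (0 <= a)%R ->
  (forall x, 0 <= f x) ->
  \esum_(x in [set: T]) (a%:E * f x) = a%:E * \esum_(x in [set: T]) f x.
Proof.
move=> a0 f0.
have le_esumZ (b : R) (g : T -> \bar R) : (0 <= b)%R -> (forall x, 0 <= g x) ->
    \esum_(x in [set: T]) (b%:E * g x) <= b%:E * \esum_(x in [set: T]) g x.
  move=> b0 g0; apply: ge_ereal_sup => /= _ [X [finX _]] <-.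
  rewrite fsbig_finite//= -ge0_sume_distrr//.
  apply: lee_wpmul2l; first by rewrite lee_fin.
  by apply: ereal_sup_ubound; exists X; rewrite ?fsbig_finite.
have [->|aN0] := eqVneq a 0%R.
  by rewrite mul0e esum1// => x _; rewrite mul0e.
have {}a0 : (0 < a)%R by rewrite lt_neqAle eq_sym aN0.
apply/eqP; rewrite eq_le le_esumZ//=; last exact: ltW.
have ai0 : (0 <= a^-1)%R by rewrite invr_ge0 ltW.
have fZ0 x : 0 <= a%:E * f x by rewrite mule_ge0// lee_fin ltW.
(* The reverse inequality is [le_esumZ] for the factor [a^-1] and the function a f. *)
have /(lee_wpmul2l (_ : 0 <= a%:E)) -/(_ (ltW a0)) := le_esumZ _ _ ai0 fZ0.
rewrite muleA -EFinM mulfV// mul1e.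
by under eq_esum do rewrite muleA -EFinM mulVf// mul1e.
Qed.

Lemma esum_ge1 (T : choiceType) (f : T -> \bar R) x : (forall y, 0 <= f y) ->
  f x <= \esum_(y in [set: T]) f y.
Proof.
move=> f0; apply: esum_ge; exists [set x]; first by split; [exact: finite_set1|].
by rewrite fsbig_set1.
Qed.

Lemma esum_fin (I : finType) (f : I -> \bar R) : (forall k, 0 <= f k) ->
  \esum_(k in [set: I]) f k = \sum_k f k.
Proof.
move=> f0; have fI : finite_set [set: I] by exact: finite_finset.
rewrite esum_fset// fsbig_finite//=; apply: perm_big.
apply: uniq_perm; rewrite ?finmap.fset_uniq ?index_enum_uniq// => k.
by rewrite in_fset_set// mem_index_enum in_setT.
Qed.

Lemma esum_prod_ord (T : choiceType) (p : nat) (f : T * 'I_p -> \bar R) :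
  (forall x, 0 <= f x) ->
  \esum_(a in [set: T * 'I_p]) f a = \sum_(k < p) \esum_(x in [set: T]) f (x, k).
Proof.
move=> f0; rewrite -esum_sum//.
transitivity (\esum_(x in [set: T]) \esum_(k in [set: 'I_p]) f (x, k)).
  rewrite esum_esum//.
  rewrite (reindex_esum ([set: T] `*`` (fun=> [set: 'I_p])) _ id)//.
    by apply: eq_esum => -[].
  by split=> // a _; exists a.
by apply: eq_esum => x _; rewrite esum_fin.
Qed.

Lemma exchange_esum (S T : choiceType) (f : S -> T -> \bar R) :
  (forall x y, 0 <= f x y) ->
  \esum_(x in [set: S]) \esum_(y in [set: T]) f x y =
  \esum_(y in [set: T]) \esum_(x in [set: S]) f x y.
Proof.
move=> f0; rewrite !esum_esum//.
rewrite (reindex_esum ([set: T] `*`` (fun=> [set: S])) _ (fun a : T * S => (a.2, a.1)))//.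
split=> //= [[x1 y1] [x2 y2] _ _ [] -> ->//|[x y] _].
by exists (y, x).
Qed.

Lemma esum_option (T : choiceType) (f : option T -> \bar R) :
  (forall a, 0 <= f a) -> f None = 0 ->
  \esum_(a in [set: option T]) f a = \esum_(x in [set: T]) f (Some x).
Proof.
move=> f0 fN; rewrite -(@esum_image _ _ _ [set: T] Some f); last by move=> x y _ _ [].
rewrite [RHS]esum_mkcond; apply: eq_esum => -[x|] _.
  by rewrite mem_set//; exists x.
by case: ifP; rewrite ?fN.
Qed.

End Esum.

(** * Transition probabilities of the killed walk *)

Section KilledWalk.
Variables (R : realType) (d p : nat).
Variables (c : 'rV[int]_d -> 'I_p -> 'I_p -> R) (m : 'I_p -> R).
Hypothesis hset : lasm_setting c m.
Local Open Scope ereal_scope.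

Lemma m_gt0 i : (0 < m i)%R.
Proof. by case: hset => _ _ _ /(_ i); exact: lt_le_trans. Qed.

Lemma sum_ratesE i : sum_rates c i = (sigma c i)%:E.
Proof.
case: hset => c0 cfin _ _; rewrite /sigma fineK// ge0_fin_numE//.
by apply: esum_ge0 => a _; rewrite lee_fin.
Qed.

Lemma sigma_gt0 i : (0 < sigma c i)%R.
Proof.
case: hset => c0 _ /(_ i) + _; rewrite sum_ratesE => cN0.
rewrite -lte_fin lt_neqAle eq_sym cN0 -sum_ratesE.
by apply: esum_ge0 => a _; rewrite lee_fin.
Qed.

Lemma mu_ge0 i k x : (0 <= mu c m i k x)%R.
Proof.
by case: hset => c0 _ _ _; rewrite /mu divr_ge0// mulr_ge0// ltW// ?m_gt0 ?sigma_gt0.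
Qed.

Lemma krw_step_ge0 a b : (0 <= krw_step c m a b)%R.
Proof.
case: a b => [[x i]|] [[y k]|] //=; first exact: mu_ge0.
by case: hset => _ _ _ m1; rewrite subr_ge0 invf_le1// m_gt0.
Qed.

Lemma krw_prob_ge0 n a b : 0 <= krw_prob c m n a b.
Proof.
elim: n a => [|n IH] a /=; first by rewrite lee_fin.
by apply: esum_ge0 => e _; rewrite mule_ge0// lee_fin krw_step_ge0.
Qed.

Lemma krw_probSE n a b : krw_prob c m n.+1 a b =
  \esum_(e in [set: option (site d p)]) (krw_step c m a e)%:E * krw_prob c m n e b.
Proof. by []. Qed.

Lemma krw_prob_None n b : krw_prob c m n None (Some b) = 0.
Proof.
elim: n => [|n IH] //=; rewrite esum1// => -[e|] _ /=; first by rewrite mul0e.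
by rewrite IH mule0.
Qed.

Lemma krw_probS n x i b : krw_prob c m n.+1 (Some (x, i)) (Some b) =
  \sum_(k < p) \esum_(z in [set: 'rV[int]_d])
     (mu c m i k z)%:E * krw_prob c m n (Some ((x + z)%R, k)) (Some b).
Proof.
rewrite krw_probSE esum_option; last first.
- by rewrite krw_prob_None mule0.
- by move=> e; rewrite mule_ge0 ?krw_prob_ge0// lee_fin krw_step_ge0.
rewrite esum_prod_ord; last first.
  by move=> e; rewrite mule_ge0 ?krw_prob_ge0// lee_fin krw_step_ge0.
apply: eq_bigr => k _.
rewrite (reindex_esum [set: 'rV[int]_d] _ (fun z => (x + z)%R)); last first.
  by split.
by apply: eq_esum => z _ /=; rewrite [(x + z)%R]addrC addrK.
Qed.

Lemma krw_prob_shift n z x i y k :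
  krw_prob c m n (Some ((x + z)%R, i)) (Some ((y + z)%R, k)) =
  krw_prob c m n (Some (x, i)) (Some (y, k)).
Proof.
elim: n x i => [|n IH] x i.
  rewrite /=; congr (_%:R%:E)%R; congr nat_of_bool.
  by apply/eqP/eqP => [[/addIr -> ->]|[-> ->]].
rewrite !krw_probS; apply: eq_bigr => l _; apply: eq_esum => w _.
by rewrite addrAC IH.
Qed.

(** The walk commutes with translations, so its n-step law depends only on the displacement and on
    the two colours. *)
Definition pstep n i k (x : 'rV[int]_d) : \bar R :=
  krw_prob c m n (Some (0%R, i)) (Some (x, k)).

Lemma pstep_ge0 n i k x : 0 <= pstep n i k x.
Proof. exact: krw_prob_ge0. Qed.

Lemma pstep_shift n i k x y :
  krw_prob c m n (Some (x, i)) (Some (y, k)) = pstep n i k (y - x)%R.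
Proof. by rewrite /pstep -(krw_prob_shift n x 0%R i (y - x)%R k) add0r subrK. Qed.

Lemma pstepS n i k x : pstep n.+1 i k x =
  \sum_(l < p) \esum_(z in [set: 'rV[int]_d])
     (mu c m i l z)%:E * pstep n l k (x - z)%R.
Proof.
rewrite /pstep krw_probS; apply: eq_bigr => l _; apply: eq_esum => z _.
by rewrite add0r pstep_shift.
Qed.

Lemma pstep0 i k x : pstep 0 i k x = ((x == 0%R) && (i == k))%:R%:E.
Proof.
rewrite /pstep /=; congr (_%:R%:E)%R; congr nat_of_bool.
by apply/eqP/andP => [[<- <-]|[/eqP -> /eqP ->]].
Qed.

Hypothesis hexp : exp_moments c m.

Lemma exp_moment_fin i k (a : R) :
  \esum_(x in [set: 'rV[int]_d])
     (expR (a * enorm (latt R x)) * mu c m i k x)%:E < +oo.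
Proof.
have g1 : (0 < `|a| + 1)%R by rewrite ltr_wpDl.
apply: le_lt_trans (hexp i k g1); apply: le_esum => x _.
rewrite lee_fin ler_wpM2r ?mu_ge0// ler_expR ler_wpM2r ?enorm_ge0//.
by rewrite (le_trans (ler_norm _))// lerDl.
Qed.

Lemma LmuE t i k : (Lmu c m t i k)%:E =
  \esum_(x in [set: 'rV[int]_d]) (expR (dotp t (latt R x)) * mu c m i k x)%:E.
Proof.
rewrite mxE fineK// ge0_fin_numE; last first.
  by apply: esum_ge0 => x _; rewrite lee_fin mulr_ge0 ?expR_ge0 ?mu_ge0.
apply: le_lt_trans (exp_moment_fin i k (enorm t)); apply: le_esum => x _.
by rewrite lee_fin ler_wpM2r ?mu_ge0// ler_expR dotp_le.
Qed.

Lemma Lmu_nonneg t : nonneg_mx (Lmu c m t).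
Proof.
move=> i k; rewrite -lee_fin LmuE; apply: esum_ge0 => x _.
by rewrite lee_fin mulr_ge0 ?expR_ge0 ?mu_ge0.
Qed.

Lemma esum_reflect_shift x (f : 'rV[int]_d -> \bar R) :
  \esum_(y in [set: 'rV[int]_d]) f (y - x)%R = \esum_(y in [set: 'rV[int]_d]) f y.
Proof.
rewrite [RHS](reindex_esum [set: 'rV[int]_d] _ (fun y => (y - x)%R))//.
split; first by [].
  by move=> ? ? _ _ /= /addIr.
by move=> y _; exists (y + x)%R => //; rewrite addrK.
Qed.

(** A step is a convolution in the displacement and a matrix product in the colours; the exponential
    transform turns it into multiplication by [Lmu c m t]. All terms are nonnegative, so sums are
    exchanged without any summability condition. *)
Lemma pstep_transform n t i k :
  \esum_(x in [set: 'rV[int]_d]) (expR (dotp t (latt R x)))%:E * pstep n i k x =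
  ((Lmu c m t ^+ n)%R i k)%:E.
Proof.
have e0 (x : 'rV[int]_d) : (0 <= expR (dotp t (latt R x)))%R by exact: expR_ge0.
elim: n i => [|n IH] i.
  rewrite expr0 mxE; under eq_esum do rewrite pstep0.
  rewrite (esumID [set 0%R])/=; last by move=> x _; rewrite mule_ge0// lee_fin.
  rewrite setTI esum_set1 ?mule_ge0 ?lee_fin//.
  rewrite eqxx latt0 dotp0 expR0 mul1e esum1 ?adde0// => x [_ /eqP/negbTE xN0].
  by rewrite xN0 mule0.
rewrite exprS mxE -sumEFin.
rewrite (eq_esum (b := fun x => \sum_l \esum_(z in [set: 'rV[int]_d])
   (expR (dotp t (latt R z)) * mu c m i l z)%:E *
   ((expR (dotp t (latt R (x - z)%R)))%:E * pstep n l k (x - z)%R))); last first.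
  move=> x _; rewrite pstepS ge0_sume_distrr; last first.
    move=> l _; apply: esum_ge0 => z _.
    by rewrite mule_ge0 ?pstep_ge0// lee_fin mu_ge0.
  apply: eq_bigr => l _; rewrite -ge0_esumZl//; last first.
    by move=> z; rewrite mule_ge0 ?pstep_ge0// lee_fin mu_ge0.
  apply: eq_esum => z _.
  rewrite !muleA -!EFinM mulrAC -expRD -dotpDr -lattD; congr (_%:E * _).
  by rewrite addrC subrK.
have g0 l (x z : 'rV[int]_d) : 0 <= (expR (dotp t (latt R z)) * mu c m i l z)%:E *
   ((expR (dotp t (latt R (x - z)%R)))%:E * pstep n l k (x - z)%R).
  rewrite !mule_ge0 ?pstep_ge0 ?lee_fin//.
  by rewrite mulr_ge0 ?mu_ge0.
rewrite esum_sum; last by move=> x l _ _; apply: esum_ge0.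
apply: eq_bigr => l _.
rewrite exchange_esum//.
rewrite EFinM LmuE muleC -ge0_esumZl; last first.
- by move=> x; rewrite lee_fin mulr_ge0 ?mu_ge0.
- exact/nonneg_mxX/Lmu_nonneg.
apply: eq_esum => z _; rewrite ge0_esumZl; last first.
- by move=> x; rewrite mule_ge0 ?pstep_ge0 ?lee_fin.
- by rewrite mulr_ge0 ?mu_ge0.
rewrite muleC -(IH l); congr (_ * _).
exact: (esum_reflect_shift z (fun x => (expR (dotp t (latt R x)))%:E * pstep n l k x)).
Qed.

(** One term of the transform: a Chernoff bound in which [t] remains free. *)
Lemma pstep_exp_le n t i k x :
  (expR (dotp t (latt R x)))%:E * pstep n i k x <= ((Lmu c m t ^+ n)%R i k)%:E.
Proof.
rewrite -pstep_transform.
apply: (@esum_ge1 _ _ (fun x => (expR (dotp t (latt R x)))%:E * pstep n i k x)).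
by move=> y; rewrite mule_ge0 ?pstep_ge0// lee_fin expR_ge0.
Qed.

Lemma pstep_fin n i k x : pstep n i k x \is a fin_num.
Proof.
rewrite ge0_fin_numE ?pstep_ge0//; have := pstep_exp_le n 0%R i k x.
by rewrite dot0p expR0 mul1e => /le_lt_trans; apply; rewrite ltry.
Qed.

(** Keep only the paths that have displacement [x] and colour [k] at time [n]. *)
Lemma pstep_mul_le n n' i k l x y :
  pstep n i k x * pstep n' k l y <= pstep (n + n') i l (x + y)%R.
Proof.
elim: n i x => [|n IH] i x.
  rewrite pstep0 add0n; have [->|xN0] := eqVneq x 0%R; last by rewrite mul0e pstep_ge0.
  have [->|iNk] := eqVneq i k; last by rewrite mul0e pstep_ge0.
  by rewrite mul1e add0r.
rewrite addSn !pstepS ge0_sume_distrl; last first.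
  move=> s _; apply: esum_ge0 => z _.
  by rewrite mule_ge0 ?pstep_ge0// lee_fin mu_ge0.
apply: lee_sum => s _.
rewrite muleC -{1}(fineK (pstep_fin n' k l y)) -ge0_esumZl; last first.
- by move=> z; rewrite mule_ge0 ?pstep_ge0// lee_fin mu_ge0.
- by rewrite fine_ge0 ?pstep_ge0.
apply: le_esum => z _.
rewrite fineK ?pstep_fin// muleCA; apply: lee_wpmul2l; first by rewrite lee_fin mu_ge0.
by rewrite muleC addrAC IH.
Qed.

End KilledWalk.

(** * Perturbation of the spectral radius *)

Local Opaque spectral_radius.

Section Perturbation.
Variables (R : realType) (p : nat).
Hypothesis p0 : (0 < p)%N.
Implicit Types (A D : 'M[R]_p) (l : 'rV[R]_p) (r v : 'cV[R]_p).

Definition pairing l v : R := \sum_i l 0 i * v i 0.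

Lemma pairing_mulmx l v : (l *m v) 0 0 = pairing l v.
Proof. by rewrite mxE. Qed.

Lemma pairingD l v w : pairing l (v + w) = pairing l v + pairing l w.
Proof. by rewrite -big_split; apply: eq_bigr => i _; rewrite mxE mulrDr. Qed.

Lemma pairingZ l a v : pairing l (a *: v) = a * pairing l v.
Proof. by rewrite mulr_sumr; apply: eq_bigr => i _; rewrite mxE mulrCA. Qed.

Lemma pairingZl l a v : pairing (a *: l) v = a * pairing l v.
Proof. by rewrite mulr_sumr; apply: eq_bigr => i _; rewrite mxE mulrA. Qed.

Lemma pairingB l v w : pairing l (v - w) = pairing l v - pairing l w.
Proof. by rewrite -[- w]scaleN1r pairingD pairingZ mulN1r. Qed.

Lemma pairing_mulA l A v : pairing l (A *m v) = pairing (l *m A) v.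
Proof. by rewrite -!pairing_mulmx mulmxA. Qed.

Lemma pairing_gt0 l v :
  (forall i, 0 < l 0 i) -> (forall i, 0 < v i 0) -> 0 < pairing l v.
Proof.
move=> lP vP; rewrite /pairing (bigD1 (Ordinal p0))//= ltr_pwDl ?mulr_gt0//.
by rewrite sumr_ge0// => i _; rewrite mulr_ge0// ltW.
Qed.

Lemma eigenvector_expr A a v n : A *m v = a *: v -> A ^+ n *m v = a ^+ n *: v.
Proof.
move=> Av; elim: n => [|n IH]; first by rewrite !expr0 mul1mx scale1r.
by rewrite exprSr -[A ^+ n * A]/(A ^+ n *m A) -mulmxA Av -scalemxAr IH scalerA exprS.
Qed.

(** If v_i were zero, every term of (A^n v)_i would vanish, including (A^n)_ik v_k, which is
    positive for a suitable n. *)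
Lemma eigenvector_pos A a v : nonneg_mx A -> irreducible_mx A ->
  (forall i, 0 <= v i 0) -> A *m v = a *: v -> v != 0 -> forall i, 0 < v i 0.
Proof.
move=> A0 irrA v0 Av vN0 i.
have [k vk] : exists k, v k 0 != 0.
  apply/existsP; rewrite -negb_forall; apply: contra vN0 => /forallP H.
  by apply/eqP/colP => k; rewrite mxE; exact/eqP/H.
have [n AnP] := irrA i k.
rewrite lt_neqAle v0 andbT eq_sym; apply: contraTneq AnP => vi0.
have := congr1 (fun w : 'cV[R]_p => w i 0) (eigenvector_expr n Av); rewrite !mxE vi0 mulr0.
move=> /eqP; rewrite psumr_eq0; last first.
  by move=> l _; rewrite mulr_ge0//; exact: nonneg_mxX.
move=> /allP /(_ k (mem_index_enum _)); rewrite mulf_eq0 (negbTE vk) orbF => /eqP ->.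
by rewrite ltxx.
Qed.

(** Pairing with [l] forces equality in a |v| <= A |v|, so |v| is an eigenvector, and so is the
    nonnegative vector |v| - v. It is zero or positive: either v >= 0 or v < 0 entrywise, and l v =
    0 leaves only v = 0. *)
Lemma perron_simple A a l v : nonneg_mx A -> irreducible_mx A ->
  (forall i, 0 < l 0 i) -> l *m A = a *: l -> A *m v = a *: v ->
  pairing l v = 0 -> v = 0.
Proof.
move=> A0 irrA lP lA Av lv.
pose w : 'cV[R]_p := \col_i (`|v i 0|).
have le_w i : a * w i 0 <= (A *m w) i 0.
  have : a * v i 0 = (A *m v) i 0 by rewrite Av mxE.
  rewrite !mxE => avi.
  apply: (@le_trans _ _ `|a * v i 0|).
    by rewrite normrM ler_wpM2r// ler_norm.
  rewrite avi (le_trans (ler_norm_sum _ _ _))// ler_sum// => k _.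
  by rewrite normrM ger0_norm// mxE.
have Aw : A *m w = a *: w.
  have eq0 : \sum_i l 0 i * ((A *m w) i 0 - a * w i 0) = 0.
    under eq_bigr do rewrite mulrBr.
    rewrite sumrB; apply/eqP; rewrite subr_eq0; apply/eqP.
    rewrite -[LHS]/(pairing l (A *m w)) -pairing_mulmx mulmxA lA -scalemxAl mxE.
    by rewrite pairing_mulmx /pairing mulr_sumr; apply: eq_bigr => i _; rewrite mulrCA.
  move/eqP: eq0; rewrite psumr_eq0; last first.
    by move=> i _; rewrite mulr_ge0// ?subr_ge0// ltW.
  move=> /allP H; apply/colP => i; rewrite [RHS]mxE.
  have := H i (mem_index_enum _); rewrite mulf_eq0 (gt_eqF (lP i))/= subr_eq0.
  by move/eqP.
have wv0 i : 0 <= (w - v) i 0 by rewrite !mxE subr_ge0 ler_norm.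
have Awv : A *m (w - v) = a *: (w - v) by rewrite mulmxBr Aw Av scalerBr.
have [wv|wvN0] := eqVneq (w - v) 0.
  have v0 i : 0 <= v i 0.
    have := congr1 (fun w : 'cV[R]_p => w i 0) wv; rewrite !mxE => /eqP.
    by rewrite subr_eq0 => /eqP <-.
  move/eqP: lv; rewrite psumr_eq0; last by move=> i _; rewrite mulr_ge0// ltW.
  move=> /allP H; apply/colP => i; rewrite mxE.
  by have := H i (mem_index_enum _); rewrite mulf_eq0 (gt_eqF (lP i))/= => /eqP.
have wvP := eigenvector_pos A0 irrA wv0 Awv wvN0.
have vneg i : v i 0 < 0.
  have := wvP i; rewrite !mxE subr_gt0; apply: contraTT; rewrite -!leNgt => vi0.
  by rewrite ger0_norm.
suff : 0 < pairing l (- v).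
  rewrite /pairing; under eq_bigr do rewrite mxE mulrN.
  by rewrite sumrN -/(pairing l v) lv oppr0 ltxx.
by apply: pairing_gt0 => // i; rewrite mxE oppr_gt0.
Qed.

Lemma bilinear_le l D v e : (forall i k, `|D i k| <= e) ->
  `|pairing l (D *m v)| <= (\sum_i `|l 0 i|) * e * \sum_k `|v k 0|.
Proof.
move=> De; rewrite /pairing (le_trans (ler_norm_sum _ _ _))//.
rewrite -mulrA mulr_suml ler_sum// => i _; rewrite normrM ler_wpM2l// mxE.
rewrite (le_trans (ler_norm_sum _ _ _))// mulr_sumr ler_sum// => k _.
by rewrite normrM ler_wpM2r.
Qed.

(** Normalizing with a fixed [l], not with the left eigenvector of A, bounds r independently of A,
    since each l_i r_i is at most 1. This gives one bound for all perturbations of a matrix. *)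
Lemma perron_normalized A l : (forall i, 0 < l 0 i) ->
  nonneg_mx A -> irreducible_mx A ->
  exists r, [/\ forall i, 0 < r i 0, A *m r = spectral_radius A *: r,
    pairing l r = 1 & \sum_i `|r i 0| <= \sum_i (l 0 i)^-1].
Proof.
move=> lP A0 irrA; have [_ [r [_ rP _ Ar]]] := perron p0 A0 irrA.
have lr := pairing_gt0 lP rP.
pose r' := (pairing l r)^-1 *: r.
have r'P i : 0 < r' i 0 by rewrite mxE mulr_gt0// invr_gt0.
have lr' : pairing l r' = 1.
  rewrite /pairing; under eq_bigr do rewrite mxE mulrCA.
  by rewrite -mulr_sumr mulVf// gt_eqF.
exists r'; split=> //; first by rewrite -scalemxAr Ar scalerA mulrC -scalerA.
rewrite ler_sum// => i _; rewrite gtr0_norm//.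
rewrite -(ler_pM2l (lP i)) mulfV ?gt_eqF// -lr' /pairing (bigD1 i)//= lerDl.
by rewrite sumr_ge0// => k _; rewrite mulr_ge0// ltW.
Qed.

(* With l r = 1, the matrix a - A + r l is invertible; it maps the difference of the
   normalized right eigenvectors of A' and A to a vector of size O(A' - A). *)
Lemma spectral_radius_second_difference A :
  nonneg_mx A -> irreducible_mx A ->
  exists2 C, 0 <= C & forall e f A1 A2, 0 <= e ->
    nonneg_mx A1 -> irreducible_mx A1 -> nonneg_mx A2 -> irreducible_mx A2 ->
    (forall i k, `|(A1 - A) i k| <= e) -> (forall i k, `|(A2 - A) i k| <= e) ->
    (forall i k, `|(A1 + A2 - A *+ 2) i k| <= f) ->
    `|spectral_radius A1 - spectral_radius A| <= C * e /\
    spectral_radius A1 + spectral_radius A2 - spectral_radius A *+ 2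
      <= C * (e ^+ 2 + f).
Proof.
move=> A0 irrA; have [l [_ [lP _ lA _]]] := perron p0 A0 irrA.
have [r [rP Ar lr rb]] := perron_normalized lP A0 irrA.
move: (spectral_radius A) lA Ar => a lA Ar.
pose M := a%:M - A + r *m l.
have Munit : M \in unitmx.
  rewrite -unitmx_tr -row_free_unit -kermx_eq0; apply/eqP/row_matrixP => i.
  rewrite row0; set w := row i _.
  have wM : w *m M^T = 0.
    by apply/sub_kermxP; exact: row_sub.
  have Mw : M *m w^T = 0 by rewrite -[M]trmxK -trmx_mul wM trmx0.
  have lw : pairing l w^T = 0.
    rewrite -pairing_mulmx.
    have : l *m (M *m w^T) = 0 by rewrite Mw mulmx0.
    rewrite mulmxA /M mulmxDr mulmxBr mul_mx_scalar lA subrr add0r mulmxA.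
    have -> : l *m r = 1%:M.
      by apply/matrixP => i1 i2; rewrite (ord1 i1) (ord1 i2) pairing_mulmx lr mxE.
    by rewrite mul1mx => ->; rewrite mxE.
  apply: trmx_inj; rewrite trmx0; apply: (perron_simple A0 irrA lP lA _ lw).
  move: Mw; rewrite /M mulmxDl mulmxBl mul_scalar_mx -mulmxA.
  have -> : l *m w^T = 0.
    by apply/matrixP => i1 i2; rewrite (ord1 i1) (ord1 i2) pairing_mulmx lw mxE.
  by rewrite mulmx0 addr0 => /eqP; rewrite subr_eq0 => /eqP ->.
pose L := \sum_i `|l 0 i|; pose B := \sum_i (l 0 i)^-1.
pose N := \sum_i \sum_k `|invmx M i k|.
have L0 : 0 <= L by exact: sumr_ge0.
have N0 : 0 <= N by apply: sumr_ge0 => i _; exact: sumr_ge0.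
have B0 : 0 <= B by apply: sumr_ge0 => i _; rewrite invr_ge0 ltW.
have first A' r' e : A' *m r' = spectral_radius A' *: r' -> pairing l r' = 1 ->
    \sum_i `|r' i 0| <= B -> (forall i k, `|(A' - A) i k| <= e) ->
    spectral_radius A' - a = pairing l ((A' - A) *m r') /\
    (0 <= e -> `|spectral_radius A' - a| <= L * B * e /\
      \sum_i `|(r' - r) i 0| <= N * ((L * B + 1) * B * e)).
  move=> Ar' lr' rb' dA.
  (* Pair the eigenvector equation of r' with l, using l A = a l and l r' = 1. *)
  have eqa : spectral_radius A' - a = pairing l ((A' - A) *m r').
    by rewrite mulmxBl Ar' pairingB pairingZ (pairing_mulA l A r') lA pairingZl lr' (mulr1 a) mulr1.
  split=> // e0.
  have ea : `|spectral_radius A' - a| <= L * B * e.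
    rewrite eqa (le_trans (bilinear_le _ _ dA))// mulrAC ler_wpM2r//.
    by rewrite ler_wpM2l.
  split=> //.
  (* As l (r' - r) = 0, the matrix M acts on r' - r as a - A, and this gives y, which is of first
     order in A' - A. *)
  pose y := (a - spectral_radius A') *: r' + (A' - A) *m r'.
  have rE : r' - r = invmx M *m y.
    apply: (canRL (mulKmx Munit)).
    have -> : M *m (r' - r) = a *: (r' - r) - A *m (r' - r).
      rewrite /M mulmxDl mulmxBl mul_scalar_mx.
      have -> : r *m l *m (r' - r) = 0; last by rewrite addr0.
      rewrite -mulmxA mulmxBr (_ : l *m r' - l *m r = 0) ?mulmx0//.
      by apply/matrixP => i1 i2; rewrite (ord1 i1) (ord1 i2) !mxE -!/(pairing _ _) lr lr' subrr.
    rewrite mulmxBr Ar scalerBr /y mulmxBl Ar' scalerBl.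
    by rewrite opprB !addrA !subrK.
  have yb k : `|y k 0| <= (L * B + 1) * B * e.
    rewrite /y mxE (le_trans (ler_normD _ _))// !mulrDl mul1r lerD//.
      rewrite mxE normrM distrC mulrAC ler_pM//.
      by rewrite (le_trans _ rb')// (bigD1 k)//= lerDl sumr_ge0.
    rewrite mxE (le_trans (ler_norm_sum _ _ _))// mulrC.
    rewrite (@le_trans _ _ (\sum_i e * `|r' i 0|))//.
      by rewrite ler_sum// => i _; rewrite normrM ler_wpM2r.
    by rewrite -mulr_sumr ler_wpM2l.
  rewrite rE /N mulr_suml ler_sum// => i _; rewrite mxE.
  rewrite (le_trans (ler_norm_sum _ _ _))// mulr_suml ler_sum// => k _.
  by rewrite normrM ler_wpM2l.
pose C1 := N * ((L * B + 1) * B).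
have C10 : 0 <= C1 by rewrite !mulr_ge0// addr_ge0// mulr_ge0.
exists (L * B + L * C1 *+ 2).
  by rewrite addr_ge0//; [exact: mulr_ge0|exact/mulrn_wge0/mulr_ge0].
move=> e f A1 A2 e0 A10 irrA1 A20 irrA2 d1 d2 d12.
have [r1 [_ Ar1 lr1 rb1]] := perron_normalized lP A10 irrA1.
have [r2 [_ Ar2 lr2 rb2]] := perron_normalized lP A20 irrA2.
have [E1 /(_ e0)[F1 G1]] := first _ _ _ Ar1 lr1 rb1 d1.
have [E2 /(_ e0)[F2 G2]] := first _ _ _ Ar2 lr2 rb2 d2.
clear Ar1 Ar2; move: (spectral_radius A1) (spectral_radius A2) E1 F1 E2 F2.
move=> s1 s2 E1 F1 E2 F2.
split.
  by rewrite (le_trans F1)// ler_wpM2r// lerDl; exact/mulrn_wge0/mulr_ge0.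
(* Replacing r1 and r2 by r isolates the second difference of the matrices; each error term is a
   product of two first-order quantities. *)
have -> : s1 + s2 - a *+ 2 =
    pairing l ((A1 + A2 - A *+ 2) *m r) + pairing l ((A1 - A) *m (r1 - r))
    + pairing l ((A2 - A) *m (r2 - r)).
  have id2 (x y z : R) : x + y - z *+ 2 = (x - z) + (y - z) by ring.
  have id4 (x y z w : R) : x + y = z + w + (x - z) + (y - w) by ring.
  rewrite id2 E1 E2.
  have -> : A1 + A2 - A *+ 2 = (A1 - A) + (A2 - A) by rewrite mulr2n opprD addrACA.
  rewrite (mulmxDl (A1 - A)) pairingD (mulmxBr (A1 - A)) (mulmxBr (A2 - A)).
  rewrite (pairingB l ((A1 - A) *m r1)) (pairingB l ((A2 - A) *m r2)).
  exact: id4.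
have H0 := le_trans (ler_norm _) (bilinear_le l r d12).
have H1 := le_trans (ler_norm _) (bilinear_le l (r1 - r) d1).
have H2 := le_trans (ler_norm _) (bilinear_le l (r2 - r) d2).
have f0 : 0 <= f by exact: (le_trans (normr_ge0 _) (d12 (Ordinal p0) (Ordinal p0))).
have H0' : L * f * (\sum_k `|r k 0|) <= L * f * B by rewrite ler_wpM2l// mulr_ge0.
have H1' : L * e * (\sum_k `|(r1 - r) k 0|) <= L * e * (C1 * e).
  by rewrite ler_wpM2l ?mulr_ge0// (le_trans G1)// /C1 !mulrA.
have H2' : L * e * (\sum_k `|(r2 - r) k 0|) <= L * e * (C1 * e).
  by rewrite ler_wpM2l ?mulr_ge0// (le_trans G2)// /C1 !mulrA.
rewrite -!/L in H0 H1 H2.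
have LB : 0 <= L * B by rewrite mulr_ge0.
have LC : 0 <= L * C1 by rewrite mulr_ge0.
have LBe : 0 <= L * B * e ^+ 2 by rewrite mulr_ge0// sqr_ge0.
have LCf : 0 <= L * C1 * f by rewrite mulr_ge0.
rewrite (@le_trans _ _ (L * f * B + L * e * (C1 * e) *+ 2))//.
  by rewrite mulr2n addrA !lerD// ?(le_trans H0)// ?(le_trans H1)// ?(le_trans H2).
rewrite -subr_ge0 (_ : _ - _ = L * B * e ^+ 2 + L * C1 * f *+ 2); last by ring.
by rewrite addr_ge0// mulrn_wge0.
Qed.

End Perturbation.

(** * Convexity and regularity of rho *)

Section ExpIneq.
Variable R : realType.
Implicit Types a b : R.

Lemma expR_sub1_le a : expR a - 1 <= a * expR a.
Proof.
have := expR_ge1Dx (- a); rewrite expRN => H.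
have e0 := expR_gt0 a.
have := ler_wpM2r (ltW e0) H; rewrite mulVf ?gt_eqF// => {}H; nra.
Qed.

Lemma normr_expR_sub1 a : `|expR a - 1| <= `|a| * expR `|a|.
Proof.
rewrite ler_norml; apply/andP; split.
  rewrite lerNl opprB.
  have h1 := expR_ge1Dx a; have := ler_norm (- a); rewrite normrN => h2.
  have h3 : 1 <= expR `|a| by rewrite -expR0 ler_expR.
  have h4 : 0 <= `|a| by [].
  nra.
rewrite (le_trans (expR_sub1_le a))//.
rewrite (@le_trans _ _ (`|a| * expR a))//; first by rewrite ler_wpM2r ?expR_ge0// ler_norm.
by rewrite ler_wpM2l// ler_expR ler_norm.
Qed.

Lemma le_expR a : a <= expR a.
Proof. by apply: le_trans (expR_ge1Dx a); rewrite lerDr. Qed.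

Lemma expR_convex (u a b : R) : 0 <= u <= 1 ->
  expR ((1 - u) * a + u * b) <= (1 - u) * expR a + u * expR b.
Proof.
move=> /andP[u0 u1]; set z := (1 - u) * a + u * b.
have ha : expR z * (1 + (a - z)) <= expR a.
  rewrite (_ : expR a = expR z * expR (a - z)); last by rewrite -expRD addrC subrK.
  by rewrite ler_pM2l ?expR_gt0// expR_ge1Dx.
have hb : expR z * (1 + (b - z)) <= expR b.
  rewrite (_ : expR b = expR z * expR (b - z)); last by rewrite -expRD addrC subrK.
  by rewrite ler_pM2l ?expR_gt0// expR_ge1Dx.
have -> : expR z = (1 - u) * (expR z * (1 + (a - z))) + u * (expR z * (1 + (b - z))).
  rewrite /z; ring.
by rewrite lerD// ler_wpM2l// subr_ge0.
Qed.

Variable d : nat.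
Implicit Types t w x : 'rV[R]_d.

(** The exponent [enorm t + 5] is that of the second-order bound, so that both perturbations are
    controlled by the same moment. *)
Lemma expR_dotp_perturb1 t w x : enorm w <= 1 ->
  `|expR (dotp (t + w) x) - expR (dotp t x)| <=
  enorm w * expR ((enorm t + 5) * enorm x).
Proof.
move=> w1; rewrite dotpDl expRD -[X in _ - X]mulr1 -mulrBr normrM.
rewrite (ger0_norm (expR_ge0 _)); set X := enorm x.
have X0 : 0 <= X by exact: enorm_ge0.
have aX : `|dotp w x| <= enorm w * X by exact: normr_dotp_le.
have aX' : `|dotp w x| <= X by rewrite (le_trans aX)// ler_piMl.
have -> : (enorm t + 5) * X = enorm t * X + (X + (X + 3 * X)) by ring.
rewrite expRD mulrCA; apply: ler_pM; rewrite ?expR_ge0//.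
  by rewrite ler_expR dotp_le.
rewrite (le_trans (normr_expR_sub1 _))// expRD mulrA.
apply: ler_pM; rewrite ?expR_ge0//.
  by rewrite (le_trans aX)// ler_wpM2l ?enorm_ge0// le_expR.
by rewrite ler_expR (le_trans aX')// lerDl mulr_ge0.
Qed.

(** With a = w.x, the second difference is e^{t.x} e^{-a} (e^a - 1)^2. The factor e^{-a} costs one
    |x| in the exponent, and the square of |w| e^{2|x|} costs four: hence 5. *)
Lemma expR_dotp_perturb2 t w x : enorm w <= 1 ->
  expR (dotp (t + w) x) + expR (dotp (t - w) x) <=
  2 * expR (dotp t x) + enorm w ^+ 2 * expR ((enorm t + 5) * enorm x).
Proof.
move=> w1; rewrite !dotpDl dotpNl !expRD; set X := enorm x.
have X0 : 0 <= X by exact: enorm_ge0.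
set a := dotp w x.
have aX : `|a| <= enorm w * X by exact: normr_dotp_le.
have aX' : `|a| <= X by rewrite (le_trans aX)// ler_piMl.
have -> : (enorm t + 5) * X = enorm t * X + (X + (X + X + (X + X))) by ring.
rewrite -lerBlDl [expR (enorm t * X + _)]expRD [X in _ <= X]mulrCA.
have -> : expR (dotp t x) * expR a + expR (dotp t x) * expR (- a)
   - 2 * expR (dotp t x) = expR (dotp t x) * (expR (- a) * `|expR a - 1| ^+ 2).
  rewrite real_normK ?num_real//.
  have E : expR a * expR (- a) = 1 by rewrite -expRD subrr expR0.
  have -> : expR (- a) * (expR a - 1) ^+ 2 =
    (expR a * expR (- a)) * expR a - 2 * (expR a * expR (- a)) + expR (- a) by ring.
  rewrite E; ring.
have Y0 : 0 <= expR (- a) * `|expR a - 1| ^+ 2 by rewrite mulr_ge0 ?expR_ge0// sqr_ge0.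
apply: ler_pM => //; rewrite ?expR_ge0// ?ler_expR ?dotp_le//.
rewrite expRD [leRHS]mulrCA; apply: ler_pM; rewrite ?expR_ge0 ?sqr_ge0//.
  by rewrite ler_expR (le_trans _ aX')// -normrN ler_norm.
have -> : enorm w ^+ 2 * expR (X + X + (X + X)) = (enorm w * expR X * expR X) ^+ 2.
  by rewrite !expRD; ring.
rewrite lerXn2r ?nnegrE ?mulr_ge0 ?expR_ge0 ?enorm_ge0//.
rewrite (le_trans (normr_expR_sub1 _))// ler_pM ?expR_ge0 ?ler_expR//.
by rewrite (le_trans aX)// ler_wpM2l ?enorm_ge0// le_expR.
Qed.

End ExpIneq.

(** * The spectral radius of the exponential transform *)

Section Rho.
Variables (R : realType) (d p : nat).
Variables (c : 'rV[int]_d -> 'I_p -> 'I_p -> R) (m : 'I_p -> R).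
Hypothesis hset : lasm_setting c m.
Hypothesis hA : assumptionA c m.
Hypothesis p0 : (0 < p)%N.
Implicit Types s t v w : 'rV[R]_d.
Local Notation L := (Lmu c m).
Local Notation rho := (rho c m).

Let hexp : exp_moments c m. Proof. by case: hA. Qed.

Definition exp_moment (g : R) i k : R :=
  fine (\esum_(x in [set: 'rV[int]_d])
     (expR (g * enorm (latt R x)) * mu c m i k x)%:E)%E.

Lemma exp_momentE g i k : (exp_moment g i k)%:E =
  (\esum_(x in [set: 'rV[int]_d])
     (expR (g * enorm (latt R x)) * mu c m i k x)%:E)%E.
Proof.
rewrite fineK// ge0_fin_numE ?exp_moment_fin//.
by apply: esum_ge0 => x _; rewrite lee_fin mulr_ge0 ?expR_ge0 ?mu_ge0.
Qed.

Lemma exp_moment_ge0 g i k : 0 <= exp_moment g i k.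
Proof.
apply/fine_ge0/esum_ge0 => x _; rewrite lee_fin mulr_ge0 ?expR_ge0//.
exact: mu_ge0.
Qed.

Local Opaque exp_moment Lmu.

Lemma Lmu_sumE (q : seq (R * 'rV[R]_d)) i k : all (fun x => 0 <= x.1) q ->
  (\sum_(a <- q) a.1 * L a.2 i k)%:E =
  (\esum_(x in [set: 'rV[int]_d])
    ((\sum_(a <- q) a.1 * expR (dotp a.2 (latt R x))) * mu c m i k x)%:E)%E.
Proof.
move=> /allP q0'; have q0 a : a \in q -> 0 <= a.1 by exact: q0'.
have mu0 x : 0 <= mu c m i k x by exact: mu_ge0.
under eq_esum do rewrite mulr_suml -sumEFin big_seq.
rewrite -sumEFin big_seq esum_sum; last first.
  by move=> x a _ aq; rewrite lee_fin mulr_ge0// mulr_ge0 ?expR_ge0 ?q0.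
apply: eq_bigr => a aq.
under eq_esum do rewrite -mulrA EFinM.
rewrite ge0_esumZl ?q0//; last first.
  by move=> x; rewrite lee_fin mulr_ge0 ?expR_ge0.
by rewrite EFinM LmuE.
Qed.

(** Integrates a pointwise inequality between exponentials against the jump weights. Coefficients
    are nonnegative on both sides, since the sums are taken in the nonnegative extended reals;
    differences are therefore written across the inequality. *)
Lemma Lmu_le_comb (q q' : seq (R * 'rV[R]_d)) (b g : R) i k :
  all (fun x => 0 <= x.1) q -> all (fun x => 0 <= x.1) q' -> 0 <= b ->
  (forall x, \sum_(a <- q) a.1 * expR (dotp a.2 x) <=
             \sum_(a <- q') a.1 * expR (dotp a.2 x) + b * expR (g * enorm x)) ->
  \sum_(a <- q) a.1 * L a.2 i k <=
  \sum_(a <- q') a.1 * L a.2 i k + b * exp_moment g i k.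
Proof.
move=> q0 q0' b0 H; rewrite -lee_fin EFinD EFinM !Lmu_sumE// exp_momentE.
have mu0 x : 0 <= mu c m i k x by exact: mu_ge0.
rewrite -ge0_esumZl//; last by move=> x; rewrite lee_fin mulr_ge0 ?expR_ge0.
rewrite -esumD; last 2 first.
- move=> x _; rewrite lee_fin mulr_ge0// big_seq sumr_ge0// => a aq.
  by rewrite mulr_ge0 ?expR_ge0//; move/allP : q0' => /(_ _ aq).
- by move=> x _; rewrite -EFinM lee_fin mulr_ge0// mulr_ge0 ?expR_ge0.
apply: le_esum => x _; rewrite -EFinM -EFinD lee_fin (mulrA b) -mulrDl.
by rewrite ler_wpM2r.
Qed.

Lemma Lmu_le_comb2 (a1 a2 b1 b2 b g : R) t1 t2 s1 s2 i k :
  0 <= a1 -> 0 <= a2 -> 0 <= b1 -> 0 <= b2 -> 0 <= b ->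
  (forall x, a1 * expR (dotp t1 x) + a2 * expR (dotp t2 x) <=
     b1 * expR (dotp s1 x) + b2 * expR (dotp s2 x) + b * expR (g * enorm x)) ->
  a1 * L t1 i k + a2 * L t2 i k <=
  b1 * L s1 i k + b2 * L s2 i k + b * exp_moment g i k.
Proof.
move=> a10 a20 b10 b20 b0 H.
have sum2 x1 x2 y1 y2 (F : 'rV[R]_d -> R) :
    \sum_(a <- [:: (x1, y1); (x2, y2)]) a.1 * F a.2 = x1 * F y1 + x2 * F y2.
  by rewrite !big_cons big_nil addr0.
have := @Lmu_le_comb [:: (a1, t1); (a2, t2)] [:: (b1, s1); (b2, s2)] b g i k.
rewrite !(sum2 _ _ _ _ (fun t => L t i k)); apply => //=.
- by rewrite a10 a20.
- by rewrite b10 b20.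
by move=> x; rewrite !(sum2 _ _ _ _ (fun t => expR (dotp t x))).
Qed.

Lemma second_difference_mxE (A B C : 'M[R]_p) i k :
  (A + B - C *+ 2) i k = A i k + B i k - 2 * C i k.
Proof. by rewrite !mxE; ring. Qed.

Definition moment_bound t : R :=
  \sum_i \sum_k exp_moment (enorm t + 5) i k.

Lemma moment_bound_ge t i k : exp_moment (enorm t + 5) i k <= moment_bound t.
Proof.
rewrite /moment_bound (bigD1 i)//= (bigD1 k)//= -addrA lerDl addr_ge0//.
  by rewrite sumr_ge0// => l _; exact: exp_moment_ge0.
by rewrite sumr_ge0// => l _; rewrite sumr_ge0// => l' _; exact: exp_moment_ge0.
Qed.

Lemma moment_bound_ge0 t : 0 <= moment_bound t.
Proof.
by rewrite sumr_ge0// => l _; rewrite sumr_ge0// => l' _; exact: exp_moment_ge0.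
Qed.

Lemma Lmu_perturb1 t w i k : enorm w <= 1 ->
  `|(L (t + w) - L t) i k| <= enorm w * moment_bound t.
Proof.
move=> w1; rewrite [(L (t + w) - L t) i k]mxE [(- L t) i k]mxE.
rewrite (@le_trans _ _ (enorm w * exp_moment (enorm t + 5) i k))//; last first.
  by rewrite ler_wpM2l ?enorm_ge0// moment_bound_ge.
have w0 := enorm_ge0 w.
(* Zero coefficients bring a one-term inequality into the two-term form of [Lmu_le_comb2]. *)
have unpad (x y z y' f : R) : (1 * x + 0 * y <= 1 * z + 0 * y' + f) = (x <= z + f).
  by rewrite !mul1r !mul0r !addr0.
rewrite ler_distl lerBlDr; apply/andP; split.
  rewrite -(unpad _ (L t i k) _ (L t i k)); apply: Lmu_le_comb2 => // x.
  rewrite unpad -lerBlDl.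
  by rewrite (le_trans _ (expR_dotp_perturb1 t x w1))// distrC ler_norm.
rewrite -(unpad _ (L t i k) _ (L t i k)); apply: Lmu_le_comb2 => // x.
rewrite unpad -lerBlDl.
by rewrite (le_trans _ (expR_dotp_perturb1 t x w1))// ler_norm.
Qed.

Lemma Lmu_perturb2 t w i k : enorm w <= 1 ->
  `|(L (t + w) + L (t - w) - L t *+ 2) i k| <= enorm w ^+ 2 * moment_bound t.
Proof.
move=> w1; rewrite second_difference_mxE.
rewrite (@le_trans _ _ (enorm w ^+ 2 * exp_moment (enorm t + 5) i k))//; last first.
  by rewrite ler_wpM2l ?sqr_ge0// moment_bound_ge.
have unpad (x y z z' f : R) :
    (1 * x + 1 * y <= 2 * z + 0 * z' + f) = (x + y <= 2 * z + f).
  by rewrite !mul1r mul0r addr0.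
have unpad' (x x' y z f : R) :
    (2 * x + 0 * x' <= 1 * y + 1 * z + 0 * f) = (2 * x <= y + z).
  by rewrite !mul1r !mul0r !addr0.
rewrite ger0_norm.
  rewrite lerBlDl -(unpad _ _ _ (L t i k)); apply: Lmu_le_comb2 => // [|x].
    exact: sqr_ge0.
  by rewrite unpad; exact: expR_dotp_perturb2.
rewrite subr_ge0 -(unpad' _ (L t i k) _ _ (exp_moment 0 i k)).
apply: Lmu_le_comb2 => // x; rewrite unpad' !dotpDl dotpNl.
move: (dotp t x) (dotp w x) => a b.
have h01 : 0 <= (2^-1 : R) <= 1 by apply/andP; split; lra.
have := @expR_convex _ 2^-1 (a + b) (a - b) h01.
have -> : (1 - 2^-1) * (a + b) + 2^-1 * (a - b) = a by field.
move: (expR (a + b)) (expR (a - b)) (expR _) => x1 x2 x3.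
rewrite (_ : (1 - 2^-1) * x1 + 2^-1 * x2 = 2^-1 * (x1 + x2)); last by field.
by rewrite mulrC ler_pdivlMr// mulrC.
Qed.

Lemma Lmu_irreducible t : irreducible_mx (L t).
Proof.
case: hA => _ irr _ _ i k; have [n [_ nP]] := irr 0 i k; exists n.
rewrite -lte_fin; apply: lt_le_trans (pstep_exp_le hset hexp n t i k 0).
by rewrite latt0 dotp0 expR0 mul1e.
Qed.

Lemma rho_perron t : exists (l : 'rV[R]_p) (r : 'cV[R]_p),
  [/\ forall i, 0 < l 0 i, forall i, 0 < r i 0,
      l *m L t = rho t *: l & L t *m r = rho t *: r].
Proof. exact: perron p0 (Lmu_nonneg hset hexp t) (Lmu_irreducible t). Qed.

(** The Collatz-Wielandt bound: pair the inequality with the positive left eigenvector. *)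
Lemma rho_le t a (v : 'cV[R]_p) : (forall i, 0 < v i 0) ->
  (forall i, (L t *m v) i 0 <= a * v i 0) -> rho t <= a.
Proof.
move=> vP H; have [l [_ [lP _ lL _]]] := rho_perron t.
have lv := pairing_gt0 p0 lP vP.
rewrite -(ler_pM2r lv) -pairingZl -lL -pairing_mulA -pairingZ.
by apply: ler_sum => i _; rewrite [(a *: v) i 0]mxE ler_wpM2l// ltW.
Qed.

Lemma rho_ge0 t : 0 <= rho t.
Proof.
have [l [r [_ rP _ Lr]]] := rho_perron t.
have := congr1 (fun v : 'cV[R]_p => v (Ordinal p0) 0) Lr; rewrite !mxE => E.
rewrite -(pmulr_lge0 _ (rP (Ordinal p0))) -E sumr_ge0// => k _.
by rewrite mulr_ge0 ?Lmu_nonneg// ltW.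
Qed.

(* The test vector is the weighted geometric mean of the Perron eigenvectors at s and t. *)
Lemma rho_convex s t u : 0 <= u <= 1 ->
  rho ((1 - u) *: s + u *: t) <= (1 - u) * rho s + u * rho t.
Proof.
move=> u01; have /andP[u0 u1] := u01.
have [_ [r [_ rP _ Lr]]] := rho_perron s.
have [_ [r' [_ r'P _ Lr']]] := rho_perron t.
pose f i := (1 - u) * ln (r i 0) + u * ln (r' i 0).
apply: (@rho_le _ _ (\col_i expR (f i))) => [i|i]; first by rewrite mxE expR_gt0.
(* Convexity of exp between s.x + ln r_k - ln r_i and t.x + ln r'_k - ln r'_i, summed over x. *)
have HL k : L ((1 - u) *: s + u *: t) i k * expR (f k) <=
   ((1 - u) * (r k 0 / r i 0) * L s i k + u * (r' k 0 / r' i 0) * L t i k) * expR (f i).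
  have H := @Lmu_le_comb2 (expR (f k - f i)) 0 ((1 - u) * (r k 0 / r i 0))
    (u * (r' k 0 / r' i 0)) 0 0 ((1 - u) *: s + u *: t) 0 s t i k.
  rewrite !(mul0r (L _ _ _)) (mul0r (exp_moment _ _ _)) !addr0 in H.
  have -> : L ((1 - u) *: s + u *: t) i k * expR (f k) =
      expR (f k - f i) * L ((1 - u) *: s + u *: t) i k * expR (f i).
    by rewrite [RHS]mulrAC -expRD subrK mulrC.
  rewrite ler_pM2r ?expR_gt0//; apply: H => //.
  - by rewrite mulr_ge0 ?subr_ge0// divr_ge0// ltW.
  - by rewrite mulr_ge0// divr_ge0// ltW.
  move=> x; rewrite !mul0r !addr0.
  have := @expR_convex _ u (dotp s x + (ln (r k 0) - ln (r i 0)))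
    (dotp t x + (ln (r' k 0) - ln (r' i 0))) u01.
  have e (y : R) (a b : R) : 0 < a -> 0 < b -> expR (y + (ln a - ln b)) = a / b * expR y.
    by move=> a0 b0; rewrite expRD expRD expRN !lnK ?posrE// mulrC.
  rewrite !e// !mulrA; apply: le_trans.
  rewrite -!expRD ler_expR dotpDl !dotpZl /f; lra.
rewrite [X in X <= _]mxE [X in _ <= _ * X]mxE.
apply: (@le_trans _ _ (\sum_k ((1 - u) * (r k 0 / r i 0) * L s i k +
    u * (r' k 0 / r' i 0) * L t i k) * expR (f i))).
  by apply: ler_sum => k _; rewrite [X in _ * X]mxE.
rewrite -mulr_suml ler_pM2r ?expR_gt0// big_split/= lerD//.
  under eq_bigr do rewrite -mulrA.
  rewrite -mulr_sumr ler_wpM2l ?subr_ge0//.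
  have := congr1 (fun v : 'cV[R]_p => v i 0) Lr; rewrite !mxE => E.
  under eq_bigr do rewrite mulrAC [r _ _ * _]mulrC.
  by rewrite -mulr_suml E mulfK// gt_eqF.
under eq_bigr do rewrite -mulrA.
rewrite -mulr_sumr ler_wpM2l//.
have := congr1 (fun v : 'cV[R]_p => v i 0) Lr'; rewrite !mxE => E.
under eq_bigr do rewrite mulrAC [r' _ _ * _]mulrC.
by rewrite -mulr_suml E mulfK// gt_eqF.
Qed.

(** The second difference is bounded from above only; convexity makes it nonnegative. *)
Lemma rho_perturb t : exists2 C, 0 <= C & forall w, enorm w <= 1 ->
  `|rho (t + w) - rho t| <= C * enorm w /\
  rho (t + w) + rho (t - w) - rho t *+ 2 <= C * enorm w ^+ 2.
Proof.
have [C C0 H] := spectral_radius_second_difference p0 (Lmu_nonneg hset hexp t) (Lmu_irreducible t).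
pose K := moment_bound t.
have K0 : 0 <= K by exact: moment_bound_ge0.
exists (C * (K ^+ 2 + K)) => [|w w1]; first by rewrite mulr_ge0// addr_ge0// sqr_ge0.
have w0 := enorm_ge0 w.
have /= [] := H (enorm w * K) (enorm w ^+ 2 * K) (L (t + w)) (L (t - w)) (mulr_ge0 w0 K0)
  (Lmu_nonneg hset hexp _) (@Lmu_irreducible _) (Lmu_nonneg hset hexp _) (@Lmu_irreducible _).
- by move=> i k; exact: Lmu_perturb1.
- by move=> i k; rewrite /K -(enormN w); apply: Lmu_perturb1; rewrite enormN.
- by move=> i k; exact: Lmu_perturb2.
move=> H1 H2; split.
  by rewrite (le_trans H1)// -mulrA ler_wpM2l// mulrC ler_wpM2r// lerDr sqr_ge0.
by rewrite (le_trans H2)// exprMn -mulrDr -mulrA [X in C * X]mulrC.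
Qed.

End Rho.

Lemma ler_of_linear_error (R : realType) (a b K e : R) : 0 <= K -> 0 < e ->
  (forall h, 0 < h -> h <= e -> a <= b + K * h) -> a <= b.
Proof.
move=> K0 e0 H; apply/ler_addgt0Pr => x x0.
have h0 : 0 < Num.min e (x / (K + 1)) by rewrite lt_min e0/= divr_gt0// ltr_wpDl.
apply: (le_trans (H _ h0 _)); first by rewrite ge_min lexx.
rewrite lerD2l (@le_trans _ _ (K * (x / (K + 1))))//.
  by rewrite ler_wpM2l// ge_min lexx orbT.
rewrite mulrCA ler_piMr ?(ltW x0)// ler_pdivrMr ?ltr_wpDl//.
by rewrite mul1r lerDl.
Qed.

Lemma exists_small_step (R : realType) (d : nat) (v : 'rV[R]_d) :
  exists2 e : R, 0 < e & forall h, 0 <= h -> h <= e -> enorm (h *: v) <= 1.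
Proof.
have v0 : 0 < enorm v + 1 by rewrite ltr_wpDl ?enorm_ge0.
exists (enorm v + 1)^-1; first by rewrite invr_gt0.
move=> h h0 he; rewrite enormZ ger0_norm//.
rewrite (@le_trans _ _ ((enorm v + 1)^-1 * (enorm v + 1)))//.
  by rewrite ler_pM ?enorm_ge0// lerDl.
by rewrite mulVf// gt_eqF.
Qed.

(* A convex function whose symmetric second difference is O(|w|^2) at t has linear
   directional derivatives at t, although it is not assumed to be differentiable. *)
Section ConvexGradient.
Variables (R : realType) (d : nat) (f : 'rV[R]_d -> R) (t : 'rV[R]_d) (C : R).
Implicit Types v w s : 'rV[R]_d.
Hypothesis fconvex : forall s s' u, 0 <= u <= 1 ->
  f ((1 - u) *: s + u *: s') <= (1 - u) * f s + u * f s'.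
Hypothesis C0 : 0 <= C.
Hypothesis fsecond : forall w, enorm w <= 1 ->
  f (t + w) + f (t - w) - f t *+ 2 <= C * enorm w ^+ 2.

(** By convexity every left difference quotient at t is at most every right one; the infimum of the
    right ones is the slope of a supporting line along [v]. *)
Let slope_exists v : exists D, forall h, f t + h * D <= f (t + h *: v).
Proof.
pose Q := [set (f (t + h *: v) - f t) / h | h in [set h : R | 0 < h]].
have lbQ h : 0 < h -> lbound Q ((f t - f (t - h *: v)) / h).
  move=> h0 _ [k /= k0 <-].
  rewrite ler_pdivrMr// mulrAC ler_pdivlMr//.
  have hk : 0 < h + k by rewrite addr_gt0.
  have u01 : 0 <= h / (h + k) <= 1.
    by rewrite divr_ge0 ?(ltW h0) ?(ltW hk)//= ler_pdivrMr// mul1r lerDl ltW.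
  have := fconvex (t - h *: v) (t + k *: v) u01.
  have -> : (1 - h / (h + k)) *: (t - h *: v) + (h / (h + k)) *: (t + k *: v) = t.
    apply/rowP => i; rewrite !mxE; field; exact: lt0r_neq0.
  have -> : 1 - h / (h + k) = k / (h + k) by field; exact: lt0r_neq0.
  move: (f t) (f (t - h *: v)) (f (t + k *: v)) => a b e H.
  have : (h + k) * a <= k * b + h * e.
    rewrite mulrC -ler_pdivlMr// (le_trans H)//.
    by rewrite mulrDl ![_ / _ * _]mulrAC.
  by move=> {}H; lra.
have Q0 : Q !=set0 by exists ((f (t + 1 *: v) - f t) / 1); exists 1 => //=; rewrite ltr01.
exists (inf Q) => h.
have [h0|h0|->] := ltgtP h 0; last by rewrite mul0r scale0r !addr0.
  have := lb_le_inf Q0 (lbQ (- h) _); rewrite oppr_gt0 => /(_ h0).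
  by rewrite ler_pdivrMr ?oppr_gt0// scaleNr opprK; lra.
have : inf Q <= (f (t + h *: v) - f t) / h.
  by apply: ge_inf; [exists ((f t - f (t - 1 *: v)) / 1); exact: lbQ|exists h].
by rewrite ler_pdivlMr//; lra.
Qed.

Let D v := projT1 (cid (slope_exists v)).

Let D_lower v h : f t + h * D v <= f (t + h *: v).
Proof. by rewrite /D; case: cid. Qed.

Let D_upper v h : enorm (h *: v) <= 1 ->
  f (t + h *: v) <= f t + h * D v + C * enorm (h *: v) ^+ 2.
Proof.
move=> hv; have := fsecond hv; have := D_lower v (- h); rewrite scaleNr.
move: (f (t + h *: v)) (f (t - h *: v)) (f t) (C * _) => a b e k; lra.
Qed.

Let D_le v (a K e : R) : 0 <= K -> 0 < e ->
  (forall h, 0 < h -> h <= e -> f (t + h *: v) <= f t + h * a + K * h ^+ 2) ->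
  D v <= a.
Proof.
move=> K0 e0 H; apply: (@ler_of_linear_error _ _ _ K e) => // h h0 he.
have := le_trans (D_lower v h) (H h h0 he).
rewrite -addrA lerD2l => Hh; rewrite -(ler_pM2l h0) (le_trans Hh)// mulrDr.
by rewrite expr2 [h * (K * h)]mulrCA.
Qed.

(** The case of negative [a] is the one where the second-difference bound excludes a kink: [D_upper]
    holds for both signs of h. *)
Let D_scale_le v a : D (a *: v) <= a * D v.
Proof.
have [e e0 He] := exists_small_step (a *: v).
apply: (@D_le _ _ (C * enorm (a *: v) ^+ 2) e) => //.
  by rewrite mulr_ge0 ?sqr_ge0.
move=> h h0 he; have := @D_upper v (h * a); rewrite -scalerA.
move=> /(_ (He h (ltW h0) he))/le_trans; apply.
rewrite [enorm (h *: _)]enormZ gtr0_norm// exprMn.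
by rewrite -(mulrA h a) -(mulrA C) [_ * h ^+ 2]mulrC.
Qed.

(** The point t + h (v + w) is the midpoint of t + 2 h v and t + 2 h w, and the quadratic errors
    disappear as h tends to 0. *)
Let D_subadd v w : D (v + w) <= D v + D w.
Proof.
have [e e0 He] := exists_small_step (2 *: v); have [e' e'0 He'] := exists_small_step (2 *: w).
apply: (@D_le _ _ (2^-1 * (C * enorm (2 *: v) ^+ 2 + C * enorm (2 *: w) ^+ 2)) (Num.min e e')).
- by rewrite mulr_ge0// addr_ge0// mulr_ge0 ?sqr_ge0.
- by rewrite lt_min e0.
move=> h h0; rewrite le_min => /andP[he he'].
have := He h (ltW h0) he; have := He' h (ltW h0) he'.
rewrite !scalerA => Hw' Hv'; have Hw := D_upper Hw'; have Hv := D_upper Hv'.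
have h01 : 0 <= (2^-1 : R) <= 1 by apply/andP; split; lra.
have := fconvex (t + (h * 2) *: v) (t + (h * 2) *: w) h01.
have -> : (1 - 2^-1) *: (t + (h * 2) *: v) + 2^-1 *: (t + (h * 2) *: w) = t + h *: (v + w).
  by apply/rowP => i; rewrite !mxE; field.
move: Hv Hw; rewrite -!scalerA !enormZ (gtr0_norm h0).
move: (`|2| * enorm v) (`|2| * enorm w) (f (t + h *: (2 *: v))) (f (t + h *: (2 *: w))).
move: (f (t + h *: (v + w))) (f t) (D v) (D w) => x y a b n n' x1 x2 H1 H2 H3.
rewrite (le_trans H3)//.
apply: (@le_trans _ _ ((1 - 2^-1) * (y + h * 2 * a + C * (h * n) ^+ 2)
   + 2^-1 * (y + h * 2 * b + C * (h * n') ^+ 2))).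
  by rewrite lerD// ler_wpM2l//; lra.
by rewrite le_eqVlt; apply/orP; left; apply/eqP; field.
Qed.

Let D_opp v : D (- v) = - D v.
Proof.
have D0 : 0 <= D 0 by have := D_lower 0 (-1); rewrite scaler0 addr0; lra.
have := D_scale_le v (-1); rewrite scaleN1r mulN1r => H.
have := D_subadd v (- v); rewrite subrr => H'.
by apply/eqP; rewrite eq_le H -subr_ge0 opprK addrC (le_trans D0).
Qed.

Let DZ v a : D (a *: v) = a * D v.
Proof.
apply/eqP; rewrite eq_le D_scale_le/=.
by have := D_scale_le (- v) a; rewrite scalerN !D_opp mulrN lerN2.
Qed.

Let DD v w : D (v + w) = D v + D w.
Proof.
apply/eqP; rewrite eq_le D_subadd/= -lerBrDr -D_opp.
by rewrite -{1}(addrK w v) D_subadd.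
Qed.

Let D_derive v : 'D_v f t = D v.
Proof.
apply: cvg_lim => //; apply/cvgrPdist_le => e e0.
have [e1 e10 He] := exists_small_step v.
pose K := C * enorm v ^+ 2.
have K0 : 0 <= K by rewrite mulr_ge0 ?sqr_ge0.
have KP : 0 < e / (K + 1) by rewrite divr_gt0// ltr_wpDl.
near=> h.
have hN0 : h != 0 by near: h; exact: nbhs_dnbhs_neq.
have he1 : `|h| <= e1.
  by near: h; apply: (@dnbhs0_le _ R^o); rewrite ?e10.
have heK : `|h| <= e / (K + 1).
  by near: h; apply: (@dnbhs0_le _ R^o).
have hv : enorm (h *: v) <= 1.
  by have := He `|h| (normr_ge0 _) he1; rewrite !enormZ normr_id.
have H1 := D_lower v h; have H2 := D_upper hv.
rewrite /= (addrC (h *: v) t).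
have -> : D v - h^-1 *: (f (t + h *: v) - f t) = - (h^-1 * (f (t + h *: v) - f t - h * D v)).
  by rewrite /GRing.scale/=; field.
rewrite normrN normrM normfV ler_pdivrMl ?normr_gt0//.
rewrite ger0_norm; last by lra.
rewrite (@le_trans _ _ (C * enorm (h *: v) ^+ 2))//; first by lra.
rewrite enormZ exprMn mulrCA -/K expr2 -mulrA ler_wpM2l//.
rewrite (@le_trans _ _ (e / (K + 1) * K))//; first by rewrite ler_wpM2r.
rewrite mulrAC ler_pdivrMr; last by rewrite ltr_wpDl.
by rewrite ler_pM2l// lerDl.
Unshelve. all: by end_near. Qed.

Lemma convex_derive_gradient v : 'D_v f t = dotp (gradient f t) v.
Proof.
rewrite D_derive {1}(row_sum_delta v).
have D0 : D 0 = 0 by rewrite -(scale0r 0) DZ mul0r.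
rewrite (big_morph D DD D0); apply: eq_bigr => i _.
by rewrite DZ mxE D_derive mulrC.
Qed.

Lemma convex_gradient_lower s : f t + dotp (gradient f t) (s - t) <= f s.
Proof.
have := D_lower (s - t) 1; rewrite mul1r scale1r (addrC t) subrK.
by rewrite -D_derive convex_derive_gradient.
Qed.

Lemma convex_gradient_upper w : enorm w <= 1 ->
  f (t + w) <= f t + dotp (gradient f t) w + C * enorm w ^+ 2.
Proof.
move=> w1; have := @D_upper w 1; rewrite mul1r scale1r => /(_ w1).
by rewrite -D_derive convex_derive_gradient.
Qed.

End ConvexGradient.

(** * The support function of {rho <= 1} and the map Gamma *)

Local Opaque Lmu rho.

Section Support.
Variables (R : realType) (d p : nat).
Variables (c : 'rV[int]_d -> 'I_p -> 'I_p -> R) (m : 'I_p -> R).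
Hypothesis hset : lasm_setting c m.
Hypothesis hA : assumptionA c m.
Hypothesis p0 : (0 < p)%N.
Implicit Types s t u v w : 'rV[R]_d.
Local Notation L := (Lmu c m).
Local Notation rho := (rho c m).

Let hexp : exp_moments c m. Proof. by case: hA. Qed.

(** At t = 0 a row sums to the probability of surviving one step from that colour. *)
Lemma Lmu0_row_sum i : \sum_k L 0 i k = (m i)^-1.
Proof.
apply: EFin_inj; rewrite -sumEFin.
under eq_bigr do rewrite LmuE//.
rewrite -(@esum_prod_ord _ _ _ (fun a => (expR (dotp 0 (latt R a.1)) * mu c m i a.2 a.1)%:E)); last first.
  by move=> a; rewrite lee_fin mulr_ge0 ?expR_ge0//; exact: mu_ge0.
have mi := m_gt0 hset i; have si := sigma_gt0 hset i.
rewrite (eq_esum (b := fun a => ((m i * sigma c i)^-1)%:E * (c a.1 i a.2)%:E)%E); last first.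
  by move=> a _; rewrite dot0p expR0 mul1r /mu mulrC EFinM.
rewrite ge0_esumZl; last 2 first.
- by rewrite invr_ge0 ltW// mulr_gt0.
- by case: hset => c0 _ _ _ a; rewrite lee_fin.
rewrite -/(sum_rates c i) (sum_ratesE hset) -EFinM; congr (_%:E).
by rewrite invfM -mulrA mulVf ?mulr1// gt_eqF.
Qed.

(** The row sums of [L 0] are at most 1, with one strict deficit; the left eigenvector gives
    positive weight to that row. *)
Lemma rho0_lt1 : rho 0 < 1.
Proof.
have [l [_ [lP _ lL _]]] := rho_perron hset hA p0 0.
pose e : 'cV[R]_p := const_mx 1.
have le : 0 < pairing l e by apply: pairing_gt0 => // i; rewrite mxE.
have Le i : (L 0 *m e) i 0 = (m i)^-1.
  rewrite mxE -Lmu0_row_sum; apply: eq_bigr => k _.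
  by rewrite [e k 0]mxE mulr1.
rewrite -(ltr_pM2r le) mul1r -pairingZl -lL -pairing_mulA.
case: hA => -[i mi1] _ _ _; case: hset => _ _ _ m1.
rewrite /pairing (bigD1 i)//= [ltRHS](bigD1 i)//= ltr_leD//.
  by rewrite Le [e i 0]mxE ltr_pM2l// invf_lt1// (m_gt0 hset).
apply: ler_sum => k _; rewrite Le [e k 0]mxE ler_pM2l//.
by rewrite invf_le1// (m_gt0 hset).
Qed.

(** On the diagonal the entries of the right eigenvector cancel, so that no constant appears. *)
Lemma LmuX_diag_le t n i : (L t ^+ n) i i <= rho t ^+ n.
Proof.
have [_ [r [_ rP _ Lr]]] := rho_perron hset hA p0 t.
rewrite -(ler_pM2r (rP i)).
have := congr1 (fun v : 'cV[R]_p => v i 0) (eigenvector_expr n Lr); rewrite !mxE => <-.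
rewrite (bigD1 i)//= lerDl sumr_ge0// => k _; rewrite mulr_ge0 ?(ltW (rP k))//.
by apply: nonneg_mxX; exact: Lmu_nonneg.
Qed.

Definition sublevel : set 'rV[R]_d := [set t | rho t <= 1].

Lemma sublevel0 : sublevel 0. Proof. exact/ltW/rho0_lt1. Qed.

Lemma rho_continuous : continuous rho.
Proof.
apply: locally_lipschitz_continuous => t.
have [C C0 H] := rho_perturb hset hA p0 t; exists C => // s st.
rewrite enorm_subC in st; have [H1 _] := H _ st.
by rewrite (addrC t) subrK in H1; rewrite distrC enorm_subC.
Qed.

(** If the walk has displacement x after n steps with probability q > 0, from a colour to itself,
    then q e^{t.x} <= rho(t)^n <= 1. Taking x = +e_k and x = -e_k bounds every coordinate of t. *)
Lemma sublevel_bounded : exists2 M, 0 < M & forall t, sublevel t -> enorm t <= M.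
Proof.
pose i := Ordinal p0.
have H (x : 'rV[int]_d) : exists B, forall t, sublevel t -> dotp t (latt R x) <= B.
  case: hA => _ irr _ _; have [n [_ nP]] := irr x i i.
  have nfin := pstep_fin hset hexp n i i x.
  have q0 : 0 < fine (pstep c m n i i x) by rewrite -lte_fin fineK.
  exists (- ln (fine (pstep c m n i i x))) => t tT.
  rewrite -ler_expR expRN lnK ?posrE// -[leRHS]mul1r ler_pdivlMr//.
  have := pstep_exp_le hset hexp n t i i x; rewrite -(fineK nfin) -EFinM lee_fin.
  move=> /le_trans; apply; apply: (le_trans (LmuX_diag_le t n i)).
  by rewrite exprn_ile1//; exact: rho_ge0.
have /boolp.choice[B HB] : forall k : 'I_d, exists b, forall t, sublevel t -> `|t 0 k| <= b.
  move=> k; have [B1 H1] := H (delta_mx 0 k); have [B2 H2] := H (- delta_mx 0 k).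
  exists (Num.max B1 B2) => t tT.
  have E : latt R (delta_mx 0 k) = delta_mx 0 k.
    by apply/rowP => l; rewrite !mxE; case: (_ && _).
  have := H1 _ tT; have := H2 _ tT; rewrite lattN E dotpNr dotp_delta => h2 h1.
  by rewrite ler_norml le_max lerNl !le_max h1 h2 !orbT.
exists (1 + \sum_k `|B k|); first by rewrite ltr_pwDl// sumr_ge0.
move=> t tT; rewrite (le_trans (enorm_le_sum t))//.
rewrite (@le_trans _ _ (\sum_k `|B k|))//; last by rewrite lerDr.
by apply: ler_sum => k _; rewrite (le_trans (HB _ _ tT))// ler_norm.
Qed.

Lemma sublevel_compact : compact sublevel.
Proof.
apply: bounded_closed_compact.
  have [M M0 H] := sublevel_bounded; exists M; split; first by rewrite num_real.
  move=> N MN t tT /=; rewrite (le_trans (normr_le_enorm t))//.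
  by rewrite (le_trans (H _ tT))// ltW.
rewrite -[sublevel]/(rho @^-1` [set x | x <= 1]).
by apply: preimage_closed; [move=> x _; exact: rho_continuous|exact: closed_le].
Qed.

Lemma sublevel_ball : exists2 k, 0 < k & forall t, enorm t <= k -> sublevel t.
Proof.
have [C C0 H] := rho_perturb hset hA p0 0.
have C1 : 0 < C + 1 by rewrite ltr_wpDl.
have r1 : 0 < 1 - rho 0 by rewrite subr_gt0 rho0_lt1.
exists (Num.min 1 ((1 - rho 0) / (C + 1))).
  by rewrite lt_min ltr01 divr_gt0.
move=> t; rewrite le_min => /andP[t1 tk].
have [H1 _] := H _ t1; rewrite add0r in H1.
have := le_trans (ler_norm _) H1; rewrite /sublevel/= lerBlDr => /le_trans; apply.
rewrite -lerBrDr (le_trans _ (_ : (C + 1) * enorm t <= _))//.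
  by rewrite ler_wpM2r ?enorm_ge0// lerDl.
by rewrite mulrC -ler_pdivlMr.
Qed.

(** Convexity between t and 0, where [rho] is below 1; this margin makes the Green series
    geometric. *)
Lemma sublevel_shrink t e : sublevel t -> 0 <= e <= 1 ->
  rho ((1 - e) *: t) <= 1 - e * (1 - rho 0).
Proof.
move=> tT e01; have /andP[e0 e1] := e01.
have := rho_convex hset hA p0 t 0 e01; rewrite scaler0 addr0 => /le_trans; apply.
have unfoldE (a b : R) : 1 - a * (1 - b) = (1 - a) * 1 + a * b by ring.
by rewrite unfoldE lerD2r ler_wpM2l// subr_ge0.
Qed.

Definition support (x : 'rV[R]_d) : R := sup [set dotp t x | t in sublevel].

Lemma dotp_continuousl (x : 'rV[R]_d) : continuous (fun t => dotp t x).
Proof.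
apply: (@continuous_sumr _ _ _ _ (fun k (t : 'rV[R]_d) => t 0 k * x 0 k)) => k y.
apply: (@continuousM R _ (fun t : 'rV[R]_d => t 0 k) (fun=> x 0 k) y).
  exact: coord_continuous.
exact: cst_continuous.
Qed.

Let dotp_max x : exists2 t, sublevel t & forall s, sublevel s -> dotp s x <= dotp t x.
Proof.
have T0 : sublevel !=set0 by exists 0; exact: sublevel0.
have [t /set_mem tT tmax] := compact_EVT_max T0 sublevel_compact
  (continuous_subspaceT (@dotp_continuousl x)).
by exists t => // s sT; exact/tmax/mem_set.
Qed.

Lemma support_attained x : exists2 t, sublevel t & support x = dotp t x.
Proof.
have [t tT tmax] := dotp_max x; exists t => //; apply/eqP; rewrite eq_le; apply/andP; split.
  by apply: ge_sup; [exists (dotp t x), t|move=> _ [s sT <-]; exact: tmax].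
apply: ub_le_sup; last by exists t.
by exists (dotp t x) => _ [s sT <-]; exact: tmax.
Qed.

Lemma support_ge t x : sublevel t -> dotp t x <= support x.
Proof.
move=> tT; have [s sT smax] := dotp_max x; apply: ub_le_sup; last by exists t.
by exists (dotp s x) => _ [w wT <-]; exact: smax.
Qed.

Lemma supportD x y : support (x + y) <= support x + support y.
Proof.
have [t tT ->] := support_attained (x + y).
by rewrite dotpDr lerD// support_ge.
Qed.

Lemma supportZ a x : 0 <= a -> support (a *: x) = a * support x.
Proof.
move=> a0; apply/eqP; rewrite eq_le; apply/andP; split.
  have [t tT ->] := support_attained (a *: x).
  by rewrite dotpZr ler_wpM2l// support_ge.
have [t tT ->] := support_attained x.
by rewrite -dotpZr support_ge.
Qed.

Lemma support0 : support 0 = 0.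
Proof. by rewrite -(scale0r 0) supportZ// mul0r. Qed.

Lemma support_le : exists2 M, 0 < M & forall x, support x <= M * enorm x.
Proof.
have [M M0 H] := sublevel_bounded; exists M => // x.
have [t tT ->] := support_attained x.
by rewrite (le_trans (dotp_le _ _))// ler_wpM2r ?enorm_ge0// H.
Qed.

Lemma support_lower : exists2 k, 0 < k & forall x, k * enorm x <= support x.
Proof.
have [k k0 H] := sublevel_ball; exists k => // x.
have [->|xN0] := eqVneq x 0; first by rewrite enorm0 mulr0 support0.
have xP := enorm_gt0 xN0.
apply: le_trans (support_ge x (H ((k / enorm x) *: x) _)).
  by rewrite dotpZl -enorm_sqr expr2 mulrA divfK// gt_eqF.
by rewrite enormZ ger0_norm ?divfK ?gt_eqF// divr_ge0// ltW.
Qed.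

Lemma support_ge0 x : 0 <= support x.
Proof. by have := support_ge x sublevel0; rewrite dot0p. Qed.

Lemma rho_gradient t : exists2 C, 0 <= C &
  (forall s, rho t + dotp (gradient rho t) (s - t) <= rho s) /\
  (forall w, enorm w <= 1 ->
     rho (t + w) <= rho t + dotp (gradient rho t) w + C * enorm w ^+ 2).
Proof.
have [C C0 H] := rho_perturb hset hA p0 t.
have H2 w : enorm w <= 1 -> rho (t + w) + rho (t - w) - rho t *+ 2 <= C * enorm w ^+ 2.
  by move=> /H[].
exists C => //; split.
  exact: convex_gradient_lower (rho_convex hset hA p0) C0 H2.
exact: convex_gradient_upper (rho_convex hset hA p0) C0 H2.
Qed.

(** Evaluate the supporting hyperplane at t at the point 0, where [rho] is below 1. In particular
    the gradient is nonzero on [bdT]. *)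
Lemma gradient_dotp_gt0 t : rho t = 1 -> 0 < dotp (gradient rho t) t.
Proof.
move=> t1; have [C _ [H _]] := rho_gradient t.
have := H 0; rewrite t1 sub0r dotpNr => H0.
by have := le_lt_trans H0 rho0_lt1; rewrite gtrDl oppr_lt0.
Qed.

Lemma maximizer_Gamma t u : sublevel t -> usphere u ->
  (forall s, sublevel s -> dotp s u <= dotp t u) ->
  bdT c m t /\ Gamma c m t = u.
Proof.
move=> tT su tmax.
have uu : dotp u u = 1 by rewrite -enorm_sqr su expr1n.
(* Otherwise a small step from t along u stays in the sublevel set and increases the scalar product
   with u. *)
have t1 : rho t = 1.
  apply/eqP; rewrite eq_le; apply/andP; split; first exact: tT.
  rewrite leNgt; apply/negP => tlt1.
  have [C C0 H] := rho_perturb hset hA p0 t.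
  have C1 : 0 < C + 1 by rewrite ltr_wpDl.
  pose h := Num.min 1 ((1 - rho t) / (C + 1)).
  have h0 : 0 < h by rewrite lt_min ltr01 divr_gt0// subr_gt0.
  have hu : enorm (h *: u) = h by rewrite enormZ su mulr1 gtr0_norm.
  have [|H1 _] := H (h *: u); first by rewrite hu /h ge_min lexx.
  have : sublevel (t + h *: u).
    have := le_trans (ler_norm _) H1; rewrite /sublevel/= lerBlDr => /le_trans; apply.
    rewrite hu -lerBrDr (@le_trans _ _ ((C + 1) * h))//.
      by rewrite ler_wpM2r ?(ltW h0)// lerDl.
    by rewrite mulrC -ler_pdivlMr// ge_min lexx orbT.
  by move=> /tmax; rewrite dotpDl dotpZl uu mulr1 gerDl leNgt h0.
split=> //.
have [C C0 [_ gup]] := rho_gradient t.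
have gt0 := gradient_dotp_gt0 t1.
set g := gradient rho t in gup gt0.
(* Moving along such a w increases the scalar product with u, hence leaves the sublevel set, so
   [rho] exceeds 1 there and its first-order variation cannot be negative. *)
have gw w : 0 < dotp w u -> 0 <= dotp g w.
  move=> wu; have [e e0 He] := exists_small_step w.
  apply: (@ler_of_linear_error _ _ _ (C * enorm w ^+ 2) e) => //; first by rewrite mulr_ge0 ?sqr_ge0.
  move=> h h0 he; have := gup _ (He h (ltW h0) he); rewrite t1 => H.
  have : 1 < rho (t + h *: w).
    rewrite ltNge; apply/negP => /tmax; rewrite dotpDl dotpZl gerDl leNgt.
    by rewrite mulr_gt0.
  move=> /lt_le_trans/(_ H)/ltW; rewrite -addrA lerDl dotpZr enormZ gtr0_norm//.
  rewrite -(pmulr_rge0 (dotp g w + C * enorm w ^+ 2 * h) h0).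
  by congr (0 <= _); rewrite exprMn; ring.
(* The part of the gradient orthogonal to u. Testing [gw] on -q + h u gives |q|^2 <= h g.u for all h
   > 0. *)
pose q := g - dotp g u *: u.
have qu : dotp q u = 0 by rewrite dotpBl dotpZl uu mulr1 subrr.
have gq : dotp g q = dotp q q.
  by rewrite {2}/q dotpBl dotpZl [dotp u q]dotpC qu mulr0 subr0.
have gu0 : 0 <= dotp g u by apply: gw; rewrite uu.
have q0 : q = 0.
  apply: enorm_eq0; apply/eqP; rewrite -sqrf_eq0 eq_le sqr_ge0 andbT enorm_sqr.
  apply: (@ler_of_linear_error _ _ _ (dotp g u) 1) => // h h0 _; rewrite add0r.
  have := gw (- q + h *: u); rewrite dotpDl dotpNl qu oppr0 add0r dotpZl uu mulr1.
  by move=> /(_ h0); rewrite dotpDr dotpNr gq dotpZr addrC subr_ge0 mulrC.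
have gE : g = dotp g u *: u by apply/eqP; rewrite -subr_eq0 -/q q0.
have guP : 0 < dotp g u.
  rewrite lt_neqAle gu0 andbT eq_sym; apply: contraTneq gt0 => E.
  by rewrite gE E scale0r dot0p ltxx.
rewrite /Gamma -/g gE enormZ su mulr1 (gtr0_norm guP) scalerA mulVf ?scale1r//.
by rewrite gt_eqF.
Qed.

(** The supporting hyperplane of [rho] at t has normal a positive multiple of u, and [rho] is at
    most 1 = rho t at s. *)
Lemma Gamma_maximizer t u : bdT c m t -> usphere u -> Gamma c m t = u ->
  forall s, sublevel s -> dotp s u <= dotp t u.
Proof.
move=> t1 su Gt s sT; have [C C0 [glow _]] := rho_gradient t.
have gt0 := gradient_dotp_gt0 t1.
move: glow gt0 Gt; rewrite /Gamma; set g := gradient rho t => glow gt0 Gt.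
have gP : 0 < enorm g.
  by apply: enorm_gt0; apply: contraTneq gt0 => ->; rewrite dot0p ltxx.
have gE : g = enorm g *: u by rewrite -Gt enorm_normalize.
have := glow s; rewrite t1 gE dotpZl dotpC => H.
have := le_trans H sT; rewrite gerDl pmulr_rle0// dotpBl subr_le0.
by [].
Qed.

Lemma Gamma_invP u : usphere u ->
  [/\ bdT c m (Gamma_inv c m u), Gamma c m (Gamma_inv c m u) = u &
      dotp (Gamma_inv c m u) u = support u].
Proof.
move=> su.
have surj : set_surj (bdT c m) usphere (Gamma c m).
  move=> v sv; have [t tT tv] := support_attained v.
  have [|t1 Gt] := @maximizer_Gamma t v tT sv; last by exists t.
  by move=> s sT; rewrite -tv support_ge.
have B : bdT c m (Gamma_inv c m u).
  by apply: (surjpinv_image_sub surj); exists u.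
have G : Gamma c m (Gamma_inv c m u) = u by exact: (@surjpK _ _ (fun=> 0) _ _ _ surj u (mem_set su)).
split=> //; apply/eqP; rewrite eq_le; apply/andP; split.
  by apply: support_ge; rewrite /sublevel/= -[rho _]/(rho _) B.
have [t tT ->] := support_attained u.
exact: Gamma_maximizer.
Qed.

Lemma maximizer_unique t u v : usphere u -> usphere v -> sublevel t ->
  dotp t u = support u -> dotp t v = support v -> u = v.
Proof.
move=> su sv tT tu tv.
have [|_ <-] := @maximizer_Gamma t u tT su; first by move=> s sT; rewrite tu support_ge.
have [|_ <-] := @maximizer_Gamma t v tT sv; first by move=> s sT; rewrite tv support_ge.
by [].
Qed.

End Support.

(** * Upper bound for the Green function *)

Local Opaque mu.

(** * Geometric series and exponential sums over the lattice *)

Section Summation.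
Variable R : realType.

Lemma sum_geometric_le (a : R) n : 0 <= a < 1 -> \sum_(0 <= k < n) a ^+ k <= (1 - a)^-1.
Proof.
move=> /andP[a0 a1]; have a1' : 0 < 1 - a by rewrite subr_gt0.
rewrite -[leRHS]mul1r ler_pdivlMr//.
have -> : (\sum_(0 <= k < n) a ^+ k) * (1 - a) = 1 - a ^+ n.
  elim: n => [|n IH]; first by rewrite big_nil mul0r expr0 subrr.
  by rewrite big_nat_recr//= mulrDl IH exprS; ring.
by rewrite gerBl exprn_ge0.
Qed.

Lemma nneseries_geometric_le (u : nat -> \bar R) (A a : R) : 0 <= A -> 0 <= a < 1 ->
  (forall n, 0 <= u n)%E -> (forall n, u n <= (A * a ^+ n)%:E)%E ->
  (\sum_(0 <= n <oo) u n <= (A / (1 - a))%:E)%E.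
Proof.
move=> A0 a01 u0 uA; apply: (lime_le (is_cvg_nneseries _)) => //.
apply: nearW => n.
apply: (@le_trans _ _ (\sum_(0 <= k < n) (A * a ^+ k)%:E)%E).
  by apply: lee_sum => k _; exact: uA.
by rewrite sumEFin lee_fin -mulr_sumr ler_wpM2l// sum_geometric_le.
Qed.

Lemma esum_int_exp (a : R) : 0 < a ->
  (\esum_(z in [set: int]) (expR (- (a * `|z|%:~R)))%:E < +oo)%E.
Proof.
move=> a0; have b01 : 0 <= expR (- a) < 1 by rewrite expR_ge0/= expR_lt1 oppr_lt0.
have f0 z : (0 <= (expR (- (a * `|z|%:~R)))%:E)%E by rewrite lee_fin expR_ge0.
rewrite (esumID (range Posz))//; apply: lte_add_pinfty.
  rewrite setTI esum_image; last by move=> x y _ _ /= [->].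
  rewrite -nneseries_esumT//.
  apply: le_lt_trans (_ : ((1 / (1 - expR (- a)))%:E < +oo)%E); last by rewrite ltry.
  apply: nneseries_geometric_le => // n.
  by rewrite lee_fin mul1r -expRM_natl ler_expR mulrN lerN2 mulrC ler_pM2l// ger0_norm.
have -> : setT `&` ~` range Posz = range Negz.
  apply/seteqP; split=> [[n|n] [_ /= H]|_ [n _ <-]]; last by split=> // -[].
    by exfalso; apply: H; exists n.
  by exists n.
rewrite esum_image; last by move=> x y _ _ /= [->].
rewrite -nneseries_esumT//.
apply: le_lt_trans (_ : ((1 / (1 - expR (- a)))%:E < +oo)%E); last by rewrite ltry.
apply: nneseries_geometric_le => // n.
rewrite lee_fin mul1r -expRM_natl ler_expR mulrN lerN2 mulrC.
by rewrite ler_pM2l// NegzE normrN ger0_norm//= ler_nat.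
Qed.

Lemma esum_prod_rV (f : int -> R) d : (forall z, 0 <= f z) ->
  (\esum_(z in [set: int]) (f z)%:E < +oo)%E ->
  (\esum_(x in [set: 'rV[int]_d]) (\prod_k f (x 0%R k))%:E < +oo)%E.
Proof.
move=> f0 ffin; elim: d => [|d IH].
  rewrite (_ : [set: 'rV[int]_0] = [set 0]); last first.
    by apply/seteqP; split=> // x _ /=; apply/rowP => -[].
  by rewrite esum_set1 ?big_ord0 ?ltry// lee_fin.
pose e (a : int * 'rV[int]_d) : 'rV[int]_d.+1 :=
  \row_k (if unlift ord0 k is Some l then a.2 0 l else a.1).
rewrite (reindex_esum ([set: int] `*`` (fun=> [set: 'rV[int]_d])) _ e); last first.
  split=> // [[a x] [b y] _ _ /= exy|x _].
    have H k := congr1 (fun v : 'rV[int]_d.+1 => v 0 k) exy.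
    congr (_, _); first by have := H ord0; rewrite !mxE unlift_none.
    by apply/rowP => k; have := H (lift ord0 k); rewrite !mxE liftK.
  exists (x 0 ord0, \row_k x 0 (lift ord0 k)) => //; apply/rowP => k.
  by rewrite mxE; case: unliftP => [l ->|->]; rewrite ?mxE.
rewrite (eq_esum (b := fun a : int * 'rV[int]_d => ((f a.1)%:E * (\prod_k f (a.2 0%R k))%:E)%E)); last first.
  move=> [a x] _; rewrite -EFinM big_ord_recl mxE unlift_none; congr (_ * _)%:E.
  by apply: eq_bigr => k _; rewrite mxE liftK.
rewrite -(@esum_esum _ _ _ _ _ (fun a (x : 'rV[int]_d) => ((f a)%:E * (\prod_k f (x 0%R k))%:E)%E)); last first.
  by move=> a x _ _; rewrite -EFinM lee_fin mulr_ge0// prodr_ge0.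
under eq_esum => a _ do [rewrite ge0_esumZl//; last by move=> x; rewrite lee_fin prodr_ge0].
set S := (\esum_(x in [set: 'rV[int]_d]) _)%E in IH *.
have S0 : (0 <= S)%E by apply: esum_ge0 => x _; rewrite lee_fin prodr_ge0.
have Sfin : S \is a fin_num by rewrite ge0_fin_numE.
under eq_esum do rewrite muleC -(fineK Sfin).
rewrite ge0_esumZl ?fine_ge0//.
have Ffin : (\esum_(z in [set: int]) (f z)%:E)%E \is a fin_num.
  by rewrite ge0_fin_numE//; apply: esum_ge0 => z _; rewrite lee_fin.
by rewrite -(fineK Ffin) -EFinM ltry.
Qed.

Lemma esum_exp_enorm d (a : R) : 0 < a ->
  (\esum_(x in [set: 'rV[int]_d]) (expR (- (a * enorm (latt R x))))%:E < +oo)%E.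
Proof.
move=> a0; have d1 : 0 < d%:R + 1 :> R by rewrite ltr_wpDl.
(* The absolute values of the coordinates sum to at most d times the norm; d + 1 keeps the
   denominator nonzero. *)
pose b := a / (d%:R + 1); have b0 : 0 < b by rewrite divr_gt0.
apply: le_lt_trans (@esum_prod_rV (fun z => expR (- (b * `|z|%:~R))) d _ (esum_int_exp b0)); last first.
  by move=> z; exact: expR_ge0.
apply: le_esum => x _; rewrite lee_fin -expR_sum ler_expR sumrN lerN2 -mulr_sumr.
rewrite /b mulrAC ler_pdivrMr// -mulrA ler_pM2l//.
rewrite (@le_trans _ _ (\sum_(k < d) enorm (latt R x)))//.
  apply: ler_sum => k _; apply: le_trans (coord_le_enorm _ k).
  by rewrite mxE intr_norm.
rewrite sumr_const card_ord -[_ *+ d]mulr_natl mulrC.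
by rewrite ler_wpM2l ?enorm_ge0// lerDl.
Qed.

End Summation.

(** * Exponential decay of the Green function *)

Section Green.
Variables (R : realType) (d p : nat).
Variables (c : 'rV[int]_d -> 'I_p -> 'I_p -> R) (m : 'I_p -> R).
Hypothesis hset : lasm_setting c m.
Hypothesis hA : assumptionA c m.
Hypothesis p0 : (0 < p)%N.
Implicit Types s t u v w : 'rV[R]_d.
Local Notation L := (Lmu c m).
Local Notation rho := (rho c m).
Local Notation sublevel := (sublevel c m).
Local Notation support := (support c m).
Local Notation pstep := (pstep c m).

Let hexp : exp_moments c m. Proof. by case: hA. Qed.

Lemma Lmu_connect : exists2 q : R, 0 < q &
  forall i k, exists n, forall t, q <= (L t ^+ n) i k.
Proof.
have H (ik : 'I_p * 'I_p) : exists qn : R * nat,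
    0 < qn.1 /\ forall t, qn.1 <= (L t ^+ qn.2) ik.1 ik.2.
  case: ik => i k; case: hA => _ irr _ _; have [n [_ nP]] := irr 0 i k.
  have nfin := pstep_fin hset hexp n i k 0.
  exists (fine (pstep n i k 0), n); split=> [|t] /=.
    by rewrite -lte_fin fineK.
  rewrite -lee_fin fineK//; have := pstep_exp_le hset hexp n t i k 0.
  by rewrite latt0 dotp0 expR0 mul1e.
have [f fP] := boolp.choice H.
(* A product of numbers in (0, 1] is at most each of its factors: one q serves all pairs of
   colours. *)
exists (\prod_ik Num.min 1 (f ik).1).
  by apply: prodr_gt0 => ik _; rewrite lt_min ltr01 (fP ik).1.
move=> i k; exists (f (i, k)).2 => t; apply: le_trans ((fP (i, k)).2 t).
rewrite (bigD1 (i, k))//=; apply: (@le_trans _ _ (Num.min 1 (f (i, k)).1)).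
  rewrite ler_piMr//; first by rewrite le_min ler01 ltW// (fP (i, k)).1.
  apply: prodr_ile1 => ik _; rewrite le_min ler01 ltW ?(fP ik).1//=.
  by rewrite ge_min lexx.
by rewrite ge_min lexx orbT.
Qed.

Lemma LmuX_ge0 t n i k : 0 <= (L t ^+ n) i k.
Proof. by apply: nonneg_mxX; exact: Lmu_nonneg. Qed.

(* The bound is uniform in t because the paths with displacement x = 0 have weight
   e^{t.x} = 1. *)
Lemma LmuX_le : exists2 C : R, 0 < C &
  forall t n i k, sublevel t -> (L t ^+ n) i k <= C * rho t ^+ n.
Proof.
have [q q0 qP] := Lmu_connect; exists q^-1; first by rewrite invr_gt0.
move=> t n i k tT; have [_ [r [_ rP _ Lr]]] := rho_perron hset hA p0 t.
have LXr N a b : (L t ^+ N) a b * r b 0 <= rho t ^+ N * r a 0.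
  have := congr1 (fun v : 'cV[R]_p => v a 0) (eigenvector_expr N Lr); rewrite !mxE => <-.
  by rewrite (bigD1 b)//= lerDl sumr_ge0// => l _; rewrite mulr_ge0 ?LmuX_ge0// ltW.
(* A Harnack inequality: the entries of the Perron vector are comparable, with a ratio that does not
   depend on t. *)
have rik : q * r i 0 <= r k 0.
  have [N HN] := qP k i.
  rewrite (@le_trans _ _ ((L t ^+ N) k i * r i 0))//; first by rewrite ler_pM2r.
  rewrite (le_trans (LXr _ _ _))// ler_piMl ?(ltW (rP k))// exprn_ile1//.
  exact: rho_ge0.
rewrite -(ler_pM2r (rP k)) (le_trans (LXr _ _ _))// mulrAC.
rewrite [_ * rho t ^+ n]mulrC ler_wpM2l ?exprn_ge0 ?rho_ge0//.
by rewrite ler_pdivlMl.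
Qed.

Lemma green_pstep i k x : green c m (0, i) (x, k) = (\sum_(0 <= n <oo) pstep n i k x)%E.
Proof. by []. Qed.

Lemma green_ge0 i k x : (0 <= green c m (0%R, i) (x, k))%E.
Proof. by apply: nneseries_ge0 => n _ _; exact: pstep_ge0. Qed.

Lemma pstep_le t n i k x a : (L t ^+ n) i k <= a ->
  (pstep n i k x <= (a * expR (- dotp t (latt R x)))%:E)%E.
Proof.
move=> La; have nfin := pstep_fin hset hexp n i k x.
have := pstep_exp_le hset hexp n t i k x; rewrite -(fineK nfin) -EFinM !lee_fin.
move=> /le_trans/(_ La); rewrite expRN -ler_pdivlMl ?expR_gt0//.
by rewrite mulrC.
Qed.

(** The factor 1/e comes from a geometric series of ratio 1 - e (1 - rho 0). The maximizer t depends
    on x, but the constants do not. *)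
Lemma green_upper : exists2 C : R, 0 < C & forall e i k x, 0 < e -> e <= 1 ->
  (green c m (0%R, i) (x, k) <=
   (C / e * expR (- ((1 - e) * support (latt R x))))%:E)%E.
Proof.
have [C C0 HC] := LmuX_le; have r01 := rho0_lt1 hset hA p0.
have r1 : 0 < 1 - rho 0 by rewrite subr_gt0.
exists (C / (1 - rho 0)); first by rewrite divr_gt0.
move=> e i k x e0 e1.
have [t tT tx] := support_attained hset hA p0 (latt R x).
have e01 : 0 <= e <= 1 by rewrite (ltW e0).
have rs := sublevel_shrink hset hA p0 tT e01.
have er0 : 0 < e * (1 - rho 0) by rewrite mulr_gt0.
have a01 : 0 <= 1 - e * (1 - rho 0) < 1.
  rewrite gtrBl er0 andbT subr_ge0 mulr_ile1 ?(ltW e0) ?(ltW r1)//.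
  by rewrite gerBl; exact: rho_ge0.
have sT : sublevel ((1 - e) *: t) by apply: (le_trans rs); rewrite gerBl ltW.
rewrite green_pstep.
have -> : C / (1 - rho 0) / e * expR (- ((1 - e) * support (latt R x))) =
    C * expR (- ((1 - e) * support (latt R x))) / (1 - (1 - e * (1 - rho 0))).
  have alg (a b f X : R) : a / b / f * X = a * X / (f * b) by rewrite invfM; ring.
  by rewrite subKr alg.
apply: nneseries_geometric_le => //.
- by rewrite mulr_ge0 ?expR_ge0// ltW.
- by move=> n; exact: pstep_ge0.
move=> n; rewrite mulrAC tx -dotpZl; apply: pstep_le.
apply: (le_trans (HC _ _ _ _ sT)); rewrite ler_pM2l//.
by rewrite lerXn2r ?nnegrE ?rho_ge0//; case/andP: a01.
Qed.

Lemma green_fin i k x : green c m (0%R, i) (x, k) \is a fin_num.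
Proof.
have [C _ H] := green_upper.
by rewrite ge0_fin_numE ?green_ge0// (le_lt_trans (H 1 i k x _ _))// ltry.
Qed.

(** At [rho t = 1] the left eigenvector is invariant, so l_k is the sum over i of l_i (L^n)_ik for
    every n. Extending each path from i back to k bounds (L^n)_ik by a constant times a later
    diagonal entry; summing over M values of n makes M l_k bounded. *)
Lemma green_diverges t k S : rho t = 1 ->
  (forall N, \sum_(0 <= n < N) (L t ^+ n) k k <= S) -> False.
Proof.
move=> t1 HS; have [q q0 qP] := Lmu_connect.
have /boolp.choice[N NP] : forall i, exists n, forall t, q <= (L t ^+ n) k i by move=> i; exact: qP.
have [l [_ [lP _ lL _]]] := rho_perron hset hA p0 t; rewrite t1 scale1r in lL.
have lLX n : l *m L t ^+ n = l.
  elim: n => [|n IH]; first by rewrite expr0 mulmx1.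
  by rewrite exprS -[L t * _]/(L t *m _) mulmxA lL.
pose Q := \sum_i l 0 i / q.
have le_lk n : l 0 k <= \sum_i l 0 i / q * (L t ^+ (N i + n)) k k.
  rewrite -{1}(lLX n) mxE; apply: ler_sum => i _.
  rewrite -mulrA ler_pM2l// ler_pdivlMl// exprD.
  rewrite (@le_trans _ _ ((L t ^+ N i) k i * (L t ^+ n) i k))//.
    by rewrite ler_wpM2r ?LmuX_ge0.
  rewrite [leRHS]mxE (bigD1 i)//= lerDl sumr_ge0// => b _.
  by rewrite mulr_ge0 ?LmuX_ge0.
have bound M : M%:R * l 0 k <= Q * S.
  rewrite mulr_natl -[M in _ *+ M]card_ord -sumr_const -(big_mkord xpredT (fun=> l 0 k)).
  apply: (@le_trans _ _ (\sum_(0 <= n < M) \sum_i l 0 i / q * (L t ^+ (N i + n)) k k)).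
    by apply: ler_sum => n _.
  rewrite exchange_big/= /Q mulr_suml; apply: ler_sum => i _.
  have lq : 0 <= l 0 i / q by apply: divr_ge0; apply: ltW.
  rewrite -mulr_sumr ler_wpM2l//.
  apply: le_trans (HS (N i + M)%N).
  rewrite [leRHS](big_cat_nat (n := N i))//= ?leq_addr//.
  rewrite (_ : \sum_(0 <= n < M) _ = \sum_(N i <= n < N i + M) (L t ^+ n) k k).
    by rewrite lerDr sumr_ge0// => n _; exact: LmuX_ge0.
  rewrite -{2}[N i]add0n big_addn addKn; apply: eq_bigr => n _.
  by rewrite addnC.
have := bound (Num.truncn (Q * S / l 0 k)).+1.
rewrite -ler_pdivlMr// leNgt => /negP; apply.
exact/real_truncnS_gt/num_real.
Qed.

End Green.

(** * Lower bound for the Green function *)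

Section LowerBound.
Variables (R : realType) (d p : nat).
Variables (c : 'rV[int]_d -> 'I_p -> 'I_p -> R) (m : 'I_p -> R).
Hypothesis hset : lasm_setting c m.
Hypothesis hA : assumptionA c m.
Hypothesis p0 : (0 < p)%N.
Implicit Types t u v : 'rV[R]_d.
Implicit Types x y z : 'rV[int]_d.
Local Notation L := (Lmu c m).
Local Notation rho := (rho c m).
Local Notation sublevel := (sublevel c m).
Local Notation support := (support c m).
Local Notation pstep := (pstep c m).

Let hexp : exp_moments c m. Proof. by case: hA. Qed.

Variable j : 'I_p.

(** The number w is a logarithmic cost for the displacement x. Both endpoints have colour j and the
    number of steps is free, so that costs add under concatenation. *)
Definition reach (w : R) (x : 'rV[int]_d) : Prop :=
  exists n, ((expR (- w))%:E <= pstep n j j x)%E.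

Lemma reach0 : reach 0 0.
Proof. by exists 0%N; rewrite pstep0 !eqxx oppr0 expR0. Qed.

Lemma reach_le w w' x : w <= w' -> reach w x -> reach w' x.
Proof.
move=> ww' [n H]; exists n; apply: le_trans H.
by rewrite lee_fin ler_expR lerN2.
Qed.

Lemma reachD w w' x y : reach w x -> reach w' y -> reach (w + w') (x + y).
Proof.
move=> [n H] [n' H']; exists (n + n')%N.
apply: le_trans (pstep_mul_le hset hexp n n' j j j x y).
by rewrite opprD expRD EFinM lee_pmul// lee_fin expR_ge0.
Qed.

Lemma reachMn w x n : reach w x -> reach (n%:R * w) (x *+ n).
Proof.
move=> H; elim: n => [|n IH]; first by rewrite mul0r mulr0n; exact: reach0.
by rewrite -nat1r mulrDl mul1r mulrS; exact: reachD.
Qed.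

Lemma reach_sum (I : Type) (r : seq I) (w : I -> R) (x : I -> 'rV[int]_d) :
  (forall i, reach (w i) (x i)) -> reach (\sum_(i <- r) w i) (\sum_(i <- r) x i).
Proof.
move=> H; elim: r => [|i r IH]; first by rewrite !big_nil; exact: reach0.
by rewrite !big_cons; exact: reachD.
Qed.

Lemma reach_exists x : exists2 w, 0 <= w & reach w x.
Proof.
case: hA => _ irr _ _; have [n [_ nP]] := irr x j j.
have nfin := pstep_fin hset hexp n j j x.
have q0 : 0 < fine (pstep n j j x) by rewrite -lte_fin fineK.
exists `|ln (fine (pstep n j j x))| => //; exists n.
rewrite -[leRHS](fineK nfin) lee_fin -[leRHS]lnK ?posrE// ler_expR.
by rewrite lerNl -normrN ler_norm.
Qed.

(** Decomposition of x into unit steps. The constant is crude: this cost is paid only on corrections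
    that are small compared with the main displacement. *)
Lemma reach_enorm : exists2 C, 0 <= C & forall x, reach (C * enorm (latt R x)) x.
Proof.
have /boolp.choice[w wP] : forall k : 'I_d, exists w, 0 <= w /\
    reach w (delta_mx 0 k) /\ reach w (- delta_mx 0 k).
  move=> k; have [w1 w10 H1] := reach_exists (delta_mx 0 k).
  have [w2 w20 H2] := reach_exists (- delta_mx 0 k).
  exists (w1 + w2); split; first exact: addr_ge0.
  by split; [apply: reach_le H1; rewrite lerDl|apply: reach_le H2; rewrite lerDr].
exists (\sum_k w k); first by apply: sumr_ge0 => k _; case: (wP k).
move=> x; apply: (@reach_le (\sum_k w k * enorm (latt R x))); first by rewrite mulr_suml.
rewrite {2}[x]row_sum_delta; apply: reach_sum => k; have [wk0 [H1 H2]] := wP k.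
apply: (@reach_le ((absz (x 0 k))%:R * w k)).
  rewrite mulrC ler_wpM2l//; apply: le_trans (coord_le_enorm _ k).
  by rewrite mxE -intr_norm natr_absz.
have -> : x 0 k *: delta_mx 0 k = (delta_mx 0 k : 'rV[int]_d) *~ x 0 k.
  by rewrite -scaler_int -[(x 0 k)%:~R]/(intr _) intz.
case: (x 0 k) => n; first exact: reachMn.
by rewrite -[absz (Negz n)]/(n.+1) NegzE mulrNz -mulNrz; exact: reachMn.
Qed.

Lemma support_lipschitz M (x y : 'rV[R]_d) : (forall v, support v <= M * enorm v) ->
  support x <= support y + M * enorm (x - y).
Proof.
move=> HM; rewrite -{1}(subrK y x) addrC.
by rewrite (le_trans (supportD hset hA p0 _ _))// lerD2l.
Qed.

Lemma support_continuous : continuous support.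
Proof.
have [M M0 HM] := support_le hset hA p0.
apply: locally_lipschitz_continuous => x; exists M => [|y _]; first exact: ltW.
rewrite ler_distl lerBlDr support_lipschitz// andbT.
by rewrite enorm_subC support_lipschitz.
Qed.

(** The gap is positive in each direction v, because t maximizes t.v in the direction u alone, and
    uniform by compactness. *)
Lemma support_gap t u (e : R) : 0 < e -> usphere u -> sublevel t ->
  dotp t u = support u -> exists2 g, 0 < g & forall v, usphere v ->
  e <= enorm (v - u) -> dotp t v <= support v - g.
Proof.
move=> e0 su tT tu.
pose K := usphere `&` [set v : 'rV[R]_d | 0 <= enorm (v - u) - e].
have cK : compact K.
  apply: compact_closedI; first exact: usphere_compact.
  apply: closed_ge0 => v.
  apply: (@continuousB R _ _ (fun v : 'rV[R]_d => enorm (v - u)) (fun=> e) v).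
    apply: (@continuous_comp _ _ _ (fun v => v - u) (@enorm R d)).
      by apply: (@continuousB R _ _ id (fun=> u) v); [exact: cvg_id|exact: cst_continuous].
    exact: enorm_continuous.
  exact: cst_continuous.
have [K0|/set0P/negP/negPn/eqP K0] := pselect (K !=set0); last first.
  exists 1 => // v sv ev; exfalso.
  have : K v by split=> //=; rewrite subr_ge0.
  by rewrite K0.
have cf : continuous (fun v => support v - dotp t v).
  move=> v; apply: (@continuousB R _ _ support (dotp t) v); first exact: support_continuous.
  rewrite (_ : dotp t = fun v => dotp v t); last by apply/funext => w; exact: dotpC.
  exact: dotp_continuousl.
have [v /set_mem[sv ev] vmin] := compact_EVT_min K0 cK (continuous_subspaceT cf).
exists (support v - dotp t v).
  rewrite subr_gt0 lt_neqAle support_ge// andbT; apply: contraTneq e0 => tv.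
  have uv := maximizer_unique hset hA p0 su sv tT tu tv.
  by rewrite -leNgt; move: ev; rewrite /= -uv subrr enorm0 sub0r oppr_ge0.
move=> w sw ew; have := vmin w (mem_set _); rewrite lerBrDr -lerBrDl.
by apply; split=> //=; rewrite subr_ge0.
Qed.

Lemma min_interpolate (X Y th : R) : 0 <= th <= 1 -> Num.min X Y <= (1 - th) * X + th * Y.
Proof.
move=> /andP[t0 t1]; have -> : Num.min X Y = (1 - th) * Num.min X Y + th * Num.min X Y.
  by rewrite -mulrDl subrK mul1r.
by rewrite lerD// ler_wpM2l ?subr_ge0// ge_min lexx ?orbT.
Qed.

(* If every P_n(x) is at most exp(- A), interpolate with the exponential decay of
   P_n(x) in n, so as to make the sum over n converge. *)
Lemma green_le_of_pstep th : 0 < th -> th <= 1 -> exists2 C, 0 < C & forall x A,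
  (forall n, pstep n j j x <= (expR (- A))%:E)%E ->
  (green c m (0%R, j) (x, j) <= (C * expR (- ((1 - th) * A)))%:E)%E.
Proof.
move=> th0 th1; have [C C0 HC] := LmuX_le hset hA p0.
have r01 := rho0_lt1 hset hA p0; have r00 : 0 <= rho 0 by exact: rho_ge0.
(* The maximum with 1/2 guarantees that a is positive, so that a^n can be written as an exponential
   of n ln a. *)
pose a := Num.max (rho 0) 2^-1.
have a0 : 0 < a by rewrite lt_max invr_gt0 ltr0n orbT.
have a1 : a < 1 by rewrite gt_max r01 invf_lt1 ?ltr1n.
have lna : ln a < 0 by apply: ln_lt0; rewrite a0.
have b01 : 0 <= expR (th * ln a) < 1.
  by rewrite expR_ge0 expR_lt1 pmulr_rlt0.
exists (expR (th * ln C) / (1 - expR (th * ln a))).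
  by rewrite divr_gt0 ?expR_gt0// subr_gt0; case/andP: b01.
move=> x A HA; rewrite green_pstep mulrAC.
apply: nneseries_geometric_le => // [n|]; first exact: pstep_ge0.
move=> n; have nfin := pstep_fin hset hexp n j j x.
have le2 : (pstep n j j x <= (expR (ln C + n%:R * ln a))%:E)%E.
  have := @pstep_le _ _ _ _ _ hset hA 0 n j j x (C * a ^+ n).
  rewrite dot0p oppr0 expR0 mulr1 expRD expRM_natl !lnK ?posrE//; apply.
  apply: (le_trans (HC _ _ _ _ (sublevel0 hset hA p0))).
  by rewrite ler_pM2l// lerXn2r ?nnegrE ?(ltW a0)// le_max lexx.
have := HA n; rewrite -(fineK nfin) !lee_fin => le1.
rewrite -(fineK nfin) lee_fin in le2.
apply: (@le_trans _ _ (expR (Num.min (- A) (ln C + n%:R * ln a)))).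
  by rewrite /Num.min; case: ifP.
rewrite -expRM_natl -!expRD ler_expR.
have th01 : 0 <= th <= 1 by rewrite (ltW th0).
rewrite (le_trans (min_interpolate _ _ th01))// le_eqVlt; apply/orP; left; apply/eqP; ring.
Qed.

(* Otherwise G(x) e^{t.x} would decay exponentially, whereas its sum diverges. *)
Lemma good_point t u (e : R) : 0 < e -> usphere u -> rho t = 1 ->
  dotp t u = support u ->
  exists2 x, x != 0 & enorm ((enorm (latt R x))^-1 *: latt R x - u) <= e /\
    reach (dotp t (latt R x) + e * enorm (latt R x)) x.
Proof.
move=> e0 su t1 tu; apply: contrapT => nogood.
have tT : sublevel t by rewrite /sublevel/= t1.
have [M M0 HM] := support_le hset hA p0.
have [g g0 Hg] := support_gap e0 su tT tu.
(* In far directions, the loss e1 h(x) <= e1 M |x| of the upper bound uses at most half of the gap g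
   |x|. *)
pose e1 := Num.min 1 (g / (2 * M)).
have e10 : 0 < e1 by rewrite lt_min ltr01 divr_gt0// mulr_gt0.
have e1g : e1 * M <= g / 2.
  apply: (@le_trans _ _ (g / (2 * M) * M)); first by rewrite ler_pM2r// ge_min lexx orbT.
  by rewrite invfM mulrA divfK ?gt_eqF.
have [C C0 HC] := green_upper hset hA p0.
(* In near directions, the interpolation loss th (t.x + e |x|) is at most e |x| / 2, which leaves a
   decay of e |x| / 2. *)
pose th := Num.min 1 (e / (2 * (M + e))).
have Me : 0 < M + e by rewrite addr_gt0.
have th0 : 0 < th by rewrite lt_min ltr01 divr_gt0// mulr_gt0.
have the : th * (M + e) <= e / 2.
  apply: (@le_trans _ _ (e / (2 * (M + e)) * (M + e))).
    by rewrite ler_pM2r// ge_min lexx orbT.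
  by rewrite invfM mulrA divfK ?gt_eqF.
have th1 : th <= 1 by rewrite ge_min lexx.
have [C' C'0 HC'] := green_le_of_pstep th0 th1.
pose f := Num.min g e / 2.
have f0 : 0 < f by rewrite divr_gt0// lt_min g0.
pose K := C / e1 + C'.
have K0 : 0 < K by rewrite addr_gt0// divr_gt0.
have bound x : ((expR (dotp t (latt R x)))%:E * green c m (0%R, j) (x, j) <=
    (K * expR (- (f * enorm (latt R x))))%:E)%E.
  have gfin := green_fin hset hA p0 j j x.
  rewrite -(fineK gfin) -EFinM lee_fin.
  set X := latt R x; set N := enorm X.
  have N0 : 0 <= N by exact: enorm_ge0.
  have fg : f * N <= g / 2 * N by rewrite ler_wpM2r// /f ler_pM2r// ge_min lexx.
  have fe : f * N <= e / 2 * N by rewrite ler_wpM2r// /f ler_pM2r// ge_min lexx orbT.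
  have tX : dotp t X <= M * N.
    by rewrite (le_trans _ (HM X))// support_ge.
  have far : dotp t X <= support X - g * N ->
      expR (dotp t X) * fine (green c m (0%R, j) (x, j)) <= K * expR (- (f * N)).
    move=> far; have := HC e1 j j x e10 _; rewrite ge_min lexx => /(_ isT).
    rewrite -(fineK gfin) lee_fin -/X => H.
    apply: (@le_trans _ _ (expR (dotp t X) * (C / e1 * expR (- ((1 - e1) * support X))))).
      by rewrite ler_pM2l ?expR_gt0.
    rewrite mulrCA -expRD; apply: ler_pM; rewrite ?expR_ge0//.
    - by rewrite divr_ge0 ?ltW.
    - by rewrite lerDl ltW.
    rewrite ler_expR.
    have : e1 * support X <= e1 * (M * N) by rewrite ler_wpM2l// ?HM// ltW.
    have : e1 * M * N <= g / 2 * N by rewrite ler_wpM2r.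
    move: far fg; move: (dotp t X) (support X) => a b; lra.
  (* The origin has no direction; the far estimate is trivially available there. *)
  have [x0|xN0] := eqVneq x 0.
    by apply: far; rewrite /N /X x0 latt0 enorm0 dotp0 support0// mulr0 subr0.
  have XN0 : X != 0 by rewrite latt_eq0.
  have NP : 0 < N by exact: enorm_gt0.
  have [dir|dir] := lerP (enorm (N^-1 *: X - u)) e; last first.
    apply: far; have := Hg _ (usphere_normalize XN0) (ltW dir).
    rewrite -/N dotpZr supportZ ?invr_ge0// -(ler_pM2l NP) mulrBr !mulrA mulfV ?gt_eqF//.
    by rewrite !mul1r (mulrC N).
  have H n : (pstep n j j x <= (expR (- (dotp t X + e * N)))%:E)%E.
    rewrite leNgt; apply/negP => H; apply: nogood; exists x => //; split=> //.
    by exists n; exact: ltW.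
  have := HC' _ _ H; rewrite -(fineK gfin) lee_fin => {}H.
  apply: (@le_trans _ _ (expR (dotp t X) * (C' * expR (- ((1 - th) * (dotp t X + e * N)))))).
    by rewrite ler_pM2l ?expR_gt0.
  rewrite mulrCA -expRD; apply: ler_pM; rewrite ?expR_ge0//.
  - exact: ltW.
  - by rewrite lerDr ltW// divr_gt0.
  rewrite ler_expR.
  have : th * dotp t X <= th * (M * N) by rewrite ler_wpM2l// ltW.
  have : th * (M + e) * N <= e / 2 * N by rewrite ler_wpM2r.
  move: fe; move: (dotp t X) => a; lra.
have Sfin := esum_exp_enorm d f0.
set S := (\esum_(x in _) _)%E in Sfin.
have S0 : (0 <= S)%E by apply: esum_ge0 => x _; rewrite lee_fin expR_ge0.
have SE : S = (fine S)%:E by rewrite fineK// ge0_fin_numE.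
(* The diagonal entries of [L t ^+ n] sum to partial sums of the series of e^{t.x} G(x) over x, now
   bounded by K times a convergent series. *)
apply: (@green_diverges _ _ _ _ _ hset hA p0 t j (K * fine S)) => // N.
rewrite -lee_fin -sumEFin EFinM -SE.
under eq_bigr do rewrite -pstep_transform//.
rewrite -esum_sum; last by move=> x n _ _; rewrite mule_ge0 ?pstep_ge0// lee_fin expR_ge0.
rewrite /S -ge0_esumZl; last 2 first.
- exact: ltW.
- by move=> x; rewrite lee_fin expR_ge0.
apply: le_esum => x _; rewrite -EFinM; apply: le_trans (bound x).
rewrite -ge0_sume_distrr; last by move=> n _; exact: pstep_ge0.
apply: lee_wpmul2l; first by rewrite lee_fin expR_ge0.
by apply: nneseries_lim_ge => *; exact: krw_prob_ge0.
Qed.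

End LowerBound.

(** * Uniformity in the direction and the interpolated Green function *)

Section GreenAsymptotics.
Variables (R : realType) (d p : nat).
Variables (c : 'rV[int]_d -> 'I_p -> 'I_p -> R) (m : 'I_p -> R).
Hypothesis hset : lasm_setting c m.
Hypothesis hA : assumptionA c m.
Hypothesis p0 : (0 < p)%N.
Local Notation rho := (rho c m).
Local Notation sublevel := (sublevel c m).
Local Notation support := (support c m).
Local Notation pstep := (pstep c m).

Let hexp : exp_moments c m. Proof. by case: hA. Qed.

Variable j : 'I_p.
Local Notation reach := (reach c m j).

(* Walk along multiples of a good point x in the direction u, then correct the
   remaining displacement by elementary steps. *)
Lemma reach_near (u : 'rV[R]_d) (e : R) : 0 < e -> usphere u ->
  exists b B, 0 < b /\ forall y : 'rV[int]_d, y != 0 ->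
    enorm ((enorm (latt R y))^-1 *: latt R y - u) <= b ->
    reach (support (latt R y) + e * enorm (latt R y) + B) y.
Proof.
move=> e0 su; have [t1 _ tu] := Gamma_invP hset hA p0 su.
set t := Gamma_inv c m u in t1 tu.
have tT : sublevel t by rewrite /sublevel/= -[rho t]/(rho t) t1.
have [M M0 HM] := support_le hset hA p0.
have [C C0 HC] := reach_enorm hset hA j.
have MC : 0 < M + C by rewrite ltr_pwDl.
(* Per unit of |y|, replacing the direction of x by that of y costs at most 2 M b and the final
   correction 2 C b: together e/2. The other e/2 pays for the defect [a] of the good point. *)
pose b := e / (4 * (M + C)).
have b0 : 0 < b by rewrite divr_gt0// mulr_gt0.
have bE : (M + C) * b = e / 4 by rewrite /b; field; rewrite gt_eqF.
pose a := Num.min b (e / 2).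
have a0 : 0 < a by rewrite lt_min b0 divr_gt0.
have [x xN0 [dir rx]] := good_point hset hA p0 j a0 su t1 tu.
set X := latt R x in dir rx; set N := enorm X in dir rx.
have NP : 0 < N by apply: enorm_gt0; rewrite latt_eq0.
exists b, (C * N); split=> // y yN0.
set Y := latt R y; set NY := enorm Y => diry.
have NYP : 0 < NY by apply: enorm_gt0; rewrite latt_eq0.
set X1 := N^-1 *: X in dir; set Y1 := NY^-1 *: Y in diry.
have XE : X = N *: X1 by rewrite /X1 scalerA mulfV ?scale1r// gt_eqF.
have YE : Y = NY *: Y1 by rewrite /Y1 scalerA mulfV ?scale1r// gt_eqF.
have X11 : enorm X1 = 1.
  by rewrite /X1 enormZ ger0_norm ?invr_ge0 ?(ltW NP)// mulVf// gt_eqF.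
(* The multiple of x whose length is closest to |y| from below; the remainder of length less than N
   goes into the constant [C * N]. *)
pose n := Num.truncn (NY / N).
have /truncn_itv/andP[n1 n2] : 0 <= NY / N by rewrite divr_ge0 ?ltW.
rewrite -/n ler_pdivlMr// in n1; rewrite -/n ltr_pdivrMr// in n2.
have yE : y = x *+ n + (y - x *+ n) by rewrite addrC subrK.
have := reachD hset hA (reachMn hset hA n rx) (HC (y - x *+ n)).
rewrite -yE; apply: reach_le.
have Zb : enorm (latt R (y - x *+ n)) <= NY * (2 * b) + N.
  rewrite lattB lattMn -/X -/Y.
  have -> : Y - n%:R *: X = NY *: (Y1 - X1) + (NY - n%:R * N) *: X1.
    by rewrite scalerBr scalerBl -YE addrA subrK -scalerA -XE.
  rewrite (le_trans (enormD _ _))// (enormZ NY) (enormZ (NY - _)) X11 mulr1 lerD//.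
    rewrite gtr0_norm// ler_pM2l//.
    have -> : Y1 - X1 = (Y1 - u) - (X1 - u) by rewrite opprB addrA subrK.
    rewrite (le_trans (enormB _ _))// mulr_natl mulr2n lerD//.
    by rewrite (le_trans dir)// ge_min lexx.
  rewrite ger0_norm ?subr_ge0// lerBlDr -[X in X + _]mul1r -mulrDl.
  by rewrite ltW// addrC natr1.
have tX1 : dotp t X1 <= support Y1 + 2 * M * b.
  have -> : X1 = u + (X1 - u) by rewrite addrC subrK.
  rewrite dotpDr tu.
  have H1 : dotp t (X1 - u) <= M * b.
    rewrite (le_trans (support_ge hset hA p0 _ tT))// (le_trans (HM _))// ler_pM2l//.
    by rewrite (le_trans dir)// ge_min lexx.
  have H2 : support u <= support Y1 + M * b.
    rewrite (le_trans (support_lipschitz hset hA p0 u Y1 HM))// lerD2l ler_pM2l//.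
    by rewrite enorm_subC.
  rewrite (_ : 2 * M * b = M * b + M * b); last by ring.
  by rewrite addrA lerD.
have sY0 : 0 <= support Y1 by apply: support_ge0.
have sYE : support Y = NY * support Y1 by rewrite {1}YE supportZ// ltW.
have ae : a <= e / 2 by rewrite ge_min lexx orbT.
have W1 : n%:R * (dotp t X + a * N) <= NY * (support Y1 + 2 * M * b + e / 2).
  have -> : n%:R * (dotp t X + a * N) = n%:R * N * (dotp t X1 + a).
    by rewrite {1}XE dotpZr; ring.
  apply: (@le_trans _ _ (n%:R * N * (support Y1 + 2 * M * b + e / 2))).
    by rewrite ler_wpM2l ?mulr_ge0 ?(ltW NP)// lerD.
  rewrite ler_wpM2r// addr_ge0 ?divr_ge0 ?(ltW e0)// addr_ge0//.
  by apply/ltW; rewrite mulr_gt0// mulr_gt0.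
have W2 : C * enorm (latt R (y - x *+ n)) <= C * (NY * (2 * b) + N) by rewrite ler_wpM2l.
rewrite (le_trans (lerD W1 W2))// sYE le_eqVlt; apply/orP; left; apply/eqP.
have eE : e = 4 * ((M + C) * b) by rewrite bE; field.
have e2E : e / 2 = 2 * ((M + C) * b) by rewrite bE; field.
by rewrite e2E eE; move: (support Y1) => s; ring.
Qed.

Lemma reach_uniform (e : R) : 0 < e -> exists2 B, 0 <= B &
  forall y : 'rV[int]_d, reach (support (latt R y) + e * enorm (latt R y) + B) y.
Proof.
move=> e0.
(* The property is monotone in B, so the local constants are merged by letting B tend to infinity in
   the covering form of compactness. *)
pose P (B : R) (v : 'rV[R]_d) := forall y : 'rV[int]_d, y != 0 ->
  v = (enorm (latt R y))^-1 *: latt R y ->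
  reach (support (latt R y) + e * enorm (latt R y) + B) y.
have : \forall B \near +oo, usphere `<=` P B.
  apply: (proj1 (compact_near_coveringP _) (@usphere_compact R d)) => u su.
  have [b [B [b0 H]]] := reach_near e0 su.
  near=> v A.
  have BA : B <= A by near: A; apply: nbhs_pinfty_ge; rewrite num_real.
  have vb : enorm (u - v) <= b by near: v; exact: near_enorm_le.
  move=> y yN0 vE; apply: (@reach_le _ _ _ _ _ _ (support (latt R y) + e * enorm (latt R y) + B)).
    by rewrite lerD2l.
  by apply: H => //; rewrite -vE enorm_subC.
move=> H; have : \forall B \near +oo, 0 <= B /\ usphere `<=` P B.
  by near=> B; split; near: B; [apply: nbhs_pinfty_ge; rewrite num_real|].
move=> /filter_ex[B [B0 HB]]; exists B => // y.
have [->|yN0] := eqVneq y 0.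
  apply: reach_le (reach0 c m j).
  by rewrite latt0 support0// enorm0 mulr0 !add0r.
by apply: HB => //; apply: usphere_normalize; rewrite latt_eq0.
Unshelve. all: by end_near. Qed.

Variable i0 : 'I_p.
Local Notation G y := (fine (green c m (0%R, i0) (y, j))).

(** A fixed path without displacement changes colour i0 into j, after which [reach_uniform] applies.
    With error e k, its term e k |y| is absorbed by e times the support function. *)
Lemma green_lower (e : R) : 0 < e -> exists2 b, 0 < b &
  forall y : 'rV[int]_d, b * expR (- ((1 + e) * support (latt R y))) <= G y.
Proof.
move=> e0; have [k k0 Hk] := support_lower hset hA p0.
have [B B0 HB] := reach_uniform (mulr_gt0 e0 k0).
case: hA => _ irr _ _; have [n [_ nP]] := irr 0 i0 j.
have nfin := pstep_fin hset hexp n i0 j 0.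
have q0 : 0 < fine (pstep n i0 j 0) by rewrite -lte_fin fineK.
exists (fine (pstep n i0 j 0) * expR (- B)); first by rewrite mulr_gt0 ?expR_gt0.
move=> y; have [l Hl] := HB y.
rewrite -lee_fin fineK; last exact: green_fin.
apply: (@le_trans _ _ (pstep (n + l) i0 j y)); last first.
  rewrite green_pstep; apply: le_trans (nneseries_lim_ge (n + l).+1 _).
    rewrite big_nat_recr//= leeDr// sume_ge0// => k' _; exact: pstep_ge0.
  by move=> *; exact: pstep_ge0.
have := pstep_mul_le hset hexp n l i0 j j 0 y; rewrite add0r; apply: le_trans.
rewrite -(fineK nfin) -mulrA EFinM; apply: lee_wpmul2l; first by rewrite lee_fin ltW.
apply: le_trans Hl; rewrite -expRD lee_fin ler_expR -opprD lerN2.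
rewrite [B + _]addrC lerD2r mulrDl mul1r lerD2l -mulrA.
by rewrite ler_pM2l.
Qed.

Lemma green_upper_fine (e : R) : 0 < e -> e <= 1 -> exists2 C, 0 < C &
  forall y : 'rV[int]_d, G y <= C * expR (- ((1 - e) * support (latt R y))).
Proof.
move=> e0 e1; have [C C0 HC] := green_upper hset hA p0.
exists (C / e) => [|y]; first by rewrite divr_gt0.
by rewrite -lee_fin fineK ?HC//; exact: green_fin.
Qed.

(** Each coordinate of y is the floor of that of x or its successor, so a boolean per coordinate
    determines y. *)
Lemma finite_unit_ball (x : 'rV[R]_d) :
  finite_set [set y : 'rV[int]_d | `|x - latt R y| < 1].
Proof.
pose F (o : {ffun 'I_d -> bool}) : 'rV[int]_d := \row_k (Num.floor (x 0 k) + (o k : nat)%:Z).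
apply: (@sub_finite_set _ _ (range F)); last exact/finite_image/finite_finset.
move=> y /= xy; exists [ffun k => Num.floor (x 0 k) < y 0 k] => //.
apply/rowP => k; rewrite !mxE ffunE.
have := le_lt_trans (coord_le_normr (x - latt R y) k) xy; rewrite !mxE ltr_norml => /andP[h1 h2].
have f1 := Num.Theory.floor_le (x 0 k); have f2 := Num.Theory.floorD1_gt (x 0 k).
have g1 : Num.floor (x 0 k) <= y 0 k.
  rewrite -ltzD1 -(ltr_int R) intrD; lra.
have g2 : y 0 k < Num.floor (x 0 k) + 2.
  rewrite -(ltr_int R) intrD; rewrite intrD in f2; lra.
by case: ltP => h; move: g1 g2 h; rewrite /=; lia.
Qed.

Lemma tent_ge0 (s : R) : 0 <= tent s.
Proof. by rewrite /tent; case: ifP => // s1; rewrite subr_ge0. Qed.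

Lemma tent_eq0 (s : R) : 1 <= s -> tent s = 0.
Proof.
by move=> s1; rewrite /tent; case: ifP => // s1'; apply/eqP; rewrite subr_eq0 eq_le s1.
Qed.

Let tent_sum (x : 'rV[R]_d) (f : 'rV[int]_d -> R) :
  \sum_(y \in [set: 'rV[int]_d]) tent `|x - latt R y| * f y =
  \sum_(y <- finmap.enum_fset (fset_set [set y : 'rV[int]_d | `|x - latt R y| < 1]))
    tent `|x - latt R y| * f y.
Proof.
rewrite (fsbigTE (fset_set [set y : 'rV[int]_d | `|x - latt R y| < 1]))// => y.
rewrite in_fset_set; last exact: finite_unit_ball.
by rewrite notin_setE /= => /negP; rewrite -leNgt => /tent_eq0 ->; rewrite mul0r.
Qed.

Let tent_sum_gt0 (x : 'rV[R]_d) :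
  0 < \sum_(y \in [set: 'rV[int]_d]) tent `|x - latt R y|.
Proof.
under eq_fsbigr do rewrite -[tent _]mulr1.
rewrite tent_sum; have [y xy] := latt_round x.
have y1 : `|x - latt R y| < 1 by rewrite (le_lt_trans xy)// invf_lt1 ?ltr1n.
rewrite (big_rem y)/=; last first.
  by rewrite in_fset_set ?mem_set//; exact: finite_unit_ball.
rewrite ltr_pwDl//; last by apply: sumr_ge0 => z _; rewrite mulr1 tent_ge0.
by rewrite mulr1 /tent ltW// subr_gt0.
Qed.

(** The extension is a weighted average of the values at lattice points at sup distance less than
    1. *)
Lemma green_ext_between (x : 'rV[R]_d) (a b : R) :
  (forall y : 'rV[int]_d, `|x - latt R y| < 1 -> a <= G y <= b) ->
  a <= green_ext c m i0 j x <= b.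
Proof.
move=> H; have S0 := tent_sum_gt0 x; rewrite /green_ext.
rewrite ler_pdivlMr// ler_pdivrMr//.
have fin := finite_unit_ball x.
have E : \sum_(y \in [set: 'rV[int]_d]) tent `|x - latt R y| =
    \sum_(y <- finmap.enum_fset (fset_set [set y : 'rV[int]_d | `|x - latt R y| < 1]))
    tent `|x - latt R y|.
  by under eq_fsbigr do rewrite -[tent _]mulr1; rewrite tent_sum; under eq_bigr do rewrite mulr1.
rewrite E tent_sum !mulr_sumr; apply/andP; split.
  rewrite big_seq [leRHS]big_seq; apply: ler_sum => y.
  rewrite in_fset_set// inE /= => /H/andP[H1 _].
  by rewrite mulrC ler_wpM2l ?tent_ge0.
rewrite big_seq [leRHS]big_seq; apply: ler_sum => y.
rewrite in_fset_set// inE /= => /H/andP[_ H2].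
by rewrite mulrC ler_wpM2r ?tent_ge0.
Qed.

Lemma green_ext_latt (x : 'rV[int]_d) : green_ext c m i0 j (latt R x) = G x.
Proof.
apply/eqP; rewrite eq_le andbC; apply: green_ext_between => y xy.
suff -> : y = x by rewrite lexx.
apply/rowP => k; have := le_lt_trans (coord_le_normr _ k) xy.
rewrite !mxE -intrB -intr_norm -[1]/(1%:~R) ltr_int; lia.
Qed.

Let support_close (x : 'rV[R]_d) (y : 'rV[int]_d) M : (forall v, support v <= M * enorm v) ->
  0 <= M -> `|x - latt R y| < 1 ->
  support x <= support (latt R y) + M * d%:R /\ support (latt R y) <= support x + M * d%:R.
Proof.
move=> HM M0 xy.
have xy' : enorm (x - latt R y) <= d%:R.
  by rewrite (le_trans (enorm_le_normr _))// ler_piMr// ltW.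
split.
  by rewrite (le_trans (support_lipschitz hset hA p0 x (latt R y) HM))// lerD2l ler_wpM2l.
rewrite (le_trans (support_lipschitz hset hA p0 (latt R y) x HM))// lerD2l ler_wpM2l//.
by rewrite enorm_subC.
Qed.

Lemma green_ext_bounds (e : R) : 0 < e -> e <= 1 -> exists b B, [/\ 0 < b, 0 < B &
  forall x, b * expR (- ((1 + e) * support x)) <= green_ext c m i0 j x <=
            B * expR (- ((1 - e) * support x))].
Proof.
move=> e0 e1; have [b b0 Hb] := green_lower e0; have [B B0 HB] := green_upper_fine e0 e1.
have [M M0 HM] := support_le hset hA p0.
exists (b * expR (- ((1 + e) * (M * d%:R)))), (B * expR ((1 - e) * (M * d%:R))).
split; rewrite ?mulr_gt0 ?expR_gt0// => x; apply: green_ext_between => y xy.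
have [H1 H2] := support_close HM (ltW M0) xy.
apply/andP; split.
  apply: le_trans (Hb y); rewrite -mulrA ler_pM2l// -expRD ler_expR.
  by rewrite -opprD lerN2 -mulrDr ler_wpM2l ?addr_ge0 ?(ltW e0)// addrC.
apply: (le_trans (HB y)); rewrite -mulrA ler_pM2l// -expRD ler_expR.
rewrite -mulrN -mulrN -mulrDr ler_wpM2l ?subr_ge0//.
by rewrite lerNl opprD opprK addrC lerBlDr.
Qed.

End GreenAsymptotics.

(** * Radii and limit shape *)

Section Convergence.
Variable R : realType.

Lemma ln_nat_large (A : R) : exists N0, forall N, (N0 <= N)%N -> A < ln N%:R.
Proof.
exists (Num.truncn (expR A)).+1 => N hN; rewrite -ltr_expR lnK.
  apply: (lt_le_trans (real_truncnS_gt (num_real _))); by rewrite ler_nat.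
by rewrite posrE ltr0n (leq_trans _ hN).
Qed.

Lemma cvg_nat_dist (f : nat -> R) (l : R) :
  (forall e, 0 < e -> exists N0, forall N, (N0 <= N)%N -> `|l - f N| <= e) ->
  f @ \oo --> l.
Proof.
move=> H; apply/cvgrPdist_le => e /H[N0 HN].
by exists N0 => // N /=; exact: HN.
Qed.

Lemma uniform_cvg_nat_dist (T : choiceType) (A : set T) (F : nat -> T -> R) (f : T -> R) :
  (forall e, 0 < e -> exists N0, forall N, (N0 <= N)%N ->
     forall u, A u -> `|f u - F N u| <= e) ->
  {uniform A, F @ \oo --> f}.
Proof.
move=> H P /uniform_nbhs[E [entE EP]].
move: entE; rewrite -entourage_ballE => -[e /= e0 eE].
have [N0 HN] := H _ (divr_gt0 e0 (ltr0Sn _ 1)).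
exists N0 => // N /= hN; apply: EP => u Au; apply: eE => /=.
rewrite -ball_normE /=; apply: (le_lt_trans (HN _ hN _ Au)).
by rewrite ltr_pdivrMr// ltr_pMr// ltr1n.
Qed.

Lemma cvge0_nat (f : nat -> \bar R) :
  (forall e, 0 < e -> exists N0, forall N, (N0 <= N)%N -> (0 <= f N <= e%:E)%E) ->
  f @ \oo --> 0%E.
Proof.
move=> H; apply: cvg_EFin.
  have [N0 HN] := H 1 ltr01; exists N0 => // N /= /HN/andP[f0 f1].
  by rewrite ge0_fin_numE// (le_lt_trans f1)// ltry.
apply: cvg_nat_dist => e /H[N0 HN]; exists N0 => N /HN/andP[f0 fe] /=.
have fN : f N \is a fin_num by rewrite ge0_fin_numE// (le_lt_trans fe)// ltry.
by rewrite sub0r normrN ger0_norm ?fine_ge0// -lee_fin fineK.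
Qed.

(** Here h stands for the support function at u, l for log N and x for a radius. The ratio y = x h /
    l lies between (1 - e) / (1 + e) and (1 + e) / (1 - e), within 4 e of 1 as e <= 1/2. *)
Lemma radius_close (e A l h x : R) : 0 < e -> e <= 2^-1 -> 0 < l -> 0 < h ->
  A <= e * l -> (l - A) / ((1 + e) * h) <= x -> x <= (l + A) / ((1 - e) * h) ->
  `|h^-1 - x / l| <= 4 * e * h^-1.
Proof.
move=> e0 e2 l0 h0 Al; have e1 : 0 < 1 - e by lra.
rewrite ler_pdivrMr ?mulr_gt0// ?addr_gt0// ler_pdivlMr ?mulr_gt0// => H1 H2.
pose y := x * h / l.
have xE : x / l = y * h^-1 by rewrite /y; field; rewrite !gt_eqF.
have yl : y * l = x * h by rewrite /y divfK// gt_eqF.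
rewrite xE -{1}[h^-1]mul1r -mulrBl normrM [`|h^-1|]ger0_norm ?invr_ge0 ?(ltW h0)//.
rewrite ler_wpM2r ?invr_ge0 ?(ltW h0)//.
have {}H1 : l * (1 - e) <= l * (y * (1 + e)).
  have -> : l * (y * (1 + e)) = x * ((1 + e) * h).
    by rewrite mulrA [l * y]mulrC yl; ring.
  by rewrite (le_trans _ H1)//; lra.
have {}H2 : l * (y * (1 - e)) <= l * (1 + e).
  have -> : l * (y * (1 - e)) = x * ((1 - e) * h).
    by rewrite mulrA [l * y]mulrC yl; ring.
  by rewrite (le_trans H2)//; lra.
rewrite ler_pM2l// in H1; rewrite ler_pM2l// in H2.
rewrite ler_norml; apply/andP; split.
  rewrite -(ler_pM2r e1); have : 0 <= e * (2^-1 - e) by rewrite mulr_ge0 ?subr_ge0 ?(ltW e0).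
  move: H2; rewrite !mulrBr !mulrBl !mulr1; lra.
have e1' : 0 < 1 + e by rewrite addr_gt0.
rewrite -(ler_pM2r e1'); have : 0 <= e * e by rewrite mulr_ge0 ?ltW.
move: H1; rewrite !mulrBl !mulrDr !mulr1; lra.
Qed.

End Convergence.

(** * Asymptotics of the radii and of the rescaled shape *)

Section LimitShape.
Variables (R : realType) (d p : nat).
Variables (c : 'rV[int]_d -> 'I_p -> 'I_p -> R) (m : 'I_p -> R).
Variables (i0 j : 'I_p) (alpha beta : R).
Hypothesis d0 : (0 < d)%N.
Hypothesis p0 : (0 < p)%N.
Hypothesis hset : lasm_setting c m.
Hypothesis hA : assumptionA c m.
Hypothesis alpha0 : 0 < alpha.
Hypothesis beta0 : 0 < beta.
Hypothesis hab : shape_constants c m i0 alpha beta.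
Local Notation support := (support c m).
Local Notation inner N u := (inner_set c m i0 j alpha N u).
Local Notation outer N u := (outer_set c m i0 j beta N u).
Local Notation rinner N u := (inner_radius c m i0 j alpha N u).
Local Notation router N u := (outer_radius c m i0 j beta N u).
Local Notation G y := (fine (green c m (0%R, i0) (y, j))).

Lemma support_gt0 u : usphere u -> 0 < support u.
Proof.
move=> su; have [k k0 Hk] := support_lower hset hA p0.
by rewrite (lt_le_trans _ (Hk u))// su mulr1.
Qed.

Lemma limit_radiusE u : usphere u -> limit_radius c m u = (support u)^-1.
Proof. by move=> su; rewrite /limit_radius; have [_ _ ->] := Gamma_invP hset hA p0 su; rewrite div1r. Qed.

Let divNE (a : R) N : 0 < a -> (1 <= N)%N -> a / N%:R = expR (ln a - ln N%:R).
Proof. by move=> a0 N1; rewrite expRB !lnK// posrE ltr0n. Qed.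

Lemma green_ext_exp_bounds (e : R) : 0 < e -> e <= 1 -> exists b B : R, forall x,
  expR (b - (1 + e) * support x) <= green_ext c m i0 j x <=
  expR (B - (1 - e) * support x).
Proof.
move=> e0 e1; have [b [B [b0 B0 H]]] := green_ext_bounds hset hA p0 j i0 e0 e1.
by exists (ln b), (ln B) => x; rewrite !expRD !lnK.
Qed.

Lemma outer_le (e : R) : 0 < e -> e <= 1 -> exists A : R, forall N u r, (1 <= N)%N ->
  usphere u -> outer N u r -> (1 - e) * (r * support u) <= ln N%:R + A.
Proof.
move=> e0 e1; have [b [B H]] := green_ext_exp_bounds e0 e1.
exists (B - ln beta) => N u r N1 su [r0 Hr].
have /andP[_ H2] := H (r *: u); have := le_trans Hr H2.
by rewrite divNE// ler_expR supportZ ?(ltW r0)//; lra.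
Qed.

Lemma radii_bounds (e : R) : 0 < e -> e < 1 -> exists A : R, forall N u, (1 <= N)%N ->
  A < ln N%:R -> usphere u -> let lN := ln N%:R in
  [/\ has_inf (inner N u), has_sup (outer N u),
      (lN - A) / ((1 + e) * support u) <= rinner N u <= (lN + A) / ((1 - e) * support u) &
      (lN - A) / ((1 + e) * support u) <= router N u <= (lN + A) / ((1 - e) * support u)].
Proof.
move=> e0 e1; have [b [B H]] := green_ext_exp_bounds e0 (ltW e1).
have [Ao HAo] := outer_le e0 (ltW e1).
pose A := `|b| + `|B| + `|ln alpha| + `|ln beta| + `|Ao|.
have [A1 A2 A3 A4] : [/\ ln alpha - b <= A, B - ln alpha <= A, ln beta - b <= A & Ao <= A].
  have := ler_norm b; have := ler_norm (- b); have := ler_norm B.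
  have := ler_norm (ln alpha); have := ler_norm (- ln alpha).
  have := ler_norm (ln beta); have := ler_norm Ao; rewrite !normrN.
  have := normr_ge0 b; have := normr_ge0 B; have := normr_ge0 (ln alpha).
  have := normr_ge0 (ln beta); have := normr_ge0 Ao.
  by move=> *; rewrite /A; split; lra.
have A0 : 0 <= A by rewrite !addr_ge0.
exists A => N u N1 AN su lN.
have h0 := support_gt0 su; set h := support u in h0 *.
have e1' : 0 < 1 - e by rewrite subr_gt0.
have e1'' : 0 < 1 + e by rewrite addr_gt0.
have lo0 : 0 < (lN - A) / ((1 + e) * h) by rewrite divr_gt0 ?subr_gt0// mulr_gt0.
have hi0 : 0 < (lN + A) / ((1 - e) * h).
  by rewrite divr_gt0 ?mulr_gt0// ltr_pwDl// (le_lt_trans A0).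
have loE : (1 + e) * ((lN - A) / ((1 + e) * h) * h) = lN - A.
  by field; rewrite !gt_eqF.
have hiE : (1 - e) * ((lN + A) / ((1 - e) * h) * h) = lN + A.
  by field; rewrite !gt_eqF.
have bnd r : 0 <= r -> expR (b - (1 + e) * (r * h)) <= green_ext c m i0 j (r *: u) <=
    expR (B - (1 - e) * (r * h)).
  by move=> r0; have := H (r *: u); rewrite supportZ.
have inner_hi : inner N u ((lN + A) / ((1 - e) * h)).
  split=> //; have /andP[_ H2] := bnd _ (ltW hi0); apply: (le_trans H2).
  by rewrite divNE// ler_expR hiE -/lN; lra.
have inner_lo r : inner N u r -> (lN - A) / ((1 + e) * h) <= r.
  move=> [r0 Hr]; have /andP[H1 _] := bnd _ (ltW r0).
  have := le_trans H1 Hr; rewrite divNE// ler_expR -/lN => H2.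
  by rewrite ler_pdivrMr ?mulr_gt0// [r * _]mulrCA; lra.
have outer_lo : outer N u ((lN - A) / ((1 + e) * h)).
  split=> //; have /andP[H1 _] := bnd _ (ltW lo0); apply: le_trans H1.
  by rewrite divNE// ler_expR loE -/lN; lra.
have outer_hi r : outer N u r -> r <= (lN + A) / ((1 - e) * h).
  move=> Hr; have := HAo _ _ _ N1 su Hr; rewrite -/h -/lN => H2.
  by rewrite ler_pdivlMr ?mulr_gt0// [r * _]mulrCA; lra.
split.
- by split; [exists ((lN + A) / ((1 - e) * h))|exists ((lN - A) / ((1 + e) * h))].
- by split; [exists ((lN - A) / ((1 + e) * h))|exists ((lN + A) / ((1 - e) * h))].
- apply/andP; split.
    by apply: lb_le_inf => //; exists ((lN + A) / ((1 - e) * h)).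
  by apply: ge_inf => //; exists ((lN - A) / ((1 + e) * h)).
- apply/andP; split.
    by apply: ub_le_sup => //; exists ((lN + A) / ((1 - e) * h)).
  by apply: ge_sup => //; exists ((lN - A) / ((1 + e) * h)).
Qed.

Lemma radii_uniform (e : R) : 0 < e -> exists N0, forall N, (N0 <= N)%N ->
  forall u, usphere u -> [/\ has_inf (inner N u), has_sup (outer N u),
    `|(support u)^-1 - rinner N u / ln N%:R| <= e &
    `|(support u)^-1 - router N u / ln N%:R| <= e].
Proof.
move=> e0; have [k k0 Hk] := support_lower hset hA p0.
(* The error 4 f / h(u) of [radius_close] is at most 4 f / k, hence at most e. *)
pose f := Num.min 2^-1 (k * e / 4).
have f0 : 0 < f by rewrite lt_min invr_gt0 ltr0n/= divr_gt0// mulr_gt0.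
have f2 : f <= 2^-1 by rewrite ge_min lexx.
have f1 : f < 1 by rewrite (le_lt_trans f2)// invf_lt1 ?ltr1n.
have [A HA0] := radii_bounds f0 f1.
have [N0 HN] := ln_nat_large (Num.max 0 (Num.max A (A / f))).
exists (maxn 1 N0) => N; rewrite geq_max => /andP[N1 /HN].
rewrite !gt_max => /and3P[l0 lA lAf] u su.
have := HA0 N u N1 lA su; cbv zeta; move=> [hi hs /andP[i1 i2] /andP[g1 g2]]; split=> //.
  apply: (le_trans (radius_close f0 f2 l0 (support_gt0 su) _ i1 i2)).
    by rewrite mulrC -ler_pdivrMr// ltW.
  rewrite ler_pdivrMr ?support_gt0//.
  have : e * (k * 1) <= e * support u by rewrite ler_pM2l// -su Hk.
  have : f <= k * e / 4 by rewrite ge_min lexx orbT.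
  lra.
apply: (le_trans (radius_close f0 f2 l0 (support_gt0 su) _ g1 g2)).
  by rewrite mulrC -ler_pdivrMr// ltW.
rewrite ler_pdivrMr ?support_gt0//.
have : e * (k * 1) <= e * support u by rewrite ler_pM2l// -su Hk.
have : f <= k * e / 4 by rewrite ge_min lexx orbT.
lra.
Qed.

Lemma in_shape_inner N (u : 'rV[R]_d) r x : (1 <= N)%N -> 0 < r -> latt R x = r *: u ->
  r < rinner N u -> in_shape c m i0 N (x, j).
Proof.
move=> N1 r0 xE rin; apply: (@hab N (x, j) N1).1.
have gfin := green_fin hset hA p0 i0 j x.
rewrite -(fineK gfin) lte_fin -(green_ext_latt c m p0 j i0) xE.
rewrite ltNge; apply/negP => H.
have : rinner N u <= r by apply: ge_inf; [exists 0 => s [/ltW]|split].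
by rewrite leNgt rin.
Qed.

Lemma notin_shape_outer N (u : 'rV[R]_d) r x : (1 <= N)%N -> usphere u -> 0 < r ->
  latt R x = r *: u -> router N u < r -> ~ in_shape c m i0 N (x, j).
Proof.
move=> N1 su r0 xE rout; apply: (@hab N (x, j) N1).2.
have gfin := green_fin hset hA p0 i0 j x.
rewrite -(fineK gfin) lte_fin -(green_ext_latt c m p0 j i0) xE.
rewrite ltNge; apply/negP => H.
have h0 := support_gt0 su.
have e0 : 0 < 2^-1 :> R by rewrite invr_gt0.
have e1 : 2^-1 <= 1 :> R by rewrite invf_le1// ler1n.
(* The outer set must be bounded above for its [sup] to dominate its elements; the factor 1 - e only
   has to be positive, and e = 1/2 is a convenient choice. *)
have [A HA0] := outer_le e0 e1.
have : r <= router N u.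
  apply: ub_le_sup; last by split.
  exists (2 * ((ln N%:R + A) / support u)) => s /(HA0 _ _ _ N1 su).
  by rewrite mulrA ler_pdivlMr//; move: (s * _) => y; lra.
by rewrite leNgt rout.
Qed.

(** Compares the shape with level sets of the support function directly through G, so that all
    directions are treated at once. *)
Lemma in_shape_le (e : R) : 0 < e -> e <= 1 -> exists2 A, 0 <= A & forall N x, (1 <= N)%N ->
  in_shape c m i0 N (x, j) -> (1 - e) * support (latt R x) <= ln N%:R + A.
Proof.
move=> e0 e1; have [b [B H]] := green_ext_exp_bounds e0 e1.
exists `|B - ln beta| => // N x N1 shp.
have gfin := green_fin hset hA p0 i0 j x.
have : beta / N%:R <= G x.
  rewrite leNgt; apply/negP => Hb; apply: (@hab N (x, j) N1).2 shp.
  by rewrite -(fineK gfin) lte_fin.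
have /andP[_] := H (latt R x); rewrite (green_ext_latt c m p0) => H2 /le_trans/(_ H2).
rewrite divNE// ler_expR; have := ler_norm (B - ln beta); lra.
Qed.

Lemma in_shape_ge (e : R) : 0 < e -> e <= 1 -> exists2 A, 0 <= A & forall N x, (1 <= N)%N ->
  (1 + e) * support (latt R x) <= ln N%:R - A -> in_shape c m i0 N (x, j).
Proof.
move=> e0 e1; have [b [B H]] := green_ext_exp_bounds e0 e1.
(* The additional 1 makes the comparison with alpha / N strict. *)
exists (`|ln alpha - b| + 1) => [|N x N1 hx]; first by rewrite addr_ge0.
have gfin := green_fin hset hA p0 i0 j x.
apply: (@hab N (x, j) N1).1; rewrite -(fineK gfin) lte_fin.
have /andP[H1 _] := H (latt R x); rewrite (green_ext_latt c m p0) in H1.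
apply: lt_le_trans H1; rewrite divNE// ltr_expR.
have := ler_norm (ln alpha - b); lra.
Qed.

Lemma polar_regionE : polar_region (limit_radius c m) = [set z | support z <= 1].
Proof.
apply/seteqP; split=> z /=.
  move=> [u [r [su r0 rle ->]]]; rewrite supportZ//.
  by rewrite limit_radiusE// in rle; rewrite -ler_pdivlMr ?support_gt0// div1r.
move=> z1; have [->|zN0] := eqVneq z 0.
  have [u su] := usphere_neset R d0; exists u, 0; split=> //; last by rewrite scale0r.
  by rewrite limit_radiusE// invr_ge0 ltW ?support_gt0.
have su := usphere_normalize zN0.
exists ((enorm z)^-1 *: z), (enorm z); split=> //; first exact: enorm_ge0.
  rewrite limit_radiusE// -div1r ler_pdivlMr ?support_gt0//.
  by rewrite -supportZ ?enorm_ge0// enorm_normalize.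
by rewrite enorm_normalize.
Qed.

Lemma shape_sandwich (e : R) : 0 < e -> e <= 1 -> exists N0, forall N, (N0 <= N)%N ->
  [/\ 0 < ln N%:R :> R, d%:R <= e * ln N%:R,
      forall z, solid_shape c m i0 j N z -> support z <= 1 + e &
      forall z, support z <= 1 - e -> exists2 x, in_shape c m i0 N (x, j) &
        `|ln N%:R *: z - latt R x| <= 2^-1].
Proof.
move=> e0 e1; have f0 : 0 < e / 4 by rewrite divr_gt0.
have f1 : e / 4 <= 1 by lra.
have [A A0 HA0] := in_shape_le f0 f1; have [A' A'0 HA'] := in_shape_ge f0 f1.
have [M M0 HM] := support_le hset hA p0.
(* Once log N exceeds Q, all the additive errors together are less than e log N / 2. Working with
   e/4 in the exponents leaves room for them. *)
pose Q := 2 * (A + A' + 2 * (M * d%:R) + d%:R) / e.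
have Md0 : 0 <= M * d%:R by rewrite mulr_ge0// ltW.
have [N0 HN] := ln_nat_large (Num.max 0 Q).
exists (maxn 1 N0) => N; rewrite geq_max => /andP[N1 /HN].
rewrite gt_max => /andP[l0]; rewrite /Q ltr_pdivrMr// => lQ.
set l := ln N%:R in l0 lQ *.
have dR : 0 <= d%:R :> R by [].
have close (y : 'rV[R]_d) (x : 'rV[int]_d) : `|y - latt R x| <= 2^-1 -> enorm (y - latt R x) <= d%:R.
  move=> yx; rewrite (le_trans (enorm_le_normr _))// ler_piMr// (le_trans yx)//.
  by rewrite invf_le1// ler1n.
split=> //; first by lra.
  move=> _ [y [x [shp yx]] <-].
  have /(ler_wpM2l (ltW M0)) Mc := close _ _ yx.
  have H1 := support_lipschitz hset hA p0 y (latt R x) HM.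
  have H2 := HA0 N x N1 shp; rewrite -/l in H2.
  rewrite supportZ ?invr_ge0 ?(ltW l0)// mulrC ler_pdivrMr//.
  have f1' : 0 < 1 - e / 4 by lra.
  have H3 : (1 - e / 4) * support y <= (1 - e / 4) * (support (latt R x) + M * d%:R).
    by rewrite ler_pM2l//; lra.
  have H4 : (1 - e / 4) * (M * d%:R) <= M * d%:R by rewrite ler_piMl//; lra.
  rewrite -(ler_pM2l f1').
  have H5 : 0 <= (e * l) * (1 - e) by rewrite mulr_ge0 ?subr_ge0// mulr_ge0 ?ltW.
  have -> : (1 - e / 4) * ((1 + e) * l) = l + e * l / 2 + (e * l) * (1 - e) / 4 by field.
  rewrite mulrDr in H3; lra.
move=> z z1; have [x yx] := latt_round (l *: z); exists x => //.
apply: HA' => //; rewrite -/l.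
have /(ler_wpM2l (ltW M0)) Mc := close _ _ yx.
have H1 := support_lipschitz hset hA p0 (latt R x) (l *: z) HM.
rewrite enorm_subC supportZ ?(ltW l0)// in H1.
have H2 : l * support z <= l * (1 - e) by rewrite ler_pM2l.
have f1' : 0 < 1 + e / 4 by lra.
have H3 : (1 + e / 4) * support (latt R x) <= (1 + e / 4) * (l * (1 - e) + M * d%:R).
  by rewrite ler_pM2l//; lra.
have H4 : (1 + e / 4) * (M * d%:R) <= 2 * (M * d%:R) by rewrite ler_wpM2r//; lra.
have H5 : 0 <= e * l * e by rewrite !mulr_ge0// ltW.
apply: (le_trans H3); rewrite mulrDr.
have -> : (1 + e / 4) * (l * (1 - e)) = l - e * l * 3 / 4 - e * l * e / 4 by field.
lra.
Qed.

Lemma hausdorff_cvg (E : nat -> set 'rV[R]_d) :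
  (forall e : R, 0 < e -> e <= 1 -> exists N0, forall N, (N0 <= N)%N ->
    (forall z, E N z -> support z <= 1 + e) /\
    (forall z, support z <= 1 - e -> exists2 w, E N w & enorm (z - w) <= e)) ->
  hausdorff_dist (E n) (polar_region (limit_radius c m)) @[n --> \oo] --> 0%E.
Proof.
move=> H; rewrite polar_regionE; apply: cvge0_nat => e e0.
have [k k0 Hk] := support_lower hset hA p0.
have K0 : 0 < k^-1 + 1 by rewrite addr_gt0// invr_gt0.
(* The budget f (1/k + 1) covers a radial contraction, of length at most f/k as |z| <= 1/k on the
   limit region, and an approximation error f. *)
pose f := Num.min 1 (e / (k^-1 + 1)).
have f0 : 0 < f by rewrite lt_min ltr01 divr_gt0.
have f1 : f <= 1 by rewrite ge_min lexx.
have fe : f * (k^-1 + 1) <= e by rewrite -ler_pdivlMr// ge_min lexx orbT.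
have fk : f * k^-1 <= e by rewrite (le_trans _ fe)// ler_pM2l// lerDl.
have [N0 HN] := H f f0 f1; exists N0 => N /HN[H1 H2].
(* The supremum over the nonempty limit region is nonnegative, as a supremum over an empty set would
   not be. *)
have D0 : [set z | support z <= 1] 0 by rewrite /= support0.
have dist_ge0 (x : 'rV[R]_d) (Y : set 'rV[R]_d) : (0 <= set_dist x Y)%E.
  by apply: le_ereal_inf_tmp => _ [y _ <-]; rewrite lee_fin enorm_ge0.
have dist_le (x y : 'rV[R]_d) (Y : set 'rV[R]_d) : Y y -> (set_dist x Y <= (enorm (x - y))%:E)%E.
  by move=> Yy; apply: ereal_inf_lbound; exists y.
apply/andP; split.
  rewrite /hausdorff_dist le_max; apply/orP; right.
  by apply: le_trans (dist_ge0 0 (E N)) _; apply: ereal_sup_ubound; exists 0.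
rewrite /hausdorff_dist ge_max; apply/andP; split.
  apply: ge_ereal_sup => _ [x Ex <-].
  have f1' : 0 < 1 + f by rewrite addr_gt0.
  have Dx : [set z | support z <= 1] ((1 + f)^-1 *: x).
    by rewrite /= supportZ ?invr_ge0 ?(ltW f1')// ler_pdivrMl// mulr1 H1.
  apply: (le_trans (dist_le _ _ _ Dx)); rewrite lee_fin.
  have -> : x - (1 + f)^-1 *: x = (f / (1 + f)) *: x.
    by rewrite -{1}[x]scale1r -scalerBl; congr (_ *: _); field; rewrite gt_eqF.
  rewrite enormZ ger0_norm ?divr_ge0 ?(ltW f0) ?(ltW f1')//.
  apply: le_trans fk; rewrite -mulrA ler_pM2l// ler_pdivrMl//.
  by rewrite ler_pdivlMr// mulrC (le_trans (Hk x))// H1.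
apply: ge_ereal_sup => _ [y Dy <-].
have f1' : 0 <= 1 - f by rewrite subr_ge0.
(* Contract y first, so that it enters the region where approximation by [E N] is guaranteed. *)
have [|w Ew wy] := H2 ((1 - f) *: y).
  by rewrite supportZ// ler_piMr.
apply: (le_trans (dist_le _ _ _ Ew)); rewrite lee_fin.
have -> : y - w = f *: y + ((1 - f) *: y - w).
  by rewrite addrA -scalerDl [f + _]addrC subrK scale1r.
rewrite (le_trans (enormD _ _))// (le_trans _ fe)// mulrDr mulr1 lerD//.
rewrite enormZ (gtr0_norm f0) ler_pM2l// -div1r ler_pdivlMr// mulrC.
exact: le_trans (Hk y) Dy.
Qed.

End LimitShape.

(** * Uniform convergence of the solid shape *)

Section Delimited.
Variables (R : realType) (d p : nat).
Variables (c : 'rV[int]_d -> 'I_p -> 'I_p -> R) (m : 'I_p -> R).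
Variables (i0 j : 'I_p) (alpha beta : R).
Hypothesis d0 : (0 < d)%N.
Hypothesis p0 : (0 < p)%N.
Hypothesis hset : lasm_setting c m.
Hypothesis hA : assumptionA c m.
Hypothesis alpha0 : 0 < alpha.
Hypothesis beta0 : 0 < beta.
Hypothesis hab : shape_constants c m i0 alpha beta.
Local Notation support := (support c m).
Local Notation rad := (limit_radius c m).
Local Notation E n := (solid_shape c m i0 j n.+2).

Let between (n : nat) (b : R) :=
  polar_region (fun u => rad u - b) `<=` E n /\ E n `<=` polar_region (fun u => rad u + b).

Let polar_region_le (f g : 'rV[R]_d -> R) :
  (forall u, usphere u -> f u <= g u) -> polar_region f `<=` polar_region g.
Proof.
move=> fg z [u [r [su r0 rf ->]]]; exists u, r; split=> //.
exact: le_trans rf (fg u su).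
Qed.

Let between_le n (a b : R) : a <= b -> between n a -> between n b.
Proof.
move=> ab [H1 H2]; split.
  by apply: subset_trans H1; apply: polar_region_le => u _; rewrite lerB.
by apply: subset_trans H2 _; apply: polar_region_le => u _; rewrite lerD2l.
Qed.

Let rad_ge0 u : usphere u -> 0 <= rad u.
Proof. by move=> su; rewrite (limit_radiusE p0 hset hA)// invr_ge0 ltW// (support_gt0 p0 hset hA). Qed.

Let in_polar_add (b : R) z : 0 <= b -> (z != 0 -> enorm z <= rad ((enorm z)^-1 *: z) + b) ->
  polar_region (fun u => rad u + b) z.
Proof.
move=> b0 H; have [->|zN0] := eqVneq z 0.
  have [u su] := usphere_neset R d0; exists u, 0; split=> //; last by rewrite scale0r.
  by rewrite addr_ge0// rad_ge0.
exists ((enorm z)^-1 *: z), (enorm z); split; rewrite ?enorm_normalize ?enorm_ge0 ?H//.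
exact: usphere_normalize.
Qed.

(* For large b the inner region is empty and the outer one contains the bounded set E n. *)
Let between_exists n : exists2 b, 0 <= b & between n b.
Proof.
have [k k0 Hk] := support_lower hset hA p0.
have [M M0 HM] := support_le hset hA p0.
have h0 : 0 < 2^-1 :> R by rewrite invr_gt0.
have h1 : 2^-1 <= 1 :> R by rewrite invf_le1// ler1n.
have [A A0 HA0] := in_shape_le j p0 hset hA beta0 hab h0 h1.
have lN : 0 < ln n.+2%:R :> R by rewrite ln_gt0// ltr1n.
set l := ln n.+2%:R in lN.
(* The part 1/k + 1 exceeds every limiting radius; the last term bounds the norms in [E n]. *)
pose b := k^-1 + 1 + l^-1 * (k^-1 * (2 * (l + A) + M * d%:R)).
have ki0 : 0 < k^-1 by rewrite invr_gt0.
have last0 : 0 <= l^-1 * (k^-1 * (2 * (l + A) + M * d%:R)).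
  by rewrite mulr_ge0 ?invr_ge0 ?(ltW lN)// mulr_ge0 ?(ltW ki0)// addr_ge0// mulr_ge0 ?addr_ge0// ltW.
have b0 : 0 <= b by rewrite addr_ge0// addr_ge0// ltW.
exists b => //; split.
  move=> z [u [r [su r0 rb _]]]; exfalso; move: rb; rewrite leNgt => /negP; apply.
  apply: lt_le_trans r0; rewrite subr_lt0 (limit_radiusE p0 hset hA)//.
  apply: (@le_lt_trans _ _ k^-1).
    rewrite lef_pV2 ?posrE ?(support_gt0 p0 hset hA)//.
    by have := Hk u; rewrite su mulr1.
  by rewrite /b -addrA ltrDl ltr_pwDl.
move=> _ [y [x [shp yx]] <-]; apply: in_polar_add => // yN0.
apply: (@le_trans _ _ b); last by rewrite lerDr (rad_ge0 (usphere_normalize yN0)).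
have H1 := HA0 n.+2 x isT shp; rewrite -/l in H1.
have xy : enorm (y - latt R x) <= d%:R.
  by rewrite (le_trans (enorm_le_normr _))// ler_piMr// (le_trans yx).
have H2 := support_lipschitz hset hA p0 y (latt R x) HM.
have H3 : M * enorm (y - latt R x) <= M * d%:R by rewrite ler_pM2l.
have H4 : k * enorm y <= 2 * (l + A) + M * d%:R.
  by rewrite (le_trans (Hk y))//; lra.
rewrite enormZ ger0_norm ?invr_ge0 ?(ltW lN)//.
rewrite /b -[leLHS]add0r lerD//; first by rewrite addr_ge0// ltW.
by rewrite ler_pM2l ?invr_gt0// ler_pdivlMl.
Qed.

Let between_near (e : R) : 0 < e -> exists N0, forall n, (N0 <= n)%N -> between n e.
Proof.
move=> e0; have [k k0 Hk] := support_lower hset hA p0.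
pose f := Num.min 1 (k * e).
have f0 : 0 < f by rewrite lt_min ltr01 mulr_gt0.
have f1 : f <= 1 by rewrite ge_min lexx.
have fk : f <= k * e by rewrite ge_min lexx orbT.
have fh u : usphere u -> f <= support u * e.
  move=> su; rewrite (le_trans fk)// ler_pM2r//.
  by have := Hk u; rewrite su mulr1.
have [N0 HN] := shape_sandwich j p0 hset hA alpha0 beta0 hab f0 f1.
exists N0 => n hn; have [|l0 _ H1 H2] := HN n.+2; first by rewrite ltnW// ltnW.
have hP u (su : usphere u) := support_gt0 p0 hset hA su.
split.
  move=> _ [u [r [su r0 rb ->]]].
  have /H2[x shp xz] : support (r *: u) <= 1 - f.
    rewrite supportZ//; move: rb; rewrite (limit_radiusE p0 hset hA)//.
    rewrite -(ler_pM2r (hP u su)) mulrBl mulVf ?gt_eqF ?hP// => /le_trans; apply.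
    by rewrite lerD2l lerN2 mulrC fh.
  exists (ln n.+2%:R *: (r *: u)); first by exists x.
  by rewrite scalerA mulVf ?scale1r// gt_eqF.
move=> z /H1 z1; apply: in_polar_add => [|zN0]; first exact: ltW.
have su := usphere_normalize zN0.
rewrite (limit_radiusE p0 hset hA)// -(ler_pM2r (hP _ su)) mulrDl mulVf ?gt_eqF ?hP//.
rewrite -(supportZ hset hA p0) ?enorm_ge0// enorm_normalize (le_trans z1)// lerD2l.
by rewrite mulrC fh.
Qed.

Lemma solid_shape_delimited : uniformly_delimited (fun n => E n) (polar_curve rad).
Proof.
(* The near-optimal width at index n. The infimum need not be attained, so 1 / (n + 1) is added to
   make the width admissible; it tends to 0. *)
pose w n := inf [set b | 0 <= b /\ between n b] + n.+1%:R^-1.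
have hasinf n : has_inf [set b | 0 <= b /\ between n b].
  split; first by have [b b0 Hb] := between_exists n; exists b.
  by exists 0 => b [].
have w_between n : between n (w n).
  have np : 0 < n.+1%:R^-1 :> R by rewrite invr_gt0.
  have [b [b0 Hb] bw] := inf_adherent np (hasinf n).
  exact: between_le (ltW bw) Hb.
have w0 n : 0 <= w n.
  rewrite addr_ge0 ?invr_ge0//; apply: lb_le_inf; first exact: (hasinf n).1.
  by move=> b [].
have w_cvg e : 0 < e -> exists N0, forall n, (N0 <= n)%N -> w n <= e.
  move=> e0; have e2 : 0 < e / 2 by rewrite divr_gt0.
  have [N0 HN] := between_near e2.
  exists (maxn N0 (Num.truncn (e / 2)^-1).+1) => n; rewrite geq_max => /andP[hn hn'].
  rewrite /w [e]splitr lerD//.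
    by apply: ge_inf; [exact: (hasinf n).2|split; [exact: ltW|exact: HN]].
  rewrite -[leRHS]invrK lef_pV2 ?posrE ?invr_gt0//.
  apply/ltW/(lt_le_trans (real_truncnS_gt (num_real _))).
  by rewrite ler_nat (leq_trans hn').
have cvgin e : 0 < e -> exists N0, forall n, (N0 <= n)%N ->
    forall u, usphere u -> `|rad u - (rad u - w n)| <= e.
  move=> /w_cvg[N0 HN]; exists N0 => n /HN hn u _.
  by rewrite subKr ger0_norm.
have cvgout e : 0 < e -> exists N0, forall n, (N0 <= n)%N ->
    forall u, usphere u -> `|rad u - (rad u + w n)| <= e.
  move=> /w_cvg[N0 HN]; exists N0 => n /HN hn u _.
  by rewrite opprD addNKr normrN ger0_norm.
exists rad, (fun n u => rad u - w n), (fun n u => rad u + w n); split=> //.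
- move=> u su; split; apply: cvg_nat_dist => e e0.
    by have [N0 HN] := cvgin e e0; exists N0 => N /HN; exact.
  by have [N0 HN] := cvgout e e0; exists N0 => N /HN; exact.
- by split; apply: uniform_cvg_nat_dist.
Qed.

End Delimited.

Theorem theorem1 (R : realType) (d p : nat)
    (c : 'rV[int]_d -> 'I_p -> 'I_p -> R) (m : 'I_p -> R)
    (i0 j : 'I_p) (alpha beta : R)
    (hd : (1 <= d)%N) (hp : (1 <= p)%N)
    (hset : lasm_setting c m) (hA : assumptionA c m)
    (halpha : 0 < alpha) (hbeta : 0 < beta)
    (hab : shape_constants c m i0 alpha beta) :
  (* the radii are well defined for N large enough *)
  (\forall N \near \oo, forall u, usphere u ->
     has_inf (inner_set c m i0 j alpha N u) /\
     has_sup (outer_set c m i0 j beta N u)) /\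
  (* for fixed N, the shape lies between the two radii *)
  (forall (N : nat) (u : 'rV[R]_d) (r : R) (x : 'rV[int]_d),
     (1 <= N)%N -> usphere u -> 0 < r -> latt R x = r *: u ->
     (r < inner_radius c m i0 j alpha N u -> in_shape c m i0 N (x, j)) /\
     (outer_radius c m i0 j beta N u < r -> ~ in_shape c m i0 N (x, j))) /\
  (* limits of the radii, for each u and uniformly in u *)
  (forall u, usphere u ->
     (inner_radius c m i0 j alpha N u / ln N%:R @[N --> \oo]
        --> 1 / dotp (Gamma_inv c m u) u) /\
     (outer_radius c m i0 j beta N u / ln N%:R @[N --> \oo]
        --> 1 / dotp (Gamma_inv c m u) u)) /\
  {uniform usphere,
    (fun N u => inner_radius c m i0 j alpha N u / ln N%:R) @ \oo
      --> limit_radius c m} /\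
  {uniform usphere,
    (fun N u => outer_radius c m i0 j beta N u / ln N%:R) @ \oo
      --> limit_radius c m} /\
  (* limit shape; the sequences start at N = 2, where log N > 0 *)
  uniformly_delimited (fun n => solid_shape c m i0 j n.+2)
    [set (dotp (Gamma_inv c m u) u)^-1 *: u | u in usphere] /\
  hausdorff_dist (solid_shape c m i0 j n.+2) (polar_region (limit_radius c m))
    @[n --> \oo] --> 0%E /\
  hausdorff_dist (lattice_shape c m i0 j n.+2) (polar_region (limit_radius c m))
    @[n --> \oo] --> 0%E.
Proof.
have radE (u : 'rV[R]_d) : usphere u -> limit_radius c m u = (support c m u)^-1.
  exact: limit_radiusE.
have radii := radii_uniform i0 j hp hset hA halpha hbeta.
have inner_unif e : 0 < e -> exists N0, forall N, (N0 <= N)%N ->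
    forall u, usphere u -> `|limit_radius c m u - inner_radius c m i0 j alpha N u / ln N%:R| <= e.
  move=> /radii[N0 HN]; exists N0 => N hN u su.
  by rewrite radE//; have [] := HN N hN u su.
have outer_unif e : 0 < e -> exists N0, forall N, (N0 <= N)%N ->
    forall u, usphere u -> `|limit_radius c m u - outer_radius c m i0 j beta N u / ln N%:R| <= e.
  move=> /radii[N0 HN]; exists N0 => N hN u su.
  by rewrite radE//; have [] := HN N hN u su.
have sandwich := shape_sandwich j hp hset hA halpha hbeta hab.
split.
  have [N0 HN] := radii 1 ltr01; exists N0 => // N /= hN u su.
  by have [] := HN N hN u su.
split.
  move=> N u r x N1 su r0 xE; split.
    exact: (in_shape_inner hp hset hA hab N1 r0 xE).
  exact: (notin_shape_outer hp hset hA hbeta hab N1 su r0 xE).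
split.
  move=> u su; split; apply: cvg_nat_dist => e e0.
    by have [N0 HN] := inner_unif e e0; exists N0 => N hN; exact: HN.
  by have [N0 HN] := outer_unif e e0; exists N0 => N hN; exact: HN.
split; first exact: uniform_cvg_nat_dist.
split; first exact: uniform_cvg_nat_dist.
split.
  have := solid_shape_delimited j hd hp hset hA halpha hbeta hab.
  rewrite (_ : polar_curve _ = [set (dotp (Gamma_inv c m u) u)^-1 *: u | u in usphere])//.
  by apply: eq_imagel => u _; rewrite /limit_radius div1r.
split; apply: hausdorff_cvg => // e e0 e1.
  have [N0 HN] := sandwich e e0 e1; exists N0 => n hn.
  have [|l0 dl H1 H2] := HN n.+2; first by rewrite ltnW// ltnW.
  split=> // z /H2[x shp xz]; exists z; last by rewrite subrr enorm0 ltW.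
  exists (ln n.+2%:R *: z); first by exists x.
  by rewrite scalerA mulVf ?scale1r// gt_eqF.
have [N0 HN] := sandwich e e0 e1; exists N0 => n hn.
have [|l0 dl H1 H2] := HN n.+2; first by rewrite ltnW// ltnW.
split=> [_ [x shp <-]|z /H2[x shp xz]].
  by apply: H1; exists (latt R x) => //; exists x; rewrite subrr normr0.
(* Rounding moves z by at most d / log N, and [dl] makes this at most e. *)
exists ((ln n.+2%:R)^-1 *: latt R x); first by exists x.
have -> : z - (ln n.+2%:R)^-1 *: latt R x = (ln n.+2%:R)^-1 *: (ln n.+2%:R *: z - latt R x).
  by rewrite scalerBr scalerA mulVf ?scale1r// gt_eqF.
rewrite enormZ ger0_norm ?invr_ge0 ?(ltW l0)// ler_pdivrMl// mulrC.
rewrite (le_trans _ dl)// (le_trans (enorm_le_normr _))// ler_piMr// (le_trans xz)//.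
by rewrite invf_le1// ler1n.
Qed.
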